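(* For every integer $n\ge 2$, \[ \nabla E_{n,1}=t^{n-1}\,Q_{n-1,n}\,(-1)^n, \] where the right-hand side is the operator $Q_{n-1,n}$ applied to the constant symmetric function $(-1)^n$.
   Context: Work in the ring of symmetric functions over $\mathbb{Q}(q,t)$, with plethystic notation $F[\cdot]$, and $M=(1-t)(1-q)$. $\widetilde H_\mu[X;q,t]$ denotes the modified Macdonald polynomials, and $\nabla$ is the linear operator with $\nabla\widetilde H_\mu=t^{\sum_{c\in\mu}\operatorname{leg}(c)}q^{\sum_{c\in\mu}\operatorname{arm}(c)}\widetilde H_\mu$. For $k\in\mathbb{Z}$ define operators $D_kF[X]=F[X+M/z]\sum_{i\ge0}(-z)^ie_i[X]\big|_{z^k}$ and $D_k^*F[X]=F[X-(1-1/t)(1-1/q)/z]\sum_{i\ge0}z^ih_i[X]\big|_{z^k}$ (coefficient of $z^k$). For coprime positive integers $m,n$ define $Q_{m,n}$ recursively: $Q_{1,n}=D_n$; if $m>1$, let $(a,b)$ be the lattice point with $1\le a\le m-1$ lying below the segment from $(0,0)$ to $(m,n)$ and closest to it, let $(c,d)=(m,n)-(a,b)$, and set $Q_{m,n}=\frac{1}{M}(Q_{c,d}Q_{a,b}-Q_{a,b}Q_{c,d})$. The symmetric functions $E_{n,k}$ are defined by $e_n\!\left[X\frac{1-z}{1-q}\right]=\sum_{k=1}^n\frac{(z;q)_k}{(q;q)_k}E_{n,k}$, where $(z;q)_k=(1-z)(1-zq)\cdots(1-zq^{k-1})$. *)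

(* Defs.v *)
From HB Require Import structures.
From mathcomp Require Import all_boot all_order all_algebra.
From mathcomp Require Import finmap.
From mathcomp Require Import fraction.
From mathcomp.multinomials Require Import monalg.

Set Implicit Arguments.
Unset Strict Implicit.
Unset Printing Implicit Defensive.

Import Order.TTheory GRing.Theory Num.Theory.
Local Open Scope ring_scope.

Definition Fqt : fieldType := {fraction {poly {poly rat}}}.
Definition qv : Fqt := @FracField.tofrac _ (('X : {poly rat})%:P).
Definition tv : Fqt := @FracField.tofrac _ ('X : {poly {poly rat}}).
Definition Mqt : Fqt := (1 - tv) * (1 - qv).

(* The ring of symmetric functions over Q(q,t), presented as the         *)
(* polynomial ring in the (algebraically independent) power sums          *)
(* p_1, p_2, ...: the monomial  ucm i  stands for p_(i+1).                *)
Definition Sym : comAlgType Fqt := {malg Fqt[{cmonom nat}]}.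

Definition psum (k : nat) : Sym := << @ucm nat k.-1 >>.

Definition cst (c : Fqt) : Sym := c%:MP.

(* Generic plethystic substitution: the ring morphism Sym -> S that is    *)
(* emb on coefficients and sends p_k to img k.  All plethysms used below  *)
(* (X -> X + M/z, X -> X(1-q), X -> X(1-z)/(1-q), ...) are of this form,  *)
(* with img k = p_k[...] computed by the usual plethystic rules.          *)
Definition pleth (S : comRingType) (emb : Fqt -> S) (img : nat -> S)
  (f : Sym) : S :=
  \sum_(m <- msupp f) emb (f@_m) * \prod_(i <- finsupp m) img i.+1 ^+ m i.

(* Elementary and complete homogeneous symmetric functions, via Newton's  *)
(* identities  n e_n = sum_(i=1..n) (-1)^(i-1) e_(n-i) p_i,                *)
(*             n h_n = sum_(i=1..n) h_(n-i) p_i.                          *)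
Fixpoint e_upto (n : nat) : seq Sym :=
  if n is n'.+1 then
    let s := e_upto n' in
    rcons s ((n'.+1%:R : Fqt)^-1 *:
      \sum_(i < n'.+1) ((-1) ^+ i * nth 0 s (n' - i) * psum i.+1))
  else [:: 1].
Definition elem (n : nat) : Sym := nth 0 (e_upto n) n.

Fixpoint h_upto (n : nat) : seq Sym :=
  if n is n'.+1 then
    let s := h_upto n' in
    rcons s ((n'.+1%:R : Fqt)^-1 *:
      \sum_(i < n'.+1) (nth 0 s (n' - i) * psum i.+1))
  else [:: 1].
Definition hom (n : nat) : Sym := nth 0 (h_upto n) n.

Definition homz (k : int) : Sym :=
  match k with Posz n => hom n | Negz _ => 0 end.
Definition sgn_elemz (k : int) : Sym :=
  match k with Posz n => (-1) ^+ n * elem n | Negz _ => 0 end.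

Definition is_part (la : seq nat) : bool :=
  sorted geq la && all (fun x => 0 < x)%N la.

Definition conj_part (la : seq nat) : seq nat :=
  [seq count (fun x => i < x)%N la | i <- iota 0 (head 0%N la)].

Definition dominates (la mu : seq nat) : Prop :=
  forall k, (\sum_(i < k) nth 0 mu i <= \sum_(i < k) nth 0 la i)%N.

(* Schur functions via the Jacobi-Trudi identity s_la = det(h_(la_i-i+j)) *)
Definition schur (la : seq nat) : Sym :=
  \det (\matrix_(i < size la, j < size la)
          homz ((nth 0%N la i)%:Z - i%:Z + j%:Z)).

(* Hall scalar product: <p_la, p_mu> = z_la delta_(la,mu) *)
Definition zee (m : {cmonom nat}) : Fqt :=
  \prod_(i <- finsupp m) ((i.+1 ^ m i * (m i)`!)%N)%:R.
Definition hall (f g : Sym) : Fqt :=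
  \sum_(m <- msupp f) f@_m * g@_m * zee m.

Definition in_schur_span_dom (n : nat) (mu : seq nat) (G : Sym) : Prop :=
  exists l : seq (Fqt * seq nat),
    (forall x, x \in l -> [/\ is_part x.2, sumn x.2 = n & dominates x.2 mu])
    /\ G = \sum_(x <- l) x.1 *: schur x.2.

Definition pleth_X1mq (f : Sym) : Sym :=
  pleth cst (fun k => cst (1 - qv ^+ k) * psum k) f.
Definition pleth_X1mt (f : Sym) : Sym :=
  pleth cst (fun k => cst (1 - tv ^+ k) * psum k) f.

(* Haiman's characterization of the modified Macdonald polynomial H~_mu:  *)
(*   H~_mu[X(1-q)] in span{s_la : la >= mu},                               *)
(*   H~_mu[X(1-t)] in span{s_la : la >= mu'},  <H~_mu, s_(n)> = 1.        *)
Definition is_modMacdonald (mu : seq nat) (H : Sym) : Prop :=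
  [/\ in_schur_span_dom (sumn mu) mu (pleth_X1mq H),
      in_schur_span_dom (sumn mu) (conj_part mu) (pleth_X1mt H)
    & hall H (schur [:: sumn mu]) = 1].

Definition sum_leg (mu : seq nat) : nat :=
  \sum_(i < size mu) \sum_(j < nth 0 mu i) count (fun x => j < x)%N (drop i.+1 mu).
Definition sum_arm (mu : seq nat) : nat :=
  \sum_(i < size mu) \sum_(j < nth 0 mu i) (nth 0 mu i - j - 1)%N.

Definition is_nabla (H : seq nat -> Sym) (nab : {linear Sym -> Sym}) : Prop :=
  forall mu, is_part mu ->
    nab (H mu) = (tv ^+ sum_leg mu * qv ^+ sum_arm mu) *: H mu.

(* The operators D_k.  With w = 1/z, F[X + M/z] = sum_j A_j w^j in Sym[w] *)
(* (p_k |-> p_k + p_k[M] w^k, p_k[M] = (1-t^k)(1-q^k)); multiplying by     *)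
(* sum_i (-z)^i e_i and taking the coefficient of z^k gives                *)
(* sum_j A_j (-1)^(j+k) e_(j+k).                                          *)
Definition pleth_XMz (f : Sym) : {poly Sym} :=
  pleth (fun c => (cst c)%:P)
        (fun k => (psum k)%:P + (cst ((1 - tv ^+ k) * (1 - qv ^+ k)))%:P * 'X^k) f.

Definition Dop (k : int) (f : Sym) : Sym :=
  let A := pleth_XMz f in
  \sum_(j < size A) A`_j * sgn_elemz (j%:Z + k).

(* The lattice point (a,b), 1 <= a <= m-1, below the segment (0,0)-(m,n)  *)
(* closest to it: for each a the best b is the largest b with b m < a n,  *)
(* and the distance is proportional to a n - b m.                          *)
Definition best_b (m n a : nat) : nat := ((a * n).-1 %/ m)%N.
Definition lat_dist (m n a : nat) : nat := (a * n - best_b m n a * m)%N.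
Definition split_a (m n : nat) : nat :=
  let cands := iota 1 m.-1 in
  nth 0%N cands
    (find (fun a => all (fun a' => lat_dist m n a <= lat_dist m n a')%N cands) cands).
Definition split_b (m n : nat) : nat := best_b m n (split_a m n).

Fixpoint Qfuel (fuel m n : nat) (f : Sym) : Sym :=
  if fuel is fuel'.+1 then
    if (m <= 1)%N then Dop n%:Z f
    else
      let a := split_a m n in let b := split_b m n in
      let c := (m - a)%N in let d := (n - b)%N in
      Mqt^-1 *: (Qfuel fuel' c d (Qfuel fuel' a b f)
                 - Qfuel fuel' a b (Qfuel fuel' c d f))
  else 0.

(* Q_{m,n}, for coprime positive m, n *)
Definition Qop (m n : nat) (f : Sym) : Sym := Qfuel m m n f.

Definition pleth_X1mz_1mq (f : Sym) : {poly Sym} :=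
  pleth (fun c => (cst c)%:P)
        (fun k => (cst ((1 - qv ^+ k)^-1) * psum k)%:P * (1 - 'X^k)) f.
Definition zq_poch (k : nat) : {poly Sym} :=
  \prod_(i < k) (1 - (cst (qv ^+ i))%:P * 'X).
Definition qq_poch (k : nat) : Fqt := \prod_(i < k) (1 - qv ^+ i.+1).

Definition is_E_family (n : nat) (E : nat -> Sym) : Prop :=
  pleth_X1mz_1mq (elem n) =
    \sum_(1 <= k < n.+1) ((qq_poch k)^-1 *: E k)%:P * zq_poch k.

(* Main.v *)
From HB Require Import structures.
From mathcomp Require Import all_boot all_order all_algebra.
From mathcomp Require Import finmap fraction fingroup perm.
From mathcomp.multinomials Require Import monalg.
From mathcomp Require Import ring zify.
Require Import Defs.

(** Setting z = 1/q in the definition of the E_(n,k) gives E_(n,1) = (-1/q)^(n-1) h_n,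
    and h_n = D*_n 1.  Conjugation by nabla turns D*_1 into multiplication by e_1, and
    the latter into -D_1.  Since D*_(n+1) is a multiple of [D*_n, e_1], while Q_(n,n+1)
    is a multiple of [Q_(n-1,n), D_1], the conjugate of D*_n is a multiple of Q_(n-1,n).

    The two conjugation formulas follow from the action of D_0, D*_0 and e_1 on the
    Macdonald polynomials.  After X -> X(1-q) the operator D_0 is upper triangular on
    Schur functions for dominance (Jacobi-Trudi and straightening), and likewise after
    X -> X(1-t); so the two triangularity axioms force each H_mu to be an eigenvector
    of D_0 and D*_0, with distinct eigenvalues since q and t are independent.  The
    relation [D*_0, [D_0, e_1]] = M (1-1/t)(1-1/q) e_1 then says that if H_nu occurs
    in e_1 H_mu, the difference f of the cell generating polynomials of nu and mu
    satisfies f(q,t) f(1/q,1/t) = 1.  Hence f is a monomial and nu is mu plus one cell,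
    whose weight is the ratio of the eigenvalues of nabla. *)

Set Implicit Arguments.
Unset Strict Implicit.
Unset Printing Implicit Defensive.

Import GRing.Theory.
Local Open Scope ring_scope.

(** Both operator families are instances of one vertex operator, a translation X -> X + A/z followed
    by multiplication by a series in z. Such a family is determined by its values at 1 and by the
    rule for passing a power sum, so commutators, conjugation by a plethysm and rescaling of z are
    all settled by induction on power sums.

    The H_mu are known only through two triangularities and a normalisation, and neither
    triangularity alone isolates H_mu. Each shows that D_0 H_mu - lambda_mu H_mu is killed by a
    product of factors D_0 - lambda_nu: over nu strictly above mu in one case, over nu whose
    conjugate is strictly above the conjugate of mu in the other. The two sets of roots are disjoint
    because conjugation reverses dominance. That the H_mu span everything is a consequence as well,
    since a vanishing leading coefficient would force H_mu = 0.

    The equation f(q,t) f(1/q,1/t) = 1 leaves the sign of the monomial f open; homogeneity fixes it,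
    the coefficients of f having sum |nu| - |mu| = 1. *)

HB.instance Definition _ := GRing.RMorphism.copy cst (@malgC {cmonom nat} Fqt).

(** * Plethysms as ring morphisms, and induction on symmetric functions *)

Section Plethysm.
Variables (S : comNzRingType) (emb : {rmorphism Fqt -> S}) (img : nat -> S).

Definition monom_eval (m : {cmonom nat}) : S :=
  \prod_(i <- finsupp m) img i.+1 ^+ m i.

Lemma monom_evalEw (m : {cmonom nat}) (d : {fset nat}) :
  (finsupp m `<=` d)%fset -> monom_eval m = \prod_(i <- d) img i.+1 ^+ m i.
Proof.
move=> sub; rewrite /monom_eval (big_fset_incl _ sub) // => i _.
by rewrite -cmE_eq0 => /eqP->; rewrite expr0.
Qed.

Lemma monom_eval_mmorphism : mmorphism monom_eval.
Proof.
split; last by rewrite /monom_eval mdom1 big_seq_fset0.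
move=> m1 m2; have s1 := fsubsetUl (finsupp m1) (finsupp m2).
have s2 := fsubsetUr (finsupp m1) (finsupp m2).
rewrite (monom_evalEw s1) (monom_evalEw s2) /monom_eval mdomD -big_split /=.
by apply: eq_bigr => i _; rewrite cmM exprD.
Qed.

HB.instance Definition _ :=
  monalg.isMultiplicative.Build {cmonom nat} S monom_eval monom_eval_mmorphism.

HB.instance Definition _ :=
  GRing.RMorphism.copy (pleth emb img : Sym -> S) (mmap emb monom_eval).

Lemma plethE f : pleth emb img f = mmap emb monom_eval f.
Proof. by []. Qed.

Lemma pleth_scale c f : pleth emb img (c *: f) = emb c * pleth emb img f.
Proof. by rewrite !plethE [LHS]mmapZ. Qed.

Lemma pleth_psum k : pleth emb img (psum k.+1) = img k.+1.
Proof.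
rewrite plethE mmapU /= rmorph1.
by rewrite mul1r /monom_eval mdomU big_seq_fset1 cmUU expr1.
Qed.
End Plethysm.

Lemma cst_scale c f : cst c * f = c *: f.
Proof. exact: mul_malgC. Qed.

Lemma cmonom_ind (I : choiceType) (P : {cmonom I} -> Prop) :
  P (@mone _) -> (forall i m, P m -> P (mmul (ucm i) m)) -> forall m, P m.
Proof.
move=> P1 PU m; have [n le_mn] := ubnP (mdeg m).
elim: n m le_mn => [|n IHn] m; first by rewrite ltn0.
have [->|m1 lt_mn] := eqVneq m (@mone _); first by move=> _; exact: P1.
have [i im] : exists i, i \in finsupp m.
  move: m1; rewrite -mdeg_eq0 mdegE.
  have [->|[i im]] := fset_0Vmem (finsupp m); first by rewrite big_seq_fset0.
  by move=> _; exists i.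
rewrite -cmE_neq0 in im.
have def_m : m = mmul (ucm i) (divcm m (ucm i)).
  apply/eqP/cmP => j; rewrite cmM divcmE !ucmE.
  by have [<-|] := eqVneq; lia.
rewrite def_m; apply/PU/IHn; move: lt_mn; rewrite {1}def_m mdegM mdegU; lia.
Qed.

Lemma malgU_scale (R : nzRingType) (K : choiceType) (c : R) (k : K) :
  << c *g k >> = c *: << k >> :> {malg R[K]}.
Proof. by apply/malgP => k'; rewrite mcoeffZ !mcoeffU mulr_natr. Qed.

Lemma malg_ind (R : nzRingType) (K : choiceType) (P : {malg R[K]} -> Prop) :
  (forall c f g, P f -> P g -> P (c *: f + g)) -> P 0 ->
  (forall k, P << k >>) -> forall f, P f.
Proof.
move=> Plin P0 PU f; rewrite [f]monalgE.
elim: (enum_fset _) => [|m s IHs]; first by rewrite big_nil; exact: P0.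
by rewrite big_cons malgU_scale; apply: Plin.
Qed.

(** Operator identities are checked through this principle: linearity, the value at 1, and the
    passage across one power sum. *)
Lemma Sym_ind (P : Sym -> Prop) :
  (forall c f g, P f -> P g -> P (c *: f + g)) -> P 0 -> P 1 ->
  (forall r f, P f -> P (psum r.+1 * f)) -> forall f, P f.
Proof.
move=> Plin P0 P1 Pp; apply: (malg_ind Plin P0) => m.
elim/cmonom_ind: m => [|i m Pm]; first exact: P1.
have -> : << mmul (ucm i) m >> = psum i.+1 * << m >> :> Sym.
  by rewrite [RHS]malgM_def fgmulUU mulr1.
exact: Pp Pm.
Qed.

(** * Newton's identities *)

Section Newton.
Variable R : comNzRingType.
Implicit Types p a b : nat -> R.

(* The formal version of [sum_n a_n z^n = exp (sum_k p_k z^k / k)]. *)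
Definition newton p a :=
  a 0%N = 1 /\ forall n, n.+1%:R * a n.+1 = \sum_(i < n.+1) a (n - i)%N * p i.+1.

Definition conv a b n := \sum_(i < n.+1) a i * b (n - i)%N.

Definition torsion_free := forall n (x : R), n.+1%:R * x = 0 -> x = 0.

(** Cancelling [n.+1] determines each term from the earlier ones. Two plethystic images of the h_n
    are thus equal as soon as the power sums behind them are. *)
Lemma newton_uniq p a b : torsion_free -> newton p a -> newton p b -> a =1 b.
Proof.
move=> tf [a0 aS] [b0 bS] n; have [N] := ubnP n; elim: N n => // N IHN [|n] lt.
  by rewrite a0 b0.
apply/eqP; rewrite -subr_eq0; apply/eqP/(tf n).
rewrite mulrBr aS bS -sumrB big1 // => i _; have lt_i := ltn_ord i.
by rewrite IHN ?subrr //; lia.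
Qed.

Lemma eq_newton p p' a a' :
  (forall k, p k.+1 = p' k.+1) -> a =1 a' -> newton p a -> newton p' a'.
Proof.
move=> ep ea [a0 aS]; split=> [|n]; rewrite -ea // aS.
by apply: eq_bigr => i _; rewrite ea ep.
Qed.

Lemma coef_conv a b N n : (n < N)%N ->
  (\poly_(i < N) a i * \poly_(i < N) b i)`_n = conv a b n.
Proof.
move=> ltnN; rewrite coefM; apply: eq_bigr => i _; have lt_i := ltn_ord i.
by rewrite !coef_poly !ifT //; lia.
Qed.

(** Power sums are logarithmic derivatives, so they add under products: if A' = A P and B' = B Q,
    then (A B)' = A B (P + Q). Truncation beyond degree n+1 loses nothing in the coefficient of
    degree n. *)
Lemma newton_conv p q a b :
  newton p a -> newton q b -> newton (fun k => p k + q k) (conv a b).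
Proof.
move=> [a0 aS] [b0 bS]; split=> [|n].
  by rewrite /conv big_ord1 a0 b0 mulr1.
pose A := \poly_(i < n.+2) a i; pose B := \poly_(i < n.+2) b i.
pose P := \poly_(i < n.+2) p i.+1; pose Q := \poly_(i < n.+2) q i.+1.
have dcoef (c r : nat -> R) (cS : forall m, m.+1%:R * c m.+1 =
    \sum_(i < m.+1) c (m - i)%N * r i.+1) m : (m <= n)%N ->
    ((\poly_(i < n.+2) c i)^`())`_m =
    (\poly_(i < n.+2) c i * \poly_(i < n.+2) r i.+1)`_m.
  move=> le_mn; rewrite coef_deriv coef_poly ltnS ltnS le_mn -mulr_natl cS.
  rewrite coefMr; apply: eq_bigr => i _; have lt_i := ltn_ord i.
  by rewrite !coef_poly !ifT //; lia.
have -> : n.+1%:R * conv a b n.+1 = ((A * B)^`())`_n.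
  by rewrite coef_deriv coef_conv // mulr_natl.
have -> : ((A * B)^`())`_n = (A * B * (P + Q))`_n.
  rewrite derivM mulrDr !coefD; congr (_ + _).
    rewrite mulrAC coefM [RHS]coefM; apply: eq_bigr => i _.
    by rewrite (dcoef a p) // -ltnS.
  rewrite -mulrA coefM [RHS]coefM; apply: eq_bigr => i _.
  by rewrite (dcoef b q) // leq_subr.
rewrite coefMr; apply: eq_bigr => i _; have lt_i := ltn_ord i.
rewrite coef_conv; last by lia.
by rewrite coefD !coef_poly !ifT //; lia.
Qed.

Lemma newton_scale p a r :
  newton p a -> newton (fun k => r ^+ k * p k) (fun n => r ^+ n * a n).
Proof.
move=> [a0 aS]; split=> [|n]; first by rewrite expr0 mul1r.
rewrite mulrCA aS mulr_sumr; apply: eq_bigr => i _.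
have -> : r ^+ n.+1 = r ^+ (n - i) * r ^+ i.+1.
  by rewrite -exprD; congr (_ ^+ _); have := ltn_ord i; lia.
by ring.
Qed.
End Newton.

Lemma newton_morph (R S : comNzRingType) (f : {rmorphism R -> S}) p a :
  newton p a -> newton (f \o p) (f \o a).
Proof.
move=> [a0 aS]; split=> [|n] /=; first by rewrite a0 rmorph1.
rewrite -(rmorph_nat f) -rmorphM aS rmorph_sum.
by apply: eq_bigr => i _; rewrite rmorphM.
Qed.

Lemma Fqt_nat_neq0 n : n.+1%:R != 0 :> Fqt.
Proof.
rewrite -(rmorph_nat (@FracField.tofrac {poly {poly rat}})) tofrac_eq0.
by rewrite -!polyC_natr !polyC_eq0 Num.Theory.pnatr_eq0.
Qed.

Lemma Sym_torsion_free : torsion_free Sym.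
Proof.
move=> n x; rewrite mulr_natl -scaler_nat => nx0.
by rewrite -[x](scalerK (Fqt_nat_neq0 n)) nx0 scaler0.
Qed.

Lemma poly_torsion_free (R : comNzRingType) :
  torsion_free R -> torsion_free {poly R}.
Proof.
move=> tf n x nx0; apply/polyP => i; rewrite coef0; apply: (tf n).
by rewrite -[LHS]coefCM polyC_natr nx0 coef0.
Qed.

Section NewtonExamples.
Variable R : comNzRingType.
Implicit Types (r : R) (a p : nat -> R).

Lemma newton_geometric r : newton (fun k => r ^+ k) (fun n => r ^+ n).
Proof.
split=> [|n]; first by rewrite expr0.
rewrite (eq_bigr (fun=> r ^+ n.+1)) => [|i _].
  by rewrite sumr_const card_ord mulr_natl.
by rewrite -exprD; congr (_ ^+ _); have := ltn_ord i; lia.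
Qed.

(** Coefficients of 1 - r z, the inverse of the geometric series; hence the negated power sums in
    [newton_lin]. *)
Definition lin_seq r n : R := nth 0 [:: 1; - r] n.

Lemma newton_lin r : newton (fun k => - r ^+ k) (lin_seq r).
Proof.
split=> // -[|n].
  by rewrite big_ord1 subn0 /lin_seq /= !mul1r.
rewrite /lin_seq /= nth_nil mulr0 big_ord_recr big_ord_recr /= subnn subSnn /=.
rewrite big1 ?add0r => [|i _].
  by rewrite mul1r mulrNN [_ ^+ n.+2]exprS subrr.
have -> : (n.+1 - i = (n - i.+1).+2)%N by have := ltn_ord i; lia.
by rewrite /= nth_nil mul0r.
Qed.

Lemma conv_linS a r n : conv a (lin_seq r) n.+1 = a n.+1 - r * a n.
Proof.
rewrite /conv big_ord_recr big_ord_recr /= subnn subSnn /= big1 => [|i _].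
  by rewrite add0r mulr1 mulrN mulrC addrC.
have -> : (n.+1 - i = (n - i.+1).+2)%N by have := ltn_ord i; lia.
by rewrite /lin_seq /= nth_nil mulr0.
Qed.

Lemma conv0 a b : conv a b 0 = a 0%N * b 0%N.
Proof. by rewrite /conv big_ord1. Qed.

Definition geo_sum r n := \sum_(i < n) r ^+ i.

Lemma geo_sumS r n : geo_sum r n.+1 = 1 + r * geo_sum r n.
Proof.
rewrite /geo_sum big_ord_recl mulr_sumr; congr (_ + _).
by apply: eq_bigr => i _; rewrite exprS.
Qed.

Lemma geo_sumSr r n : geo_sum r n.+1 = geo_sum r n + r ^+ n.
Proof. by rewrite /geo_sum big_ord_recr. Qed.

(* The coefficients of the expansion of (1-tz)(1-qz)/((1-z)(1-tqz)). *)
Definition M_coef (t q : R) n :=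
  if n is m.+1 then (1 - t) * (1 - q) * geo_sum (t * q) m.+1 else 1.

(** The power sums are 1 + (tq)^k - t^k - q^k: two geometric and two linear factors. *)
Lemma newton_M t q :
  newton (fun k => (1 - t ^+ k) * (1 - q ^+ k)) (M_coef t q).
Proof.
have nw := newton_conv (newton_conv (newton_conv (newton_geometric 1)
  (newton_geometric (t * q))) (newton_lin t)) (newton_lin q).
apply: eq_newton nw => [k | n].
  by rewrite expr1n exprMn; ring.
have geoE m : conv (fun n0 : nat => 1 ^+ n0) (fun n0 : nat => (t * q) ^+ n0) m
    = geo_sum (t * q) m.+1.
  rewrite /conv /geo_sum; under eq_bigr => i _ do rewrite expr1n mul1r.
  rewrite (reindex_inj rev_ord_inj); apply: eq_bigr => i _ /=.
  by congr (_ ^+ _); have := ltn_ord i; lia.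
case: n => [|n]; first by rewrite !conv0 /= !expr0 !mul1r.
rewrite conv_linS; case: n => [|n].
  rewrite conv_linS !conv0 geoE /M_coef /geo_sum /lin_seq !big_ord_recr !big_ord0 /=.
  by rewrite !expr0 expr1; ring.
rewrite !conv_linS !geoE /M_coef geo_sumSr.
have -> : geo_sum (t * q) n.+2 = 1 + (t * q) * geo_sum (t * q) n.+1.
  exact: geo_sumS.
have -> : (t * q) ^+ n.+2 = 1 + t * q * (1 + t * q * geo_sum (t * q) n.+1)
    - (1 + t * q * geo_sum (t * q) n.+1).
  by rewrite -!geo_sumS geo_sumSr addrC addKr.
ring.
Qed.

Lemma newton_oneB r :
  newton (fun k => 1 - r ^+ k) (fun n => if n is 0 then 1 else 1 - r).
Proof.
have nw := newton_conv (newton_geometric 1) (newton_lin r).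
apply: eq_newton nw => [k | n]; first by rewrite expr1n.
case: n => [|n]; first by rewrite conv0 expr0 mul1r.
by rewrite conv_linS !expr1n mulr1.
Qed.

Definition zext (g : nat -> R) (k : int) : R := if k is Posz n then g n else 0.
End NewtonExamples.

Lemma big_ord_vanish (V : nmodType) (G : nat -> V) p q :
  (forall m, ~~ ((m < p) && (m < q))%N -> G m = 0) ->
  \sum_(m < p) G m = \sum_(m < q) G m.
Proof.
move=> G0; have wide r : (r = p \/ r = q) ->
    \sum_(m < r) G m = \sum_(m < maxn p q) G m.
  move=> er; have le_r : (r <= maxn p q)%N by lia.
  rewrite (big_ord_widen _ G le_r) big_mkcond; apply: eq_bigr => m _.
  case: ltnP => // le_rm; rewrite G0 //; move: (nat_of_ord m) le_rm => i; lia.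
by rewrite (wide p) ?(wide q); [| right | left].
Qed.

(* With c = tq this is the geometric pattern c_i = tq c_(i-1) - M of the structure
   constants c_i of the commutators [D*_a, D_b]. *)
Lemma M_coef_rec (F : fieldType) (t q : F) (k : int) : t != 0 -> q != 0 ->
  zext (M_coef t^-1 q^-1) (- k) - zext (M_coef t q) k =
  t * q * (zext (M_coef t^-1 q^-1) (- (k - 1)) - zext (M_coef t q) (k - 1))
  - (1 - t) * (1 - q).
Proof.
move=> t0 q0; case: k => [[|n]|n].
- rewrite sub0r opprK oppr0 /= /geo_sum big_ord1 expr0.
  by field; rewrite t0 q0.
- have -> : n.+1%:Z - 1 = n by lia.
  rewrite -NegzE; case: n => [|n] /=.
    rewrite /geo_sum big_ord1 expr0; ring.
  rewrite [geo_sum _ n.+2]geo_sumS; ring.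
have -> : - (Negz n - 1) = n.+2 by lia.
have -> : Negz n - 1 = Negz n.+1 by lia.
have -> : - Negz n = n.+1 by lia.
rewrite /= [geo_sum _ n.+2]geo_sumS -invfM.
by field; rewrite t0 q0.
Qed.

(** * Vertex operators *)

(* Symmetric functions in power-sum presentation, seen abstractly: [ssig b] is the
   plethysm p_k -> b_k p_k and [stau a] the plethysm p_k -> p_k + a_k w^k. *)
Record sym_model (F : fieldType) := SymModel {
  sm_alg :> comAlgType F;
  sp : nat -> sm_alg;
  sh : nat -> sm_alg;
  ssig : (nat -> F) -> {rmorphism sm_alg -> sm_alg};
  stau : (nat -> F) -> {rmorphism sm_alg -> {poly sm_alg}};
  sm_tf : torsion_free sm_alg;
  sm_ind : forall P : sm_alg -> Prop,
    (forall c f g, P f -> P g -> P (c *: f + g)) -> P 0 -> P 1 ->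
    (forall r f, P f -> P (sp r.+1 * f)) -> forall f, P f;
  newton_sh : newton sp sh;
  ssigZ : forall b c f, ssig b (c *: f) = c *: ssig b f;
  ssig_p : forall b r, ssig b (sp r.+1) = b r.+1 *: sp r.+1;
  stauZ : forall a c f, stau a (c *: f) = (in_alg sm_alg c)%:P * stau a f;
  stau_p : forall a r, stau a (sp r.+1) =
    (sp r.+1)%:P + (in_alg sm_alg (a r.+1))%:P * 'X^(r.+1)
}.

Definition shz (F : fieldType) (S : sym_model F) (k : int) : S :=
  if k is Posz n then sh S n else 0.

Section Operators.
Variables (F : fieldType) (S : sym_model F).
Implicit Types (a b g : nat -> F) (k : int) (f : S) (A B : {poly S}).
Local Notation p := (sp S).
Local Notation h := (sh S).
Local Notation hz := (shz S).
Local Notation sig := (@ssig F S).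
Local Notation tau := (@stau F S).

HB.instance Definition _ b :=
  GRing.isScalable.Build F S S *:%R (sig b) (ssigZ b).

Lemma newton_ssig b : newton (fun i => b i *: p i) (sig b \o h).
Proof.
by apply: eq_newton (newton_morph (sig b) (newton_sh S)) => // i; exact: ssig_p.
Qed.

Lemma ssig_newton b x : newton (fun i => b i *: p i) x ->
  forall n, sig b (h n) = x n.
Proof. by move=> nx n; apply: (newton_uniq (@sm_tf _ S) (newton_ssig b) nx). Qed.

(** The coefficient of z^k in A(1/z) times the series of the h_n[bX] z^n, where [bX] stands for p_r
    -> b_r p_r. *)
Definition Lz b k (A : {poly S}) : S :=
  \sum_(j < size A) A`_j * sig b (hz (j%:Z + k)).

Lemma LzEw b k A N : (size A <= N)%N ->
  Lz b k A = \sum_(j < N) A`_j * sig b (hz (j%:Z + k)).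
Proof.
move=> le_AN; rewrite /Lz (big_ord_widen _ (fun j => A`_j * sig b (hz (j%:Z + k))) le_AN).
rewrite big_mkcond; apply: eq_bigr => j _; case: ltnP => // le_Aj.
by rewrite nth_default ?mul0r.
Qed.

Lemma LzD b k A B : Lz b k (A + B) = Lz b k A + Lz b k B.
Proof.
pose N := maxn (size A) (size B).
rewrite (@LzEw _ _ _ N) ?size_polyD // (@LzEw _ _ A N) ?leq_maxl //.
rewrite (@LzEw _ _ B N) ?leq_maxr // -big_split.
by apply: eq_bigr => j _; rewrite coefD mulrDl.
Qed.

Lemma Lz0 b k : Lz b k 0 = 0.
Proof. by rewrite /Lz size_poly0 big_ord0. Qed.

Lemma Lz_sum b k (I : Type) (r : seq I) (P : pred I) (G : I -> {poly S}) :
  Lz b k (\sum_(i <- r | P i) G i) = \sum_(i <- r | P i) Lz b k (G i).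
Proof. exact: (big_morph _ (LzD b k) (Lz0 b k)). Qed.

Lemma LzC b k c A : Lz b k (c%:P * A) = c * Lz b k A.
Proof.
rewrite (@LzEw _ _ _ (size A)); last by rewrite mul_polyC size_scale_leq.
rewrite /Lz mulr_sumr; apply: eq_bigr => j _; by rewrite coefCM mulrA.
Qed.

Lemma LzXn b k m A : Lz b k ('X^m * A) = Lz b (k + m%:Z) A.
Proof.
rewrite (@LzEw _ _ _ (m + size A)); last first.
  by rewrite mulrC (leq_trans (size_polyMleq _ _)) // size_polyXn; lia.
rewrite big_split_ord /= big1 ?add0r => [|i _]; last first.
  by rewrite coefXnM ltn_ord mul0r.
apply: eq_bigr => j _; rewrite coefXnM ltnNge leq_addr addKn.
by congr (_ * sig b (hz _)); move: (nat_of_ord j) => i; lia.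
Qed.

Lemma Lz1 b k : Lz b k 1 = sig b (hz k).
Proof. by rewrite /Lz size_poly1 big_ord1 coef1 mul1r add0r. Qed.

(** The coefficient of z^k in F[X + A/z] times a series, with [a r] the power sums of A. Taking [b]
    to be -1 gives the series of (-z)^i e_i, and 1 that of z^i h_i, so [Dv] and [Dstar] below are
    D_k and D*_k. *)
Definition Vop a b k f : S := Lz b k (tau a f).

Lemma Vop_is_linear a b k : linear (Vop a b k).
Proof. by move=> c f g; rewrite /Vop rmorphD /= stauZ LzD LzC mulr_algl. Qed.

HB.instance Definition _ a b k :=
  GRing.isLinear.Build F S S *:%R (Vop a b k) (Vop_is_linear a b k).

Lemma Vop1 a b k : Vop a b k 1 = sig b (hz k).
Proof. by rewrite /Vop rmorph1 Lz1. Qed.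

Lemma Vop_psum a b k r f : Vop a b k (p r.+1 * f) =
  p r.+1 * Vop a b k f + a r.+1 *: Vop a b (k + r.+1%:Z) f.
Proof.
rewrite /Vop rmorphM /= stau_p mulrDl LzD LzC; congr (_ + _).
rewrite -mulrA LzC.
rewrite LzXn.
by rewrite mulr_algl.
Qed.

(* The recursion of [Vop_psum] determines the family from its values at 1. *)
Lemma Vop_uniq a b (W : int -> S -> S) :
  (forall k, linear (W k)) -> (forall k, W k 1 = sig b (hz k)) ->
  (forall k r f, W k (p r.+1 * f) =
     p r.+1 * W k f + a r.+1 *: W (k + r.+1%:Z) f) ->
  forall k f, W k f = Vop a b k f.
Proof.
move=> Wlin W1 Wp k f; move: f k.
apply: (@sm_ind _ S) => [c f g IHf IHg k | k | k | r f IHf k].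
- by rewrite linearP Wlin IHf IHg.
- by have := Wlin k (-1) 0 0; rewrite scaler0 addr0 scaleN1r addNr linear0.
- by rewrite Vop1.
- by rewrite Wp Vop_psum !IHf.
Qed.

(** The addition formula h_n[Y + Z] = sum h_i[Y] h_(n-i)[Z], where [g] is the h-sequence of the
    alphabet with power sums a_r b_r. *)
Lemma tau_sig_hom a b g n : newton (fun i => a i * b i) g ->
  tau a (sig b (h n)) =
  \sum_(i < n.+1) (sig b (h i))%:P * ((in_alg S (g (n - i)%N))%:P * 'X^(n - i)).
Proof.
have ring_id (R : comNzRingType) (A B P X : R) :
    B * P + X * (A * B) = B * (P + A * X) by ring.
move=> ng; have n1 := newton_morph (tau a) (newton_ssig b).
have n2 := newton_morph (@polyC S) (newton_ssig b).
have n3 := newton_morph (polyC \o in_alg S) ng.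
have n4 := newton_conv n2 (newton_scale 'X n3).
have tf := poly_torsion_free (@sm_tf _ S).
have n5 : newton ((tau a) \o (fun i => b i *: p i))
   (conv (polyC \o (sig b \o h)) (fun m => 'X^m * (polyC \o in_alg S \o g) m)).
  apply: eq_newton n4 => // k /=.
  have algM x y : (x * y)%:A = x%:A * y%:A :> S by exact: (rmorphM (in_alg S)).
  rewrite stauZ stau_p algM -(mulr_algl (b _) (p _)) !polyCM.
  exact: ring_id.
rewrite [LHS](newton_uniq tf n1 n5 n); apply: eq_bigr => i _ /=.
by rewrite ['X^_ * _]mulrC.
Qed.

Lemma Vop_sig_homz a b' b g (k l : int) (s : nat) :
  newton (fun i => a i * b' i) g -> k + l = s ->
  Vop a b k (sig b' (hz l)) =
  \sum_(m < s.+1) zext g (l - m%:Z) *: (sig b' (h m) * sig b (h (s - m)%N)).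
Proof.
move=> ng; case: l => [l | l] kl; last first.
  rewrite rmorph0 linear0 big1 // => i _.
  have -> : Negz l - i%:Z = Negz (l + i)%N.
    by move: (nat_of_ord i) => j; lia.
  by rewrite scale0r.
pose G m := zext g (l%:Z - m%:Z) *: (sig b' (h m) * sig b (hz (s%:Z - m%:Z))).
have -> : Vop a b k (sig b' (hz l)) = \sum_(m < l.+1) G m.
  rewrite /Vop /hz (tau_sig_hom l ng) Lz_sum; apply: eq_bigr => i _.
  rewrite LzC LzC -[X in Lz _ _ X]mulr1 LzXn Lz1 mulr_algl -scalerAr.
  have li := ltn_ord i; rewrite /G.
  have -> : l%:Z - i%:Z = (l - i)%N by rewrite subzn // -ltnS.
  by rewrite -kl; congr (_ *: (_ * sig b (hz _))); move: (nat_of_ord i) li => j; lia.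
(* Terms beyond l have a coefficient of negative index, terms beyond s an h of negative index, so
   either bound gives the same sum. The bound s is symmetric in the two operators of a commutator
   and lets their products be compared term by term. *)
rewrite (@big_ord_vanish _ G l.+1 s.+1) => [|m].
  apply: eq_bigr => i _; rewrite /G; congr (_ *: (_ * sig b _)).
  by rewrite subzn // -ltnS.
rewrite negb_and -!leqNgt /G => /orP[lt_lm | lt_sm].
  have -> : l%:Z - m%:Z = Negz (m - l.+1)%N by lia.
  by rewrite scale0r.
have -> : s%:Z - m%:Z = Negz (m - s.+1)%N by lia.
by rewrite rmorph0 mulr0 scaler0.
Qed.
End Operators.

(** * Commutators of the operators D_k and D*_k *)

Section Commutator.
Variables (F : fieldType) (A : comAlgType F) (p : nat -> A) (c : F).
Variables (m m' : nat -> F) (D D' : int -> {linear A -> A}).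
Hypothesis A_ind : forall P : A -> Prop,
  (forall x f g, P f -> P g -> P (x *: f + g)) -> P 0 -> P 1 ->
  (forall r f, P f -> P (p r.+1 * f)) -> forall f, P f.
Hypothesis D_p : forall k r f,
  D k (p r.+1 * f) = p r.+1 * D k f + m r.+1 *: D (k + r.+1%:Z) f.
Hypothesis D'_p : forall k r f,
  D' k (p r.+1 * f) = p r.+1 * D' k f - m' r.+1 *: D' (k + r.+1%:Z) f.
Hypothesis m_m' : forall r, m r.+1 = c ^+ r.+1 * m' r.+1.

Definition Comm (a b : int) (f : A) := D' a (D b f) - D b (D' a f).

Lemma Comm_psum a b r f : Comm a b (p r.+1 * f) =
  p r.+1 * Comm a b f + m r.+1 *: Comm a (b + r.+1%:Z) f
  - m' r.+1 *: Comm (a + r.+1%:Z) b f.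
Proof.
rewrite /Comm D_p D'_p linearD linearB !linearZ /= D_p D'_p.
rewrite mulrBr !scalerBr; ring.
Qed.

Lemma Comm_is_linear a b : linear (Comm a b).
Proof.
move=> x f g; rewrite /Comm !linearP /= scalerBr; ring.
Qed.

HB.instance Definition _ a b :=
  GRing.isLinear.Build F A A *:%R (Comm a b) (Comm_is_linear a b).

Hypothesis K1 : forall (a b : int) (s : nat), a + b = s ->
  Comm (a + 1) b 1 = c *: Comm a (b + 1) 1.

(** Both sides pass a power sum by the same rule, so the relation at 1 propagates. Passing p_r
    raises a + b by r, which is why it is assumed for all a + b >= 0 at once. *)
Lemma Comm_shift1 f (a b : int) (s : nat) : a + b = s ->
  Comm (a + 1) b f = c *: Comm a (b + 1) f.
Proof.
move: f a b s; apply: A_ind => [x f g IHf IHg | | | r f IHf] a b s ab.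
- by rewrite !linearP /= (IHf _ _ s) // (IHg _ _ s) // scalerDr !scalerA mulrC.
- by rewrite [LHS]linear0 [Comm _ _ 0]linear0 scaler0.
- exact: K1 ab.
- rewrite !Comm_psum.
  have -> : a + 1 + r.+1%:Z = a + r.+1%:Z + 1 by lia.
  have -> : b + 1 + r.+1%:Z = b + r.+1%:Z + 1 by lia.
  rewrite (IHf _ _ s) // (IHf _ _ (s + r.+1)%N); last by lia.
  rewrite (IHf _ _ (s + r.+1)%N); last by lia.
  rewrite [p r.+1 * (c *: _)]mulrC -scalerAl [_ * p r.+1]mulrC.
  move: (Comm a (b + 1) f) (Comm a (b + r.+1%:Z + 1) f) (Comm (_ + _) _ f) => x y z.
  rewrite [RHS]scalerBr scalerDr.
  by congr (_ + _ - _); rewrite !scalerA mulrC.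
Qed.

Lemma Comm_shift f (a b : int) (s : nat) n : a + b = s ->
  Comm (a + n%:Z) b f = c ^+ n *: Comm a (b + n%:Z) f.
Proof.
elim: n a b s => [|n IHn] a b s ab; first by rewrite !addr0 scale1r.
have -> : a + n.+1%:Z = (a + 1) + n%:Z by lia.
have -> : b + n.+1%:Z = b + n%:Z + 1 by lia.
rewrite (IHn _ _ s.+1); last by lia.
rewrite (@Comm_shift1 _ _ _ (s + n)%N); last by lia.
by rewrite scalerA exprSr.
Qed.

(** By the shift relation the two correction terms in [Comm_psum] are m_r and c^r m'_r times the
    same operator and cancel. The commutator thus commutes with every power sum, so it is
    multiplication by its value at 1. *)
Lemma Comm_mul f (a b : int) (s : nat) : a + b = s -> Comm a b f = f * Comm a b 1.
Proof.
move=> ab; move: f; apply: A_ind => [x f g IHf IHg | | | r f IHf].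
- by rewrite linearP /= IHf IHg mulrDl scalerAl.
- by rewrite linear0 mul0r.
- by rewrite mul1r.
- rewrite Comm_psum (Comm_shift f r.+1 ab) scalerA m_m' IHf [m' _ * _]mulrC.
  by rewrite addrK mulrA.
Qed.
End Commutator.

Lemma oneB_pow_inv (F : fieldType) (x y : F) r : x != 0 -> y != 0 ->
  (1 - x ^+ r) * (1 - y ^+ r) =
  (x * y) ^+ r * ((1 - x^-1 ^+ r) * (1 - y^-1 ^+ r)).
Proof.
move=> x0 y0; have := expf_neq0 r x0; have := expf_neq0 r y0.
rewrite !exprVn exprMn => xr yr; field.
by rewrite xr yr.
Qed.

Section DOperators.
Variables (F : fieldType) (S : sym_model F) (t q : F).
Hypotheses (t0 : t != 0) (q0 : q != 0).
Implicit Types (f : S) (a b k : int).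
Local Notation p := (sp S).
Local Notation h := (sh S).
Local Notation sig := (@ssig F S).

Definition Mk (k : nat) : F := (1 - t ^+ k) * (1 - q ^+ k).
Definition Mdual (k : nat) : F := (1 - t^-1 ^+ k) * (1 - q^-1 ^+ k).
Definition Dv k := @Vop F S Mk (fun=> -1) k.
Definition Dstar k := @Vop F S (fun i => - Mdual i) (fun=> 1) k.

HB.instance Definition _ k := GRing.Linear.copy (Dv k) (@Vop F S Mk (fun=> -1) k).
HB.instance Definition _ k :=
  GRing.Linear.copy (Dstar k) (@Vop F S (fun i => - Mdual i) (fun=> 1) k).

Lemma Dv_psum k r f : Dv k (p r.+1 * f) =
  p r.+1 * Dv k f + Mk r.+1 *: Dv (k + r.+1%:Z) f.
Proof. exact: Vop_psum. Qed.

Lemma Dstar_psum k r f : Dstar k (p r.+1 * f) =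
  p r.+1 * Dstar k f - Mdual r.+1 *: Dstar (k + r.+1%:Z) f.
Proof. by rewrite -scaleNr; exact: Vop_psum. Qed.

Lemma Mk_Mdual r : Mk r = (t * q) ^+ r * Mdual r.
Proof. exact: oneB_pow_inv. Qed.

Definition comm_coef (k : int) : F :=
  zext (M_coef t^-1 q^-1) (- k) - zext (M_coef t q) k.

Lemma Comm1 (a b : int) (s : nat) : a + b = s -> Comm Dv Dstar a b 1 =
  \sum_(m < s.+1) comm_coef (m%:Z - b) *:
    (sig (fun=> -1) (h m) * sig (fun=> 1) (h (s - m)%N)).
Proof.
move=> ab; rewrite /Comm /= /Dv /Dstar !Vop1.
have n1 : newton (fun i => - Mdual i * -1) (M_coef t^-1 q^-1).
  by apply: eq_newton (newton_M _ _) => // k; rewrite mulrN1 opprK.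
have n2 : newton (fun i => Mk i * 1) (M_coef t q).
  by apply: eq_newton (newton_M _ _) => // k; rewrite mulr1.
have ba : b + a = s by rewrite addrC.
rewrite (Vop_sig_homz S _ n1 ab) (Vop_sig_homz S _ n2 ba).
rewrite [X in _ - X](reindex_inj rev_ord_inj) -sumrB.
apply: eq_bigr => i _; have li : (i <= s)%N by rewrite -ltnS.
rewrite [nat_of_ord (rev_ord i)]/= subSS subKn //.
rewrite [sig _ _ * sig (fun=> -1) _]mulrC -scalerBl; congr (_ *: _).
rewrite /comm_coef opprB; congr (_ - zext _ _).
by move: (nat_of_ord i) li => j li; lia.
Qed.

(** The relation sum (-1)^m e_m h_(n-m) = 0 in positive degree: the power sums of X - X vanish. *)
Lemma conv_sig_opp n :
  \sum_(m < n.+2) sig (fun=> -1) (h m) * sig (fun=> 1) (h (n.+1 - m)%N) = 0.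
Proof.
have nw := newton_conv (newton_ssig S (fun=> -1)) (newton_ssig S (fun=> 1)).
have n0 : newton (fun i => -1 *: p i + 1 *: p i) (fun n => (n == 0%N)%:R).
  split=> // m; rewrite mulr0 big1 // => i _.
  by rewrite scaleN1r scale1r addNr mulr0.
exact: (newton_uniq (@sm_tf _ S) nw n0 n.+1).
Qed.

(** By [M_coef_rec] the coefficients of the two sides differ by a constant, and a constant multiple
    of the e-h convolution vanishes in positive degree. *)
Lemma Comm1_shift (a b : int) (s : nat) : a + b = s ->
  Comm Dv Dstar (a + 1) b 1 = (t * q) *: Comm Dv Dstar a (b + 1) 1.
Proof.
move=> ab.
have ab1 : (a + 1) + b = s.+1 by lia.
have ab2 : a + (b + 1) = s.+1 by lia.
rewrite (Comm1 ab1) (Comm1 ab2); apply/eqP; rewrite -subr_eq0; apply/eqP.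
rewrite scaler_sumr -sumrB.
transitivity (- ((1 - t) * (1 - q)) *: \sum_(m < s.+2)
    sig (fun=> -1) (h m) * sig (fun=> 1) (h (s.+1 - m)%N)); last first.
  by rewrite conv_sig_opp scaler0.
rewrite scaler_sumr.
apply: eq_bigr => i _; rewrite scalerA -scalerBl; congr (_ *: _).
have -> : i%:Z - (b + 1) = i%:Z - b - 1 by rewrite opprD addrA.
by rewrite {1}/comm_coef (M_coef_rec _ t0 q0) addrAC subrr add0r.
Qed.

Lemma sh1 : h 1 = p 1.
Proof.
have := (newton_sh S).2 0%N.
by rewrite mul1r big_ord1 subn0 (newton_sh S).1 mul1r.
Qed.

(* The case a = 0, b = 1 of [D*_a, D_b] being a multiplication operator. *)
Lemma Dstar0_Dv1_comm f :
  Dstar 0 (Dv 1 f) - Dv 1 (Dstar 0 f) = Mdual 1 *: (p 1 * f).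
Proof.
have e01 : (0 : int) + 1 = 1%N by [].
have := Comm_mul (@sm_ind _ S) Dv_psum Dstar_psum (fun r => Mk_Mdual r.+1) Comm1_shift f e01.
rewrite /Comm => ->.
have := Comm1 e01; rewrite /Comm => ->.
have c0 : comm_coef (0%N%:Z - 1) = Mdual 1.
  by rewrite /comm_coef /= subr0 /geo_sum big_ord1 expr0 mulr1 /Mdual !expr1.
have c1 : comm_coef (1%N%:Z - 1) = 0 by rewrite /comm_coef /= subrr.
rewrite big_ord_recr big_ord_recr big_ord0 add0r /= c0 c1 scale0r addr0 subn0.
rewrite sh1 (newton_sh S).1 rmorph1 mul1r ssig_p scale1r.
by rewrite add0r mulrC -scalerAl.
Qed.
End DOperators.

(** * Jacobi-Trudi determinants *)

Section DetShift.
Variable R : comNzRingType.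

Definition col_subst k (x : 'I_k -> nat -> R) (p : 'I_k) (y : 'I_k -> R) : 'M[R]_k :=
  \matrix_(i, j) if j == p then y i else x i j.

Lemma det_col_subst k (x : 'I_k -> nat -> R) p y :
  \det (col_subst x p y) = \sum_i y i * cofactor (\matrix_(i, j) x i j) i p.
Proof.
rewrite (expand_det_col _ p); apply: eq_bigr => i _.
rewrite mxE eqxx; congr (_ * (_ * \det _)).
apply/matrixP => a b; rewrite !mxE.
by rewrite eq_sym (negPf (neq_lift _ _)).
Qed.

Lemma det_col_subst_col k (x : 'I_k -> nat -> R) p (l : 'I_k) :
  \det (col_subst x p (fun i => x i l)) =
  if l == p then \det (\matrix_(i, j) x i j) else 0.
Proof.
have [->|lp] := eqVneq l p.
  congr (\det _); apply/matrixP => i j; rewrite !mxE.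
  by case: eqP => // ->.
rewrite -det_tr; apply: (determinant_alternate lp) => i; rewrite !mxE eqxx.
by rewrite (negPf lp).
Qed.

(** Cramer's rule writes det X times [y] as X applied to the vector [d] of column substitutions, so
    the left matrix, with its first column multiplied by det X, factors as X U. Comparing
    determinants leaves a factor det X to cancel, hence the regularity hypothesis. *)
Lemma det_shift_reg k (x : 'I_k.+1 -> nat -> R) (y : 'I_k.+1 -> R) s :
  GRing.lreg (\det (\matrix_(i < k.+1, j < k.+1) x i j)) ->
  \det (\matrix_(i < k.+1, j < k.+1)
          (if j == 0%N :> nat then y i else x i j - s * x i j.-1)) =
  \sum_(p < k.+1) s ^+ p * \det (col_subst x p y).
Proof.
set X := \matrix_(i, j) x i j => regX; apply: regX.
set N := \matrix_(i, j) _.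
pose d p := \det (col_subst x p y).
pose U : 'M[R]_k.+1 := \matrix_(a, j)
  (if j == 0%N :> nat then d a else (a == j)%:R - s * (a == j.-1 :> nat)%:R).
have detU : \det U = \sum_(p < k.+1) s ^+ p * d p.
  (* [W] inverts the bidiagonal matrix from which [U] differs only in its first column. So [W *m U]
     is lower triangular, and its diagonal is 1 except for the corner entry, which is the required
     sum. *)
  pose W : 'M[R]_k.+1 := \matrix_(a, b) (if (a <= b)%N then s ^+ (b - a) else 0).
  have detW : \det W = 1.
    rewrite -det_tr det_trig; last first.
      by apply/is_trig_mxP => i j ij; rewrite !mxE leqNgt ij.
    by apply: big1 => i _; rewrite !mxE leqnn subnn expr0.
  have WU a j : (W *m U) a j =
      if j == 0%N :> nat then \sum_b W a b * d b else (a == j)%:R.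
    rewrite mxE; case: ifPn => j0.
      by apply: eq_bigr => b _; rewrite [U _ _]mxE j0.
    have ltj : (j.-1 < k.+1)%N by have := ltn_ord j; lia.
    rewrite (eq_bigr (fun b => W a b * (b == j)%:R
        - s * (W a b * (b == Ordinal ltj)%:R))) => [|b _]; last first.
      by rewrite [U _ _]mxE (negPf j0) mulrBr mulrCA.
    rewrite sumrB -mulr_sumr (bigD1 j) //= eqxx mulr1 big1 ?addr0; last first.
      by move=> b /negPf->; rewrite mulr0.
    rewrite (bigD1 (Ordinal ltj)) //= eqxx mulr1 big1 ?addr0; last first.
      by move=> b /negPf->; rewrite mulr0.
    rewrite !mxE /=; have [->|aj] := eqVneq a j.
      by rewrite leqnn subnn expr0 ifF ?mulr0 ?subr0 //; lia.
    have naj : (a : nat) != j by [].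
    case: (leqP a j) => laj; last by rewrite ifF ?mulr0 ?subrr //; lia.
    rewrite ifT; last by lia.
    have -> : (j - a = (j.-1 - a).+1)%N by lia.
    by rewrite exprS subrr.
  rewrite -[LHS]mul1r -detW -det_mulmx det_trig; last first.
    apply/is_trig_mxP => a j aj; rewrite WU ifF; last by lia.
    by case: eqP aj => // ->; rewrite ltnn.
  rewrite big_ord_recl big1 => [|i _]; last by rewrite WU /= eqxx.
  rewrite WU /= mulr1; apply: eq_bigr => b _; rewrite !mxE /=.
  by rewrite subn0.
have XU : X *m U = \matrix_(i, j) (if j == 0%N :> nat then \det X * y i else N i j).
  apply/matrixP => i j; rewrite [RHS]mxE mxE; case: ifPn => j0.
    have -> : y i = (\col_a y a) i 0 by rewrite mxE.
    have -> : \det X * (\col_a y a) i 0 = (X *m (\adj X *m (\col_a y a))) i 0.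
      by rewrite mulmxA mul_mx_adj mul_scalar_mx [RHS]mxE.
    rewrite mxE; apply: eq_bigr => a _; rewrite !mxE j0; congr (_ * _).
    rewrite /d det_col_subst; apply: eq_bigr => b _; rewrite !mxE mulrC.
    by [].
  have ltj : (j.-1 < k.+1)%N by have := ltn_ord j; lia.
  rewrite (eq_bigr (fun b => X i b * (b == j)%:R
      - s * (X i b * (b == Ordinal ltj)%:R))) => [|b _]; last first.
    by rewrite [U _ _]mxE (negPf j0) mulrBr mulrCA.
  rewrite sumrB -mulr_sumr (bigD1 j) //= eqxx mulr1 big1 ?addr0; last first.
    by move=> b /negPf->; rewrite mulr0.
  rewrite (bigD1 (Ordinal ltj)) //= eqxx mulr1 big1 ?addr0; last first.
    by move=> b /negPf->; rewrite mulr0.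
  by rewrite !mxE (negPf j0).
rewrite [RHS](_ : _ = \det (X *m U)); last by rewrite det_mulmx detU.
rewrite XU [RHS](expand_det_col _ 0) [\det N](expand_det_col _ 0) mulr_sumr.
apply: eq_bigr => i _; rewrite !mxE /= mulrA; congr (_ * (_ * \det _)).
by apply/matrixP => a b; rewrite !mxE /=.
Qed.
End DetShift.

Lemma det_shift (R : comNzRingType) k (x : 'I_k.+1 -> nat -> R) (y : 'I_k.+1 -> R) s :
  \det (\matrix_(i < k.+1, j < k.+1)
          (if j == 0%N :> nat then y i else x i j - s * x i j.-1)) =
  \sum_(p < k.+1) s ^+ p * \det (col_subst x p y).
Proof.
(* Perturb x by a generic multiple of the identity to make its determinant regular. *)
pose x' (i : 'I_k.+1) j : {poly R} := (x i j)%:P + 'X * (i == j :> nat)%:R.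
pose ev : {rmorphism {poly R} -> R} := horner_eval 0.
have evC c : ev c%:P = c by exact: hornerC.
have ev_x' i j : ev (x' i j) = x i j.
  by rewrite rmorphD rmorphM evC [ev 'X]hornerX mul0r addr0.
have reg : GRing.lreg (\det (\matrix_(i < k.+1, j < k.+1) x' i j)).
  apply: monic_lreg.
  have -> : \matrix_(i < k.+1, j < k.+1) x' i j = char_poly_mx (- \matrix_(i, j) x i j).
    apply/matrixP => i j; rewrite !mxE polyCN opprK addrC /x'; congr (_ + _).
    by rewrite mulr_natr.
  exact: char_poly_monic.
have := congr1 ev (det_shift_reg (fun i => (y i)%:P) s%:P reg).
rewrite -det_map_mx rmorph_sum.
rewrite (_ : map_mx _ _ = \matrix_(i < k.+1, j < k.+1)
    (if j == 0%N :> nat then y i else x i j - s * x i j.-1)); last first.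
  apply/matrixP => i j; rewrite !mxE; case: ifP => _; first exact: evC.
  by rewrite rmorphB rmorphM !ev_x' evC.
move=> ->; apply: eq_bigr => p _; rewrite rmorphM rmorphXn evC; congr (_ * _).
rewrite -det_map_mx; congr (\det _); apply/matrixP => i j; rewrite !mxE.
by case: ifP.
Qed.

Section JacobiTrudi.
Variables (F : fieldType) (S : sym_model F) (u v : F).
Hypothesis u0 : u != 0.
Implicit Types (al : nat -> int) (k : nat).
Local Notation h := (sh S).
Local Notation hz := (shz S).
Local Notation sig := (@ssig F S).

Definition jt_entry al (i j : nat) : S := hz (al i - i%:Z + j%:Z).

Definition jt k al : S := \det (\matrix_(i < k, j < k) jt_entry al i j).

(** In the Vandermonde determinant behind Jacobi-Trudi, this multiplies the variable of row [r] by
    [s]. *)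
Definition jt_row k al (s : F) (r : 'I_k) : S :=
  \det (\matrix_(i < k, j < k)
    if i == r then s ^+ j *: jt_entry al i j else jt_entry al i j).

Let a i : F := 1 - v ^+ i.
Let b i : F := u ^+ i - 1.
(** What D_0 becomes under conjugation by X -> X(1-u): the parameters (q, t) and (t, q) match the
    two triangularity axioms, and their inverses serve D*_0. *)
Definition Dprime := @Vop F S (fun i => 1 - v ^+ i) (fun i => u ^+ i - 1) 0.
Let phi (n : int) := @stau F S a (hz n).
Let g (n : nat) : F := if n is 0 then 1 else 1 - v.

Lemma ssig1 n : sig (fun=> 1) (h n) = h n.
Proof.
apply: ssig_newton; apply: eq_newton (newton_sh S) => // i; by rewrite scale1r.
Qed.

Definition Psi (n : int) : {poly S} :=
  if n is Posz n then \sum_(i < n.+1) (h i)%:P * 'X^(n - i) else 0.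

Lemma Psi_rec (n : int) : Psi (n + 1) = (hz (n + 1))%:P + 'X * Psi n.
Proof.
case: n => [n | [|n]].
- have -> : n%:Z + 1 = n.+1 by lia.
  rewrite /Psi big_ord_recr /= subnn expr0 mulr1 addrC mulr_sumr; congr (_ + _).
  apply: eq_bigr => i _; rewrite subSn -1?ltnS // exprS; ring.
- by rewrite /Psi /= big_ord1 /= expr0 mulr1 mulr0 addr0.
- have -> : Negz n.+1 + 1 = Negz n by lia.
  by rewrite /Psi /= polyC0 mulr0 addr0.
Qed.

Lemma phiE (n : int) :
  phi n = (in_alg S v)%:P * (hz n)%:P + (in_alg S (1 - v))%:P * Psi n.
Proof.
case: n => n; last by rewrite /phi /= rmorph0 polyC0 !mulr0 addr0.
have ng : newton (fun i => a i * 1) g.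
  by apply: eq_newton (newton_oneB v) => // i; rewrite mulr1.
have := tau_sig_hom S n ng; rewrite ssig1 /phi [hz n]/= => ->.
rewrite /Psi !big_ord_recr /= ssig1 subnn expr0 !mulr1 [_ * (_ + _)]mulrDr mulr_sumr.
have alg1 : (v%:A)%:P + ((1 - v)%:A)%:P = 1 :> {poly S}.
  by rewrite -polyCD -scalerDl addrC subrK scale1r.
rewrite [RHS]addrCA -mulrDl alg1 mul1r scale1r polyC1 mulr1.
congr (_ + _); apply: eq_bigr => i _; rewrite ssig1.
have -> : g (n - i)%N = 1 - v by rewrite /g; case: (n - i)%N (ltn_ord i) (subn_gt0 i n) => // ->.
ring.
Qed.

(** With w for ['X] and H(z) the series of the h_n, the series of the [phi n] is H(z)(1 - vwz)/(1 -
    wz). Clearing the denominator relates neighbouring columns of a Jacobi-Trudi matrix. *)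
Lemma phi_rec (n : int) :
  phi (n + 1) - 'X * phi n = (hz (n + 1))%:P - (in_alg S v)%:P * 'X * (hz n)%:P.
Proof.
rewrite !phiE Psi_rec rmorphB rmorph1 polyCB polyC1; ring.
Qed.

Let eta n := sig b (h n).

(** The alphabets X and (u-1)X add up to uX. *)
Lemma conv_eta n : \sum_(i < n.+1) h i * eta (n - i)%N = u ^+ n *: h n.
Proof.
have algX m : u%:A ^+ m = (u ^+ m)%:A :> S.
  by rewrite -[u%:A]/(in_alg S u) -rmorphXn.
have nw := newton_conv (newton_sh S) (newton_ssig S b).
have nu : newton (fun i => sp S i + b i *: sp S i) (fun n => u ^+ n *: h n).
  have ne := newton_scale (u%:A) (newton_sh S).
  apply: eq_newton ne => [i | i].
    by rewrite algX mulr_algl /b scalerBl scale1r addrC subrK.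
  by rewrite algX mulr_algl.
exact: (newton_uniq (@sm_tf _ S) nw nu n).
Qed.

(** The full convolution of h and [eta] is given by [conv_eta]; [Psi n] supplies only the h_i with i
    <= n, and the subtracted sum is the missing tail. For negative n the tail is everything. *)
Lemma Lz_Psi (n : int) (p : nat) : Lz b p (Psi n) =
  u ^ (n + p%:Z) *: hz (n + p%:Z)
  - \sum_(l < p) eta (p - l.+1)%N * hz (n + l.+1%:Z).
Proof.
apply/eqP; rewrite -[_ == _]/(_ == _) eq_sym subr_eq; apply/eqP.
case: n => n.
  have -> : Lz b p (Psi n) = \sum_(i < n.+1) h i * eta (n + p - i)%N.
    rewrite /Psi Lz_sum; apply: eq_bigr => i _.
    rewrite LzC -['X^_]mulr1 LzXn Lz1 /eta; congr (_ * sig b _).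
    have li := ltn_ord i.
    have -> // : p%:Z + (n - i)%N%:Z = (n + p - i)%N.
    by move: (nat_of_ord i) li => j; lia.
  rewrite -PoszD -[LHS]conv_eta -addSn big_split_ord /=; congr (_ + _).
  apply: eq_bigr => i _; rewrite mulrC; congr (eta _ * _); first by lia.
  by rewrite addnS addSn.
rewrite [Psi _]/= Lz0 add0r.
have [lt_pn | le_np] := ltnP p n.+1.
  have -> : Negz n + p = Negz (n - p) by lia.
  rewrite /= scaler0 big1 // => i _.
  have li := ltn_ord i.
  have -> : Negz n + i.+1%:Z = Negz (n - i.+1) by move: (nat_of_ord i) li => j; lia.
  by rewrite mulr0.
have -> : p = (n + (p - n.+1).+1)%N by lia.
move: (p - n.+1)%N => r; have -> : Negz n + (n + r.+1)%N = r by lia.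
rewrite big_split_ord /= [X in _ = X + _]big1 => [|i _].
  rewrite add0r -[LHS]conv_eta; apply: eq_bigr => i _; rewrite mulrC.
  congr (eta _ * _); first by move: (nat_of_ord i) => j; lia.
  have -> // : Negz n + (n + i).+1%:Z = i.
  by move: (nat_of_ord i) => j; lia.
have li := ltn_ord i.
have -> : Negz n + i.+1%:Z = Negz (n - i.+1) by move: (nat_of_ord i) li => j; lia.
by rewrite mulr0.
Qed.

Lemma Dprime_jt0 al : Dprime (jt 0 al) = jt 0 al.
Proof. by rewrite /jt det_mx00 /Dprime Vop1 /= (newton_sh S).1 rmorph1. Qed.

(** Both sides are the same double sum of entries times cofactors, expanded along columns on the
    left and along rows on the right; the scalar u^(al_i - i + p) v^p is regrouped as u^(al_i - i)
    (uv)^p. *)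
Lemma jt_col_row k al :
  \sum_(p < k) v ^+ p *: \det (col_subst (fun i : 'I_k => jt_entry al i) p
     (fun i => u ^ (al i - i%:Z + p%:Z) *: jt_entry al i p)) =
  \sum_(i < k) u ^ (al i - i%:Z) *: jt_row al (u * v) i.
Proof.
pose X := \matrix_(i < k, j < k) jt_entry al i j.
transitivity (\sum_(p < k) \sum_(i < k)
    (u ^ (al i - i%:Z) * (u * v) ^+ p) *: (jt_entry al i p * cofactor X i p)).
  apply: eq_bigr => p _; rewrite det_col_subst scaler_sumr; apply: eq_bigr => i _.
  rewrite -scalerAl scalerA; congr (_ *: _).
  by rewrite expfzDr // exprMn -exprnP mulrCA [v ^+ p * _]mulrC.
rewrite exchange_big; apply: eq_bigr => i _.
rewrite /jt_row (expand_det_row _ i) scaler_sumr; apply: eq_bigr => p _.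
rewrite mxE eqxx -scalerAl scalerA; congr (_ *: (_ * (_ * \det _))).
apply/matrixP => x y; rewrite !mxE.
by rewrite eq_sym (negPf (neq_lift _ _)).
Qed.

(** Column operations replace every column but the first by the right side of [phi_rec]; [det_shift]
    with parameter vw then sums over the places where the untouched [phi] column can be inserted. *)
Lemma tau_jt k al : @stau F S a (jt k.+1 al) =
  \sum_(p < k.+1) ((in_alg S v)%:P * 'X) ^+ p *
    \det (col_subst (fun (i : 'I_k.+1) j => (jt_entry al i j)%:P) p
           (fun i => phi (al i - i%:Z))).
Proof.
rewrite -det_shift /jt -det_map_mx.
pose x (i : 'I_k.+1) (j : nat) := phi (al i - i%:Z + j%:Z).
(* The column operations are themselves an instance of [det_shift], with [y] the first column:
   inserted at any other place it produces two equal columns. *)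
transitivity (\det (\matrix_(i < k.+1, j < k.+1)
    (if j == 0%N :> nat then x i 0%N else x i j - 'X * x i j.-1))).
  rewrite det_shift (bigD1 ord0) //= expr0 mul1r big1 ?addr0 => [|p p0].
    rewrite (det_col_subst_col x ord0 ord0) eqxx.
    by congr (\det _); apply/matrixP => i j; rewrite !mxE.
  rewrite (det_col_subst_col x p ord0) eq_sym (negPf p0) mulr0 //.
congr (\det _); apply/matrixP => i j; rewrite !mxE.
case: ifPn => j0; first by rewrite /x addr0.
have e : j%:Z = j.-1%:Z + 1 by move: (nat_of_ord j) j0 => l; lia.
by rewrite /x /jt_entry e addrA phi_rec.
Qed.

Lemma Dprime_jt k al : Dprime (jt k al) = v ^+ k *: jt k al +
  (1 - v) *: \sum_(i < k) u ^ (al i - i%:Z) *: jt_row al (u * v) i.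
Proof.
case: k => [|k]; first by rewrite Dprime_jt0 expr0 scale1r big_ord0 scaler0 addr0.
rewrite -jt_col_row.
set x := fun i : 'I_k.+1 => jt_entry al i.
(* Split [phi] by [phiE]. Its h part repeats column 0, so it survives only for p = 0. The tail terms
   of [Lz_Psi] repeat columns 1 to p, so only the last of them, column p itself, survives. *)
have step (p : 'I_k.+1) : Lz b p (\det (col_subst (fun (i : 'I_k.+1) j => (x i j)%:P) p
     (fun i => phi (al i - i%:Z)))) =
   (if p == ord0 then v else - (1 - v)) *: jt k.+1 al + (1 - v) *:
   \det (col_subst x p (fun i => u ^ (al i - i%:Z + p%:Z) *: x i p)).
  rewrite det_col_subst Lz_sum.
  pose c i := cofactor (\matrix_(i < k.+1, j < k.+1) x i j) i p.
  have sub (y : 'I_k.+1 -> S) : \det (col_subst x p y) = \sum_i y i * c i.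
    exact: det_col_subst.
  rewrite (eq_bigr (fun i => c i * Lz b p (phi (al i - i%:Z)))) => [|i _]; last first.
    rewrite mulrC -LzC; congr (Lz _ _ (_ * _)); rewrite /c -cofactor_map_mx.
    congr cofactor; apply/matrixP => r s; by rewrite !mxE.
  have colE (l : 'I_k.+1) : \sum_i x i l * c i = if l == p then jt k.+1 al else 0.
    by rewrite -sub det_col_subst_col.
  rewrite (eq_bigr (fun i => v *: (eta p * (x i 0%N * c i)) + (1 - v) *:
      (u ^ (al i - i%:Z + p%:Z) *: x i p * c i -
       \sum_(l < p) eta (p - l.+1)%N * (x i l.+1 * c i)))) => [|i _]; last first.
    rewrite phiE LzD !LzC Lz_Psi -[_%:P]mulr1 LzC Lz1.
    rewrite /x /jt_entry addr0 !in_algE !mulr_algl.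
    rewrite mulrDr -!scalerAr; congr (_ *: _ + _ *: _).
      by rewrite -[sig b (hz p)]/(eta p); ring.
    rewrite mulrBr mulrC; congr (_ - _); rewrite mulr_sumr; apply: eq_bigr => l _.
    by rewrite mulrC mulrA.
  rewrite big_split /= -!scaler_sumr -mulr_sumr (colE ord0) sumrB -sub.
  rewrite exchange_big /=.
  rewrite (eq_bigr (fun l : 'I_p => eta (p - l.+1)%N *
      (if l.+1 == p :> nat then jt k.+1 al else 0))) => [|l _]; last first.
    have ll := ltn_ord l; have lp := ltn_ord p.
    have ltl : (l.+1 < k.+1)%N by exact: leq_ltn_trans ll lp.
    by rewrite -mulr_sumr (colE (Ordinal ltl)).
  have eta0 : eta 0 = 1 by rewrite /eta (newton_sh S).1 rmorph1.
  case: (eqVneq p ord0) => [-> | p0].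
    by rewrite big_ord0 subr0 eta0 mul1r.
  rewrite mulr0 scaler0 add0r scalerBr addrC; congr (_ + _).
  case: p p0 {sub colE c} => -[//|p] lp _ /=.
  rewrite big_ord_recr /= subnn eta0 mul1r eqxx big1 ?add0r ?scaleNr // => l _.
  have ll := ltn_ord l; rewrite ifF ?mulr0 //.
  by move: (nat_of_ord l) ll => ?; lia.
rewrite /Dprime /Vop tau_jt Lz_sum.
rewrite (eq_bigr (fun p : 'I_k.+1 => (v ^+ p * (if p == ord0 then v else - (1 - v))) *:
    jt k.+1 al + (1 - v) *: (v ^+ p *:
   \det (col_subst x p (fun i => u ^ (al i - i%:Z + p%:Z) *: x i p))))) => [|p _]; last first.
  rewrite exprMn -rmorphXn -rmorphXn -mulrA LzC LzXn add0r step /= mulr_algl.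
  by rewrite scalerDr !scalerA [v ^+ p * (1 - v)]mulrC.
rewrite big_split /= -scaler_suml -scaler_sumr; congr (_ *: _ + _).
rewrite big_ord_recl /= expr0 mul1r -mulr_suml.
(* The sum v - (1 - v)(v + ... + v^k) telescopes to v^(k+1). *)
elim: k {x step} => [|k IHk]; first by rewrite big_ord0 mul0r addr0 expr1.
by rewrite big_ord_recr /= mulrDl addrA IHk /bump /= add1n [v ^+ k.+2]exprS; ring.
Qed.
End JacobiTrudi.

(** * Straightening *)

Section LinSpan.
Variables (F : fieldType) (V : lmodType F) (e : seq nat -> V).
Implicit Types (f g : V) (P Q : seq nat -> Prop).

(** An explicit list of coefficients and labels, the format of the triangularity axioms. *)
Definition lin_span P f := exists l : seq (F * seq nat),
  (forall x, x \in l -> P x.2) /\ f = \sum_(x <- l) x.1 *: e x.2.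

Lemma lin_span0 P : lin_span P 0.
Proof. by exists [::]; split=> //; rewrite big_nil. Qed.

Lemma lin_span_lin P c f g : lin_span P f -> lin_span P g -> lin_span P (c *: f + g).
Proof.
move=> [l [Pl ->]] [l' [Pl' ->]].
exists ([seq (c * x.1, x.2) | x <- l] ++ l'); split=> [x|].
  rewrite mem_cat => /orP[/mapP[y yl ->] /=|]; [exact: Pl | exact: Pl'].
rewrite big_cat big_map /= scaler_sumr; congr (_ + _).
by apply: eq_bigr => y _; rewrite scalerA.
Qed.

Lemma lin_spanD P f g : lin_span P f -> lin_span P g -> lin_span P (f + g).
Proof. by move=> Pf Pg; rewrite -[f]scale1r; apply: lin_span_lin. Qed.

Lemma lin_spanZ P c f : lin_span P f -> lin_span P (c *: f).
Proof.
by move=> Pf; rewrite -[_ *: _]addr0; apply: lin_span_lin => //; apply: lin_span0.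
Qed.

Lemma lin_spanB P f g : lin_span P f -> lin_span P g -> lin_span P (f - g).
Proof. by move=> Pf Pg; rewrite addrC -scaleN1r; apply: lin_span_lin. Qed.

Lemma lin_span_big P (I : Type) (r : seq I) (C : pred I) (G : I -> V) :
  (forall i, C i -> lin_span P (G i)) -> lin_span P (\sum_(i <- r | C i) G i).
Proof.
move=> PG; apply: (big_ind (lin_span P)) => //; first exact: lin_span0.
by move=> f g; apply: lin_spanD.
Qed.

Lemma lin_span_sub P Q f : (forall nu, P nu -> Q nu) -> lin_span P f -> lin_span Q f.
Proof. by move=> PQ [l [Pl ->]]; exists l; split=> // x /Pl /PQ. Qed.

Lemma lin_span_gen P nu : P nu -> lin_span P (e nu).
Proof.
move=> Pnu; exists [:: (1, nu)]; split=> [x|].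
  by rewrite inE => /eqP->.
by rewrite big_seq1 scale1r.
Qed.
End LinSpan.

Lemma lin_span_map (F : fieldType) (V W : lmodType F) (T : {linear V -> W})
    (e : seq nat -> V) (e' : seq nat -> W) P Q f :
  (forall nu, P nu -> lin_span e' Q (T (e nu))) -> lin_span e P f -> lin_span e' Q (T f).
Proof.
move=> PQ [l [Pl ->]]; rewrite linear_sum big_seq; apply: lin_span_big => x xl.
by rewrite linearZ; apply: lin_spanZ; apply: PQ; apply: Pl.
Qed.

Section Straightening.
Variables (F : fieldType) (S : sym_model F).
Implicit Types (al : nat -> int) (k : nat) (nu : seq nat) (P Q : seq nat -> Prop).

Definition vec nu (i : nat) : int := (nth 0%N nu i)%:Z.

Definition sschur nu : S := jt S (size nu) (vec nu).

Definition schur_span := lin_span sschur.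

Definition pre r al : int := \sum_(i < r) al i.
Definition wgt k al : int := \sum_(i < k) i%:Z * al i.

(** Dominance for integer vectors; the weight is carried along as the measure on which straightening
    terminates. *)
Definition vdom k al al' :=
  [/\ forall r, (r <= k)%N -> pre r al <= pre r al',
      pre k al = pre k al' & wgt k al' <= wgt k al].

Lemma vdom_trans k al1 al2 al3 : vdom k al1 al2 -> vdom k al2 al3 -> vdom k al1 al3.
Proof.
move=> [p12 e12 w12] [p23 e23 w23]; split=> [r rk | |].
- by have := p12 r rk; have := p23 r rk; lia.
- by rewrite e12.
- by lia.
Qed.

Definition above k al nu := [/\ is_part nu, (size nu <= k)%N & vdom k al (vec nu)].

Definition above_strict k al nu := above k al nu /\ wgt k (vec nu) < wgt k al.

Definition move_cell (i j : nat) (c : int) al (l : nat) : int :=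
  al l + (if l == i then c else 0) - (if l == j then c else 0).

Lemma sum_indicator r (i : nat) (c : nat -> int) :
  \sum_(l < r) (if l == i :> nat then c l else 0) = if (i < r)%N then c i else 0.
Proof.
elim: r => [|r IHr]; first by rewrite big_ord0.
rewrite big_ord_recr /= IHr; case: (ltngtP i r) => ir.
- by rewrite ltnS (ltnW ir) addr0.
- by rewrite ltnS leqNgt ir addr0.
- by rewrite ir ltnS leqnn add0r.
Qed.

Lemma pre_move i j c al r : pre r (move_cell i j c al) =
  pre r al + (if (i < r)%N then c else 0) - (if (j < r)%N then c else 0).
Proof.
rewrite /pre /move_cell sumrB big_split /=.
by rewrite (sum_indicator r i (fun=> c)) (sum_indicator r j (fun=> c)).
Qed.

Lemma wgt_move i j c al k : (i < k)%N -> (j < k)%N ->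
  wgt k (move_cell i j c al) = wgt k al + (i%:Z - j%:Z) * c.
Proof.
move=> ik jk; rewrite /wgt /move_cell.
rewrite (eq_bigr (fun l : 'I_k => l%:Z * al l + (if l == i :> nat then l%:Z * c else 0)
  - (if l == j :> nat then l%:Z * c else 0))) => [|l _]; last first.
  by rewrite mulrBr mulrDr; congr (_ + _ - _); case: ifP; rewrite ?mulr0.
rewrite sumrB big_split /= (sum_indicator k i (fun l => l%:Z * c)).
rewrite (sum_indicator k j (fun l => l%:Z * c)) ik jk; ring.
Qed.

Lemma vdom_move i j c al k : (i < j)%N -> (j < k)%N -> 0 <= c ->
  vdom k al (move_cell i j c al).
Proof.
move=> ij jk c0; have ik := ltn_trans ij jk; split=> [r rk | |].
- rewrite pre_move; case: (ltnP i r); case: (ltnP j r); lia.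
- by rewrite pre_move ik jk addrK.
- rewrite wgt_move //; nia.
Qed.

Lemma eq_jt k al al' : (forall i, (i < k)%N -> al i = al' i) -> jt S k al = jt S k al'.
Proof.
move=> e; congr (\det _); apply/matrixP => i j; rewrite !mxE /jt_entry e //.
Qed.

Lemma shz_lt0 (z : int) : z < 0 -> shz S z = 0.
Proof. by case: z. Qed.

Lemma jt_row0 k al i : (i < k)%N -> al i - i%:Z + k%:Z <= 0 -> jt S k al = 0.
Proof.
move=> ik le0; rewrite /jt (expand_det_row _ (Ordinal ik)) big1 // => j _.
rewrite mxE /jt_entry /= shz_lt0 ?mul0r //.
by have := ltn_ord j; move: (nat_of_ord j) => l; lia.
Qed.

Lemma jt_rows_eq k al i j : (i < k)%N -> (j < k)%N -> i != j ->
  al i - i%:Z = al j - j%:Z -> jt S k al = 0.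
Proof.
move=> ik jk ij e; apply: (@determinant_alternate _ _ _ (Ordinal ik) (Ordinal jk)) => // l.
by rewrite !mxE /jt_entry /= e.
Qed.

(** Exchanging rows i and i+1 exchanges the values al_i - i and al_(i+1) - (i+1); on [al] this moves
    al_(i+1) - al_i - 1 cells up to row i. *)
Lemma jt_swap k al i : (i.+1 < k)%N ->
  jt S k (move_cell i i.+1 (al i.+1 - al i - 1) al) = - jt S k al.
Proof.
move=> ik; have ik' := ltnW ik.
pose i0 := Ordinal ik'; pose i1 := Ordinal ik.
have ne : i0 != i1 by rewrite -val_eqE /= neq_ltn ltnSn.
have -> : - jt S k al = \det (xrow i0 i1 (\matrix_(i < k, j < k) jt_entry S al i j)).
  by rewrite xrowE det_mulmx /tperm_mx det_perm odd_tperm ne expr1 mulN1r.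
congr (\det _); apply/matrixP => a b; rewrite !mxE /jt_entry /move_cell.
case: tpermP => [->|->|ne0 ne1] /=.
- rewrite eqxx (ltn_eqF (ltnSn i)); congr (shz S _).
  by move: (nat_of_ord b) (al i.+1) (al i) => ? ? ?; lia.
- rewrite eqxx (gtn_eqF (ltnSn i)); congr (shz S _).
  by move: (nat_of_ord b) (al i.+1) (al i) => ? ? ?; lia.
- have -> : (a == i :> nat) = false by apply/negP => /eqP e; apply: ne0; apply: val_inj.
  have -> : (a == i.+1 :> nat) = false by apply/negP => /eqP e; apply: ne1; apply: val_inj.
  by rewrite addr0 subr0.
Qed.

Lemma jt_trailing nu k : (size nu <= k)%N -> jt S k (vec nu) = sschur nu.
Proof.
elim: k => [|k IHk].
  by rewrite leqn0 /sschur => /eqP->.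
rewrite leq_eqVlt => /orP[/eqP<- //|]; rewrite ltnS => sk.
rewrite -IHk // /jt (expand_det_row _ ord_max) big_ord_recr /= big1 => [|j _].
  rewrite add0r mxE /jt_entry /vec nth_default // sub0r addNr /= (newton_sh S).1 mul1r.
  rewrite /cofactor addnn -mul2n exprM sqrrN expr1n expr1n mul1r.
  congr (\det _); apply/matrixP => a b; rewrite !mxE /jt_entry /= /lift /=.
  have bumpE (c : 'I_k) : bump k c = c by rewrite /bump leqNgt ltn_ord add0n.
  by rewrite !bumpE.
rewrite mxE /jt_entry /vec /= nth_default // sub0r.
rewrite (_ : _ + _ = Negz (k - j.+1)) ?mul0r //.
by have := ltn_ord j; move: (nat_of_ord j) => l; lia.
Qed.

Lemma nth_filter_pos (s : seq nat) i : sorted geq s ->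
  nth 0%N [seq x <- s | (0 < x)%N] i = nth 0%N s i.
Proof.
elim: s i => //= x s IHs i xs; have ss : sorted geq s by apply: path_sorted xs.
case: ltnP => [x0 | ].
  by case: i => //= i; apply: IHs.
rewrite leqn0 => /eqP x0; have s0 : forall y, y \in s -> y = 0%N.
  move=> y ys; have := order_path_min (fun a b c (h1 : (a <= b)%N) h2 => leq_trans h2 h1) xs.
  by move/allP/(_ y ys); rewrite /geq /= x0 leqn0 => /eqP.
rewrite (_ : filter _ s = [::]) ?nth_nil; last first.
  by apply/eqP; rewrite -size_eq0 size_filter -leqn0 leqNgt -has_count; apply/hasPn => y /s0->.
case: i => //= i; case: (ltnP i (size s)) => si; last by rewrite nth_default.
by rewrite (s0 _ (mem_nth _ si)).
Qed.

Lemma jt_above k al : (forall i, (i.+1 < k)%N -> al i.+1 <= al i) ->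
  (forall i, (i < k)%N -> 0 <= al i) -> schur_span (above k al) (jt S k al).
Proof.
move=> dec pos; pose s := [seq `|al i|%N | i <- iota 0 k].
pose nu := [seq x <- s | (0 < x)%N].
have nth_s i : (i < k)%N -> (nth 0%N s i)%:Z = al i.
  by move=> ik; rewrite (nth_map 0%N) ?size_iota // nth_iota // add0n gez0_abs ?pos.
have sorted_s : sorted geq s.
  apply/(sortedP 0%N) => i; rewrite size_map size_iota => ik.
  have := dec i ik; rewrite -!nth_s // -1?ltnW //.
  by rewrite /geq /=; lia.
have nuE i : (i < k)%N -> al i = vec nu i.
  by move=> ik; rewrite /vec nth_filter_pos // nth_s.
have size_nu : (size nu <= k)%N.
  by rewrite size_filter (leq_trans (count_size _ _)) // size_map size_iota.
have e_al : jt S k al = sschur nu by rewrite (eq_jt nuE) jt_trailing.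
rewrite e_al; apply: lin_span_gen; split=> //.
  rewrite /is_part filter_all andbT.
  by apply: sorted_filter sorted_s => a b c h1 h2; apply: leq_trans h2 h1.
split=> [r rk | |].
- rewrite /pre (eq_bigr (fun i : 'I_r => vec nu i)) // => i _.
  by rewrite nuE // (leq_trans _ rk).
- by apply: eq_bigr => i _; rewrite nuE.
- have -> // : wgt k al = wgt k (vec nu).
  by apply: eq_bigr => i _; rewrite nuE.
Qed.

Lemma wgt_lower_bound k al : (forall i, (i < k)%N -> - k%:Z <= al i) ->
  - (k * k * k)%N%:Z <= wgt k al.
Proof.
move=> lb; have -> : - (k * k * k)%N%:Z = \sum_(i < k) - (k * k)%N%:Z.
  by rewrite sumr_const card_ord -mulr_natr; nia.
rewrite /wgt; apply: Num.Theory.ler_sum => i _; have := lb i (ltn_ord i).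
by have := ltn_ord i; move: (nat_of_ord i) (al i) => l x; nia.
Qed.

(** Straightening: swapping the rows at an ascent goes up in dominance and strictly lowers [wgt],
    unless the two rows agree and the determinant is 0. Below weight -k^3 some entry is so negative
    that its row vanishes, so the descent stops. *)
Lemma schur_span_jt k al : schur_span (above k al) (jt S k al).
Proof.
pose K : int := (k * k * k)%N.
suff main n : forall al, wgt k al + K < n%:Z -> schur_span (above k al) (jt S k al).
  by apply: (main (absz (wgt k al + K)).+1); lia.
elim: n => [|n IHn] {}al lt_n.
all: have [/existsP[i low] | /existsPn low] :=
    boolP [exists i : 'I_k, al i - i%:Z + k%:Z <= 0];
  first by rewrite (jt_row0 (ltn_ord i) low); apply: lin_span0.
all: have lb : - K <= wgt k al.
1,3: apply: wgt_lower_bound => i ik; have := low (Ordinal ik); rewrite /=; lia.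
  by lia.
have [/existsP[i /andP[ik lt_i]] | /existsPn dec] :=
    boolP [exists i : 'I_k, (i.+1 < k)%N && (al i < al i.+1)].
  have [e|ne] := eqVneq (al i - i%:Z) (al i.+1 - i.+1%:Z).
    rewrite (jt_rows_eq (ltn_ord i) ik _ e); first exact: lin_span0.
    by rewrite neq_ltn ltnSn.
  rewrite -[jt S k al]opprK -(jt_swap al ik) -scaleN1r; apply: lin_spanZ.
  set al' := move_cell _ _ _ _.
  have c0 : 0 <= al i.+1 - al i - 1 by lia.
  have dom : vdom k al al' by apply: vdom_move => //; exact: ltnSn.
  have wE : wgt k al' = _ := wgt_move (al i.+1 - al i - 1) al (ltn_ord i) ik.
  have wlt : wgt k al' < wgt k al.
    rewrite wE; move: ne lt_i; move: (nat_of_ord i) (al _) (al _) => l x y; nia.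
  apply: lin_span_sub (IHn al' _); last by lia.
  by move=> nu [pnu snu dnu]; split=> //; apply: vdom_trans dnu.
have {}dec i : (i.+1 < k)%N -> al i.+1 <= al i.
  by move=> ik; have := dec (Ordinal (ltnW ik)); rewrite /= ik /=; lia.
case: k @K IHn lt_n low lb dec => [|k] K IHn lt_n low lb dec.
  by apply: jt_above.
have [lt0 | ge0] := Order.TotalTheory.ltP (al k) 0.
  rewrite (@jt_row0 k.+1 al k) //; [exact: lin_span0 | lia].
apply: jt_above => // i ik.
have le_ik : al k <= al i.
  have -> : i = (k - (k - i))%N by lia.
  elim: (k - i)%N => [|m IHm]; first by rewrite subn0.
  have [km|mk] := leqP k m; first by rewrite (_ : k - m.+1 = k - m)%N //; lia.
  have := dec (k - m.+1)%N; rewrite (_ : (k - m.+1).+1 = (k - m)%N); last by lia.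
  by move=> H; apply: (Order.POrderTheory.le_trans IHm); apply: H; lia.
exact: Order.POrderTheory.le_trans ge0 le_ik.
Qed.
End Straightening.

(** * Triangularity *)

Section MalgLinear.
Variables (F : fieldType) (S : comAlgType F) (K : conomType).
Implicit Types (hK : K -> S) (P Q : {malg F[K]}).

Definition mlin hK P : S := mmap (in_alg S) hK P.

Lemma mlinZ hK c P : mlin hK (c *: P) = c *: mlin hK P.
Proof.
rewrite /mlin (mmapEw (msuppZ_le _ _)) mmapE scaler_sumr.
by apply: eq_bigr => m _; rewrite mcoeffZ /= !mulr_algl scalerA.
Qed.

Lemma mlin_lin hK c P Q : mlin hK (c *: P + Q) = c *: mlin hK P + mlin hK Q.
Proof. by rewrite -mlinZ; exact: mmapD. Qed.

Lemma mlinU hK m : mlin hK << m >> = hK m.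
Proof. by rewrite /mlin mmapU /= scale1r mul1r. Qed.

Lemma mlin_mulU hK m P : mlin hK (<< m >> * P) = mlin (fun m' => hK (mmul m m')) P.
Proof.
elim/malg_ind: P => [c f g IHf IHg | | m'].
- rewrite mulrDr mlin_lin -IHf -IHg -mlinZ; rewrite -[LHS]/(mmap _ _ _) mmapD.
  by congr (_ + _); rewrite mulrC -scalerAl mulrC.
- by rewrite mulr0 /mlin !mmap0.
- by rewrite malgM_def fgmulUU mulr1 !mlinU.
Qed.
End MalgLinear.

(* A polynomial ring acting linearly, but not multiplicatively, on the products
   prod_i h_(al_i - i): multiplying by y_i raises the i-th index by one. *)
Record shift_model (F : fieldType) (S : sym_model F) (k : nat) := ShiftModel {
  sa_alg :> comAlgType F;
  yv : nat -> sa_alg;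
  Phi : (nat -> int) -> sa_alg -> S;
  Phi_lin : forall al c P Q, Phi al (c *: P + Q) = c *: Phi al P + Phi al Q;
  eq_Phi : forall al al' P, (forall i, (i < k)%N -> al i = al' i) ->
    Phi al P = Phi al' P;
  Phi_y1 : forall al i P, (i < k)%N ->
    Phi al (yv i * P) = Phi (fun l => al l + (if l == i then 1 else 0)) P;
  Phi_1 : forall al, Phi al 1 = \prod_(i < k) shz S (al i - i%:Z);
  Phi_vanish : forall P, exists N : nat, forall al i, (i < k)%N ->
    al i - i%:Z + N%:Z < 0 -> Phi al P = 0
}.

Lemma shift_model_exists (F : fieldType) (S : sym_model F) (k : nat) : shift_model S k.
Proof.
pose hK al (m : {cmonom nat}) : S := \prod_(i < k) shz S (al i - i%:Z + (m i)%:Z).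
apply: (@ShiftModel F S k {malg F[{cmonom nat}]} (fun i => << ucm i >>)
  (fun al => mlin (hK al))).
- by move=> al; exact: mlin_lin.
- move=> al al' P e; rewrite /mlin !mmapE; apply: eq_bigr => m _; congr (_ * _).
  by apply: eq_bigr => i _; rewrite e.
- move=> al i P ik; rewrite mlin_mulU /mlin !mmapE; apply: eq_bigr => m _.
  congr (_ * _); apply: eq_bigr => l _; congr (shz S _).
  rewrite cmM cmU [i == l]eq_sym.
  by case: eqP => _ /=; move: (al l) (m l) (nat_of_ord l) => ? ? ?; lia.
- move=> al; rewrite [LHS]mlinU; apply: eq_bigr => i _; rewrite cm1 addr0 //.
- move=> P; exists (msize P) => al i ik lt0; rewrite /mlin mmapE big_seq big1 // => m mP.
  rewrite /hK (bigD1 (Ordinal ik)) //= shz_lt0 ?mul0r ?mulr0 //.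
  have le_m : (m i <= mdeg m)%N.
    rewrite mdegE; have [im|] := boolP (i \in finsupp m).
      by rewrite (big_fsetD1 i) //= leq_addr.
    by rewrite -cmE_eq0 => /eqP->.
  have := msize_mdeg_lt mP; move: (msize P) (mdeg m) (m i) le_m lt0 => a b c; lia.
Qed.

Section RowScaling.
Variables (F : fieldType) (S : sym_model F) (k : nat) (M : shift_model S k).
Implicit Types (al : nat -> int) (P Q : M).
Local Notation y := (@yv F S k M).
Local Notation Phi := (@Phi F S k M).

HB.instance Definition _ al := GRing.isLinear.Build F M S *:%R (Phi al) (@Phi_lin F S k M al).

(** Row i is lowered beforehand to make room for both terms: y_i restores [al], while y_j moves one
    cell from row i to row j. *)
Lemma Phi_pair al i j c d P : (i < k)%N -> (j < k)%N ->
  Phi (fun l => al l - (if l == i then 1 else 0)) ((c *: y i - d *: y j) * P) =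
  c *: Phi al P - d *: Phi (move_cell j i 1 al) P.
Proof.
move=> ik jk; rewrite mulrBl linearB -!scalerAl !linearZ /= !Phi_y1 //.
congr (_ *: _ + _ *: - _); apply: eq_Phi => l _; first by case: ifP => _; lia.
by rewrite /move_cell; case: ifP; case: ifP => _ _; lia.
Qed.

Lemma Phi_y al i n P : (i < k)%N -> Phi al (y i ^+ n * P) =
  Phi (fun l => al l + (if l == i then n%:Z else 0)) P.
Proof.
move=> ik; elim: n al P => [|n IHn] al P.
  by rewrite mul1r; apply: eq_Phi => l _; case: ifP; rewrite addr0.
rewrite exprSr -mulrA IHn Phi_y1 //; apply: eq_Phi => l _.
by case: ifP => _; move: (al l) => x; lia.
Qed.

Lemma Phi_prod al (n : 'I_k -> nat) :
  Phi al (\prod_(i < k) y i ^+ n i) = \prod_(i < k) shz S (al i - i%:Z + (n i)%:Z).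
Proof.
pose n' (i : nat) : nat := if insub i is Some o then n o else 0%N.
have n'E (i : 'I_k) : n' i = n i by rewrite /n' valK.
under eq_bigr => i _ do rewrite -n'E.
under [RHS]eq_bigr => i _ do rewrite -n'E.
suff main r P : (r <= k)%N -> Phi al (\prod_(i < r) y i ^+ n' i * P) =
    Phi (fun l => al l + (if (l < r)%N then (n' l)%:Z else 0)) P.
  rewrite -[\prod_(i < k) _ in LHS]mulr1 main // Phi_1; apply: eq_bigr => i _.
  by rewrite ltn_ord addrAC.
elim: r P => [|r IHr] P rk.
  by rewrite big_ord0 mul1r; apply: eq_Phi => l _; rewrite addr0.
rewrite big_ord_recr /= -mulrA IHr ?(ltnW rk) // Phi_y //; apply: eq_Phi => l _.
have -> : (l < r.+1)%N = (l == r) || (l < r)%N by rewrite ltnS leq_eqVlt.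
by case: eqP => [->|_]; rewrite ?ltnn /= addr0.
Qed.

(** Lifts Jacobi-Trudi to a Vandermonde determinant, which has a product formula whose factors can
    be altered one at a time. *)
Lemma Phi_det al (z : nat -> F) :
  Phi al (\det (\matrix_(i < k, j < k) (z i *: y i) ^+ j)) =
  \det (\matrix_(i < k, j < k) (z i ^+ j *: jt_entry S al i j)).
Proof.
rewrite /determinant linear_sum; apply: eq_bigr => sg _.
under eq_bigr => i _ do rewrite mxE exprZn.
under [in RHS]eq_bigr => i _ do rewrite mxE.
rewrite !scaler_prod -!scalerAr linearZ /=; congr (_ *: _).
have sign (x : M) : Phi al ((-1) ^+ sg * x) = (-1) ^+ sg * Phi al x.
  by rewrite !mulr_sign; case: ifP => // _; exact: linearN.
by rewrite sign Phi_prod.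
Qed.

Section Factors.
Variables (r : nat) (s : F).
Hypothesis rk : (r < k)%N.

(** The Vandermonde factor of a pair i < j, with the scaling of y_r recorded separately in each
    factor that contains it: [x] is indexed by the other row. The scaling can then be switched on
    row by row. *)
Definition vfac (x : nat -> F) (i j : nat) : M :=
  if j == r then x i *: y r - y i
  else if i == r then y j - x j *: y r else y j - y i.

Definition vpol (x : nat -> F) :=
  \prod_(e : 'I_k * 'I_k | (e.1 < e.2)%N) vfac x e.1 e.2.

Lemma vpol_det c : vpol (fun=> c) =
  \det (\matrix_(i < k, j < k) ((if i == r :> nat then c else 1) *: y i) ^+ j).
Proof.
rewrite -det_tr; pose a : 'rV_k := \row_j ((if j == r :> nat then c else 1) *: y j).
rewrite (_ : _^T = Vandermonde k a); last by apply/matrixP => i j; rewrite !mxE.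
rewrite det_Vandermonde pair_big_dep /=; apply: eq_bigr => e lt_e; rewrite !mxE /vfac.
case: (eqVneq (e.2 : nat) r) => [e2|_].
  by rewrite -e2 ifF ?scale1r // ltn_eqF.
by case: (eqVneq (e.1 : nat) r) => [->|_]; rewrite !scale1r.
Qed.

Lemma Phi_vpol1 al : Phi al (vpol (fun=> 1)) = jt S k al.
Proof.
rewrite vpol_det (Phi_det _ (fun i => if i == r then 1 else 1)).
congr (\det _); apply/matrixP => i j; rewrite !mxE.
by rewrite if_same expr1n scale1r.
Qed.

Lemma Phi_vpol_row al : Phi al (vpol (fun=> s)) = jt_row S al s (Ordinal rk).
Proof.
rewrite vpol_det (Phi_det _ (fun i => if i == r then s else 1)).
congr (\det _); apply/matrixP => i j; rewrite !mxE -val_eqE /=.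
by case: eqP => _; rewrite ?expr1n ?scale1r.
Qed.

Definition xstep (n l : nat) : F := if (l < n)%N then s else 1.

Lemma vpol_stepr : vpol (xstep r.+1) = vpol (xstep r).
Proof.
apply: eq_bigr => e lt_e; rewrite /vfac /xstep; case: eqP => [e2|n2].
  by congr (_ *: _ - _); congr (if _ then _ else _); lia.
by case: eqP => // e1; congr (_ - _ *: _); congr (if _ then _ else _); lia.
Qed.

(** Only the factor of the pair {a, r} changes; [P] is the product of the others, with a sign when r
    < a. *)
Lemma vpol_step a : (a < k)%N -> a != r -> exists P,
  vpol (xstep a) = (y r - y a) * P /\ vpol (xstep a.+1) = (s *: y r - y a) * P.
Proof.
move=> ak ar.
have xa : xstep a a = 1 by rewrite /xstep ltnn.
have xa1 : xstep a.+1 a = s by rewrite /xstep ltnSn.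
have xo l : l != a -> xstep a.+1 l = xstep a l.
  by rewrite /xstep => la; congr (if _ then _ else _); lia.
have [lt_ar | le_ra] := ltnP a r.
  pose e0 := (Ordinal ak, Ordinal rk).
  exists (\prod_(e : 'I_k * 'I_k | (e.1 < e.2)%N && (e != e0)) vfac (xstep a) e.1 e.2).
  split; rewrite /vpol (bigD1 e0) //=; congr (_ * _); rewrite ?/vfac ?eqxx ?xa ?xa1 ?scale1r //.
  apply: eq_bigr => e /andP[lt_e ne]; rewrite /vfac.
  case: eqP => [e2|_]; last by case: eqP => // e1; rewrite xo //; lia.
  rewrite xo //; apply: contra ne => /eqP e1.
  by rewrite [e]surjective_pairing /e0 xpair_eqE -!val_eqE /= e1 e2 !eqxx.
have lt_ra : (r < a)%N by lia.
pose e0 := (Ordinal rk, Ordinal ak).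
exists (- \prod_(e : 'I_k * 'I_k | (e.1 < e.2)%N && (e != e0)) vfac (xstep a) e.1 e.2).
rewrite !mulrN -!mulNr !opprB.
split; rewrite /vpol (bigD1 e0) //=; congr (_ * _);
  rewrite ?/vfac ?(negPf ar) ?eqxx ?xa ?xa1 ?scale1r //.
apply: eq_bigr => e /andP[lt_e ne]; rewrite /vfac.
case: eqP => [e2|n2]; first by rewrite xo //; lia.
case: eqP => // e1; rewrite xo //; apply: contra ne => /eqP e2.
by rewrite [e]surjective_pairing /e0 xpair_eqE -!val_eqE /= e1 e2 !eqxx.
Qed.

Local Notation strict al := (@schur_span F S (above_strict k al)).

Lemma above_strict_move i j al nu : (i < j)%N -> (j < k)%N ->
  above k (move_cell i j 1 al) nu -> above_strict k al nu.
Proof.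
move=> ij jk [pnu snu dnu]; have ik := ltn_trans ij jk.
have dm := vdom_move al ij jk (erefl : 0 <= 1 :> int).
split; first by split=> //; apply: vdom_trans dm dnu.
by case: dnu => _ _; rewrite wgt_move //; lia.
Qed.

Lemma strict_move_above i j al f : (i < j)%N -> (j < k)%N ->
  schur_span (above k (move_cell i j 1 al)) f -> strict al f.
Proof. by move=> ij jk; apply: lin_span_sub => nu; apply: above_strict_move. Qed.

Lemma strict_move i j al f : (i < j)%N -> (j < k)%N ->
  strict (move_cell i j 1 al) f -> strict al f.
Proof.
move=> ij jk Sf; apply: (strict_move_above ij jk); apply: lin_span_sub Sf.
by move=> nu [].
Qed.

(** For consecutive products V, V' cross-multiplication in [vpol_step] gives (y_r - y_n) V' = (s y_r
    - y_n) V. Under [Phi] one variable restores the index vector and the other moves a cell upwards.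
    So V' agrees with V times s or 1 up to terms strictly above, and s occurs exactly when n < r,
    whence the exponent min(n, r). *)
Lemma Phi_vpol_xstep n al : (n <= k)%N ->
  strict al (Phi al (vpol (xstep n)) - s ^+ minn n r *: jt S k al).
Proof.
elim: n al => [|n IHn] al nk.
  rewrite min0n expr0 scale1r (_ : vpol _ = vpol (fun=> 1)) // Phi_vpol1 subrr.
  exact: lin_span0.
have [enr|nr] := eqVneq n r.
  rewrite enr vpol_stepr (_ : minn r.+1 r = minn n r); last by lia.
  have -> : vpol (xstep r) = vpol (xstep n) by rewrite enr.
  by apply: IHn; exact: ltnW.
have [P [Pn Pn1]] := vpol_step nk nr.
have [N0 van0] := Phi_vanish (vpol (xstep n)).
have [N1 van1] := Phi_vanish (vpol (xstep n.+1)).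
(* The indices moved between rows n and r: the smaller gains, the larger loses. *)
pose lo := minn n r; pose hi := maxn n r.
have lohi : (lo < hi)%N by rewrite /lo /hi; lia.
have hik : (hi < k)%N by rewrite /hi; lia.
have rel be : Phi be (vpol (xstep n.+1)) =
    (if (n < r)%N then s else 1) *: Phi be (vpol (xstep n))
    + Phi (move_cell lo hi 1 be) (vpol (xstep n.+1))
    - (if (n < r)%N then 1 else s) *: Phi (move_cell lo hi 1 be) (vpol (xstep n)).
  have comm : (1 *: y r - 1 *: y n) * vpol (xstep n.+1) =
      (s *: y r - 1 *: y n) * vpol (xstep n).
    by rewrite Pn Pn1 !scale1r mulrCA.
  case: ltnP => nr'.
    have -> : lo = n by rewrite /lo; lia. have -> : hi = r by rewrite /hi; lia.
    have := congr1 (Phi (fun l => be l - (if l == r then 1 else 0))) comm.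
    rewrite !Phi_pair // !scale1r => e.
    by rewrite -addrA addrCA -e addrC subrK.
  have -> : lo = r by rewrite /lo; lia. have -> : hi = n by rewrite /hi; lia.
  have := congr1 (fun p => Phi (fun l => be l - (if l == n then 1 else 0)) (- p)) comm.
  rewrite -!mulNr !opprB !Phi_pair // !scale1r => e.
  by rewrite addrAC -e subrK.
(* The moved vector satisfies the same relation; iterating lowers row [hi] until the image and the
   determinant both vanish. *)
suff main m : forall be, be hi - hi%:Z + N0%:Z + N1%:Z + k%:Z < m%:Z ->
    strict be (Phi be (vpol (xstep n.+1)) - s ^+ minn n.+1 r *: jt S k be).
  by apply: (main (absz (al hi - hi%:Z + N0%:Z + N1%:Z + k%:Z)).+1); lia.
elim: m => [|m IHm] be lt_m.
  rewrite (van1 _ _ hik) ?(@jt_row0 _ _ _ _ _ hik) ?scaler0 ?subrr; [exact: lin_span0|lia|lia].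
set be' := move_cell lo hi 1 be.
have be'hi : be' hi = be hi - 1.
  by rewrite /be' /move_cell eqxx (gtn_eqF lohi) addr0.
have IH1 := strict_move lohi hik (IHm be' _).
have IH0 := IHn be (ltnW nk).
have IH0' := strict_move lohi hik (IHn be' (ltnW nk)).
have J := strict_move_above lohi hik (schur_span_jt S k be').
rewrite rel -/be'.
set c1 := if _ then s else 1; set c2 := if _ then 1 else s.
have e1 : s ^+ minn n.+1 r = c1 * s ^+ minn n r.
  rewrite /c1; case: ltnP => nr'.
    by rewrite -exprS; congr (_ ^+ _); lia.
  by rewrite mul1r; congr (_ ^+ _); lia.
have -> : c1 *: Phi be (vpol (xstep n)) + Phi be' (vpol (xstep n.+1))
    - c2 *: Phi be' (vpol (xstep n)) - s ^+ minn n.+1 r *: jt S k be =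
  c1 *: (Phi be (vpol (xstep n)) - s ^+ minn n r *: jt S k be) +
  (1 *: (Phi be' (vpol (xstep n.+1)) - s ^+ minn n.+1 r *: jt S k be') +
   (- c2 *: (Phi be' (vpol (xstep n)) - s ^+ minn n r *: jt S k be') +
    (s ^+ minn n.+1 r - c2 * s ^+ minn n r) *: jt S k be')).
  rewrite e1 scale1r !scaleNr !scalerBr !scalerBl !scalerA; ring.
apply: lin_span_lin => //; apply: lin_span_lin; first by apply: IH1; lia.
by apply: lin_span_lin => //; apply: lin_spanZ.
Qed.

Lemma jt_row_triangular al :
  strict al (jt_row S al s (Ordinal rk) - s ^+ r *: jt S k al).
Proof.
have := Phi_vpol_xstep al (leqnn k); rewrite (_ : minn k r = r); last by lia.
rewrite -Phi_vpol_row (_ : vpol (xstep k) = vpol (fun=> s)) //.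
apply: eq_bigr => e lt_e; rewrite /vfac /xstep !ltn_ord //.
Qed.
End Factors.
End RowScaling.

(** * Partitions *)

Section Partitions.
Implicit Types (mu nu ka : seq nat) (r c i j n N : nat).

Definition psum_of mu r := (\sum_(i < r) nth 0 mu i)%N.
(** Macdonald's statistic n(mu), which is also the total leg length. *)
Definition pweight mu := (\sum_(i < size mu) i * nth 0 mu i)%N.

(* Strict dominance; the weight makes it visibly well founded. *)
Definition gt_part mu nu := [/\ is_part nu, sumn nu = sumn mu, dominates nu mu
  & (pweight nu < pweight mu)%N].

Lemma is_part_nth mu i j : is_part mu -> (i <= j)%N -> (nth 0 mu j <= nth 0 mu i)%N.
Proof.
move=> /andP[smu _] ij; have [jm|] := ltnP j (size mu); last first.
  by move=> mj; rewrite nth_default.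
have tr : transitive geq by move=> a b d h1 h2; apply: leq_trans h2 h1.
by apply: (sorted_leq_nth tr (fun x => leqnn x) 0%N smu) => //; apply: leq_ltn_trans jm.
Qed.

Lemma is_part_nth_gt0 mu i : is_part mu -> (i < size mu)%N -> (0 < nth 0 mu i)%N.
Proof. by move=> /andP[_ /allP pos] im; apply: pos; apply: mem_nth. Qed.

Lemma part_eq mu nu : is_part mu -> is_part nu -> nth 0%N mu =1 nth 0%N nu -> mu = nu.
Proof.
move=> pm pn e; have le_size a b : is_part a -> nth 0%N a =1 nth 0%N b ->
    (size a <= size b)%N.
  move=> pa eab; rewrite leqNgt; apply/negP => lt.
  by have := is_part_nth_gt0 pa lt; rewrite eab nth_default.
by apply: (@eq_from_nth _ 0%N) => [|i _] //; apply/eqP; rewrite eqn_leq !le_size.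
Qed.

Lemma sum_nth_widen (G : nat -> nat -> nat) mu N : (forall i, G i 0 = 0)%N ->
  (size mu <= N)%N ->
  (\sum_(i < size mu) G i (nth 0 mu i) = \sum_(i < N) G i (nth 0 mu i))%N.
Proof.
move=> G0 le; rewrite (big_ord_widen _ (fun i => G i (nth 0 mu i)) le) big_mkcond.
apply: eq_bigr => i _; case: ltnP => // le_i; by rewrite nth_default.
Qed.

Lemma sumnE mu : sumn mu = psum_of mu (size mu).
Proof. by rewrite sumnE (big_nth 0%N) big_mkord. Qed.

Lemma psum_of_sumn mu N : (size mu <= N)%N -> psum_of mu N = sumn mu.
Proof. by move=> le; rewrite sumnE /psum_of (@sum_nth_widen (fun=> id) mu N). Qed.

Lemma psum_ofS mu r : psum_of mu r.+1 = (psum_of mu r + nth 0 mu r)%N.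
Proof. by rewrite /psum_of big_ord_recr. Qed.

Lemma pweight_widen mu N : (size mu <= N)%N ->
  pweight mu = (\sum_(i < N) i * nth 0 mu i)%N.
Proof. by move=> le; apply: (@sum_nth_widen muln) => // i; rewrite muln0. Qed.

Lemma pweight_psum mu N : (size mu <= N)%N ->
  (pweight mu + \sum_(r < N) psum_of mu r.+1 = N * sumn mu)%N.
Proof.
move=> le; rewrite (pweight_widen le) -(psum_of_sumn le); elim: N {le} => [|N IHN].
  by rewrite !big_ord0.
rewrite big_ord_recr [X in (_ + X)%N]big_ord_recr /= psum_ofS.
move: (\sum_(i < N) _)%N (\sum_(r < N) _)%N (psum_of mu N) (nth 0 mu N)%N IHN.
by move=> a b p x IHN; nia.
Qed.

(** By [pweight_psum] the weight is determined by the total of the partial sums, so if it does not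
    drop, dominance forces all partial sums to agree. *)
Lemma dominates_eq_or_gt mu nu : is_part mu -> is_part nu -> sumn nu = sumn mu ->
  dominates nu mu -> nu = mu \/ gt_part mu nu.
Proof.
move=> pm pn es dom; case: (ltnP (pweight nu) (pweight mu)) => [lt|ge]; first by right.
left; pose N := maxn (size mu) (size nu).
have := pweight_psum (leq_maxl (size mu) (size nu)).
have := pweight_psum (leq_maxr (size mu) (size nu)).
rewrite -/N es => en em.
have eqp r : (r <= N)%N -> psum_of nu r = psum_of mu r.
  case: r => [|r]; first by rewrite /psum_of !big_ord0.
  move=> rN; apply/eqP; rewrite eqn_leq dom andbT leqNgt; apply/negP => lt.
  have : (\sum_(r < N) psum_of mu r.+1 < \sum_(r < N) psum_of nu r.+1)%N.
    rewrite (bigD1 (Ordinal rN)) //= [X in (_ < X)%N](bigD1 (Ordinal rN)) //=.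
    by rewrite -addSn leq_add // leq_sum // => i _; apply: dom.
  by lia.
apply: part_eq => // i; have [iN|Ni] := ltnP i N.
  by have := eqp i.+1 iN; rewrite !psum_ofS eqp ?(ltnW iN) // => /addnI.
by rewrite !nth_default // (leq_trans _ Ni) // ?leq_maxl ?leq_maxr.
Qed.

Lemma gt_part_trans mu nu ka : gt_part mu nu -> gt_part nu ka -> gt_part mu ka.
Proof.
move=> [_ s1 d1 w1] [pk s2 d2 w2]; split=> //.
- by rewrite s2.
- by move=> r; apply: leq_trans (d1 r) (d2 r).
- exact: ltn_trans w2 w1.
Qed.

Lemma above_strict_gt mu nu :
  above_strict (size mu) (vec mu) nu -> gt_part mu nu.
Proof.
have preE ka r : pre r (vec ka) = (psum_of ka r)%:Z.
  by rewrite /psum_of (big_morph _ PoszD (erefl 0%:Z)).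
have wgtE ka k : (size ka <= k)%N -> wgt k (vec ka) = (pweight ka)%:Z.
  move=> le; rewrite (pweight_widen le) (big_morph _ PoszD (erefl 0%:Z)).
  by apply: eq_bigr => i _; rewrite PoszM.
move=> [[pn sn [dn en wn]] lt]; split=> //.
- move: en; rewrite !preE !psum_of_sumn // => -[->] //.
- move=> r; have [rk|kr] := leqP r (size mu).
    by have := dn r rk; rewrite !preE.
  rewrite -/(psum_of mu r) -/(psum_of nu r) !psum_of_sumn ?(ltnW kr) //; last first.
    exact: leq_trans sn (ltnW kr).
  by move: en; rewrite !preE !psum_of_sumn // => -[->].
- by move: lt; rewrite !wgtE.
Qed.

Lemma count_nth mu r c : is_part mu ->
  (r < count (fun x => c < x) mu)%N = (c < nth 0 mu r)%N.
Proof.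
elim: mu r => [|x mu IH] r pm; first by rewrite nth_nil !ltn0.
have pmu : is_part mu.
  by case/andP: pm => /= /path_sorted s /andP[_ a]; apply/andP.
have le_x i : (nth 0 mu i <= x)%N by apply: (@is_part_nth (x :: mu) 0 i.+1 pm).
case: r => [|r] /=; last first.
  rewrite -IH //; case: (ltnP c x) => [cx|xc]; first by rewrite add1n ltnS.
  rewrite add0n (_ : count _ mu = 0)%N ?ltn0 //; apply/eqP.
  rewrite -leqn0 leqNgt -has_count; apply/hasPn => y /(nthP 0%N)[i _ <-].
  by rewrite -leqNgt (leq_trans (le_x i)).
case: (ltnP c x) => [cx|xc] //; rewrite add0n.
rewrite (_ : count _ mu = 0)%N ?ltn0 //; apply/eqP.
rewrite -leqn0 leqNgt -has_count; apply/hasPn => y /(nthP 0%N)[i _ <-].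
by rewrite -leqNgt (leq_trans (le_x i)).
Qed.

Lemma nth_conj_part mu c : is_part mu ->
  nth 0%N (conj_part mu) c = count (fun x => c < x)%N mu.
Proof.
move=> pm; have [lt|ge] := ltnP c (head 0%N mu).
  by rewrite (nth_map 0%N) ?size_iota // nth_iota.
rewrite nth_default ?size_map ?size_iota //; apply/esym/eqP.
rewrite -leqn0 leqNgt; apply/negP; rewrite (count_nth 0 c pm) nth0 => lt; lia.
Qed.

Lemma cell_conj mu r c : is_part mu ->
  (r < nth 0 (conj_part mu) c)%N = (c < nth 0 mu r)%N.
Proof. by move=> pm; rewrite nth_conj_part // count_nth. Qed.

Lemma conj_part_is_part mu : is_part mu -> is_part (conj_part mu).
Proof.
move=> pm; apply/andP; split.
  apply/(sortedP 0%N) => i _; rewrite /geq /= !nth_conj_part //.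
  by apply: sub_count => x /=; lia.
apply/(all_nthP 0%N) => i; rewrite size_map size_iota => lt.
by rewrite nth_conj_part // (count_nth 0 i pm) nth0.
Qed.

Lemma size_le_sumn mu : is_part mu -> (size mu <= sumn mu)%N.
Proof.
elim: mu => //= x mu IH /andP[/= /path_sorted s /andP[x0 a]].
by have := IH (introT andP (conj s a)); lia.
Qed.

Lemma nth_le_sumn mu i : (nth 0 mu i <= sumn mu)%N.
Proof.
elim: mu i => [|x mu IH] [|i] //=; first by rewrite leq_addr.
by rewrite (leq_trans (IH i)) ?leq_addl.
Qed.

Lemma sum_cells (G : nat -> nat) n N : (n <= N)%N ->
  (\sum_(c < N) (c < n) * G c = \sum_(c < n) G c)%N.
Proof.
move=> le; rewrite (big_ord_widen _ G le) [RHS]big_mkcond; apply: eq_bigr => c _.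
by case: ltnP => _; rewrite ?mul1n.
Qed.

Lemma sumn_cells mu N : is_part mu -> (sumn mu <= N)%N ->
  sumn mu = (\sum_(r < N) \sum_(c < N) (c < nth 0 mu r))%N.
Proof.
move=> pm le; rewrite -(psum_of_sumn (leq_trans (size_le_sumn pm) le)).
apply: eq_bigr => r _; under eq_bigr => c _ do rewrite -[nat_of_bool _]muln1.
rewrite (sum_cells (fun=> 1%N)) ?sum1_card ?card_ord //.
exact: leq_trans (nth_le_sumn _ _) le.
Qed.

Lemma sumn_conj mu : is_part mu -> sumn (conj_part mu) = sumn mu.
Proof.
move=> pm; pose N := maxn (sumn mu) (sumn (conj_part mu)).
rewrite (sumn_cells (N := N) pm) ?leq_maxl //.
rewrite (sumn_cells (N := N) (conj_part_is_part pm)) ?leq_maxr //.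
by rewrite exchange_big; do 2 apply: eq_bigr => ? _; rewrite cell_conj.
Qed.

(* Conjugation reverses dominance: bound sum_r min(nu_r, j) by splitting the
   rows at the number of parts of mu exceeding j. *)
Lemma conj_dominates mu nu j : is_part mu -> is_part nu -> sumn nu = sumn mu ->
  dominates nu mu -> (psum_of (conj_part nu) j <= psum_of (conj_part mu) j)%N.
Proof.
move=> pm pn es dom; pose N := (sumn mu + sumn nu)%N.
have szm : (size mu <= N)%N by rewrite (leq_trans (size_le_sumn pm)) ?leq_addr.
have szn : (size nu <= N)%N by rewrite (leq_trans (size_le_sumn pn)) ?leq_addl.
have minE ka : is_part ka -> (size ka <= N)%N ->
    psum_of (conj_part ka) j = (\sum_(r < N) minn (nth 0 ka r) j)%N.
  move=> pk szk; rewrite /psum_of.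
  transitivity (\sum_(c < j) \sum_(r < N) (c < nth 0 ka r))%N.
    apply: eq_bigr => c _; rewrite nth_conj_part // -sum1_count (big_nth 0%N) big_mkord.
    rewrite -(@sum_nth_widen (fun _ x => (c < x)%N) ka N) // [LHS]big_mkcond.
    by apply: eq_bigr => r _; case: ltnP.
  rewrite exchange_big; apply: eq_bigr => r _.
  rewrite -[RHS]card_ord -sum1_card -(sum_cells (fun=> 1%N) (geq_minr (nth 0 ka r) j)).
  by apply: eq_bigr => c _; rewrite muln1 leq_min ltn_ord andbT.
rewrite !minE //; pose R := count (fun x => j < x)%N mu.
have RN : (R <= N)%N by apply: leq_trans szm; apply: count_size.
have splitN (G : nat -> nat) : (\sum_(r < N) G r =
    \sum_(r < R) G r + \sum_(R <= r < N) G r)%N.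
  by rewrite -!(big_mkord xpredT G) -big_cat_nat.
have tot ka : (size ka <= N)%N ->
    (sumn ka = psum_of ka R + \sum_(R <= r < N) nth 0 ka r)%N.
  by move=> szk; rewrite -(psum_of_sumn szk) /psum_of splitN.
rewrite (splitN (fun r => minn (nth 0%N nu r) j)) (splitN (fun r => minn (nth 0%N mu r) j)).
have -> : (\sum_(r < R) minn (nth 0 mu r) j = \sum_(r < R) j)%N.
  apply: eq_bigr => r _; apply/minn_idPr/ltnW; rewrite -count_nth //; exact: ltn_ord.
have -> : (\sum_(R <= r < N) minn (nth 0 mu r) j = \sum_(R <= r < N) nth 0 mu r)%N.
  apply: eq_big_nat => r /andP[Rr _]; apply/minn_idPl.
  by rewrite leqNgt -count_nth // -leqNgt.
have l1 : (\sum_(r < R) minn (nth 0 nu r) j <= \sum_(r < R) j)%N.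
  by apply: leq_sum => r _; exact: geq_minr.
have l2 : (\sum_(R <= r < N) minn (nth 0 nu r) j <= \sum_(R <= r < N) nth 0 nu r)%N.
  by apply: leq_sum => r _; exact: geq_minl.
have := tot mu szm; have := tot nu szn; have : (psum_of mu R <= psum_of nu R)%N := dom R.
by lia.
Qed.

(** The cell condition makes ka the conjugate of nu; as nu dominates mu, ka is dominated by the
    conjugate of mu and cannot lie strictly above it. This separates the two lists of
    eigenvalues. *)
Lemma gt_part_conj mu nu ka : is_part mu -> is_part nu -> sumn nu = sumn mu ->
  dominates nu mu -> gt_part (conj_part mu) ka ->
  (forall r c, (r < nth 0 ka c)%N = (c < nth 0 nu r)%N) -> False.
Proof.
move=> pm pn es dom [pk sk dk wk] cells.
have e : ka = conj_part nu.
  apply: part_eq => //; first exact: conj_part_is_part.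
  move=> c; apply/eqP; rewrite eqn_leq; apply/andP; split; rewrite leqNgt; apply/negP.
    by rewrite cells -(cell_conj _ _ pn) ltnn.
  by rewrite cell_conj // -cells ltnn.
have le r : (psum_of ka r <= psum_of (conj_part mu) r)%N.
  by rewrite e; apply: conj_dominates.
have szm := pweight_psum (leq_maxl (size (conj_part mu)) (size ka)).
have szk := pweight_psum (leq_maxr (size (conj_part mu)) (size ka)).
have : (\sum_(r < maxn (size (conj_part mu)) (size ka)) psum_of ka r.+1 <=
    \sum_(r < maxn (size (conj_part mu)) (size ka)) psum_of (conj_part mu) r.+1)%N.
  by apply: leq_sum => r _; exact: le.
by move: szm szk wk; rewrite sk; lia.
Qed.
End Partitions.

(** * Eigenvalues *)

Section Independence.
Variable F : fieldType.
Implicit Types (u v : F) (mu nu ka : seq nat).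

(** Algebraic independence over the integers: the coefficients that occur are differences of cell
    indicators and sums of their products. *)
Definition indep u v := forall N (c : nat -> nat -> int),
  \sum_(i < N) \sum_(j < N) (c i j)%:~R * (u ^+ i * v ^+ j) = 0 ->
  forall i j, (i < N)%N -> (j < N)%N -> c i j = 0.

Lemma indep_sym u v : indep u v -> indep v u.
Proof.
move=> uv N c e i j iN jN; apply: (uv N (fun a b => c b a)) => //.
rewrite exchange_big -[RHS]e; do 2 apply: eq_bigr => ? _.
by congr (_ * _); rewrite mulrC.
Qed.

Lemma indep_neq0 u v : indep u v -> u != 0.
Proof.
move=> uv; apply/eqP => u0.
suff: (1 : int) = 0 by [].
apply: (uv 2%N (fun i j => ((i == 1%N) && (j == 0%N))%:Z) _ 1%N 0%N) => //.
rewrite big1 // => i _; rewrite big1 // => j _.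
case: (eqVneq (i : nat) 1%N) => [->|_]; last by rewrite mul0r.
by rewrite u0 expr1 mul0r mulr0.
Qed.

Lemma indep_exp u v a b c d : indep u v ->
  u ^+ a * v ^+ b = u ^+ c * v ^+ d -> (a = c) /\ (b = d).
Proof.
move=> uv e; pose N := (maxn (maxn a b) (maxn c d)).+1.
have := uv N (fun i j => ((i == a) && (j == b))%:Z - ((i == c) && (j == d))%:Z) _ a b.
have pick x y : (x < N)%N -> (y < N)%N ->
    \sum_(i < N) \sum_(j < N) (((i == x :> nat) && (j == y :> nat))%:Z)%:~R
      * (u ^+ i * v ^+ j) = u ^+ x * v ^+ y.
  move=> xN yN; rewrite (bigD1 (Ordinal xN)) //= [X in _ + X]big1 => [|i ix].
    rewrite addr0 (bigD1 (Ordinal yN)) //= !eqxx mul1r big1 ?addr0 // => j jy.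
    by rewrite -val_eqE /= in jy; rewrite (negPf jy) mul0r.
  by rewrite -val_eqE /= in ix; rewrite big1 // => j _; rewrite (negPf ix) mul0r.
rewrite !eqxx /= => /(_ _ _ _)/eqP; rewrite subr_eq0.
have z : \sum_(i < N) \sum_(j < N)
    (((i == a :> nat) && (j == b :> nat))%:Z - ((i == c :> nat) && (j == d :> nat))%:Z)%:~R
    * (u ^+ i * v ^+ j) = 0.
  under eq_bigr => i _ do (under eq_bigr => j _ do rewrite rmorphB mulrBl).
  under eq_bigr => i _ do rewrite sumrB.
  rewrite sumrB pick ?pick ?e ?subrr // /N; lia.
move=> /(_ z) H; have : 1%:Z == ((a == c) && (b == d))%:Z by apply: H; rewrite /N; lia.
by case: (a =P c) => [->|_]; case: (b =P d) => [->|_].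
Qed.

(** Multiplication by u^(N-1) v^(N-1) turns a polynomial in the inverses into one in u and v with
    the coefficient table reversed. *)
Lemma indep_inv u v : indep u v -> indep u^-1 v^-1.
Proof.
move=> uv N c e i j iN jN.
have u0 := indep_neq0 uv; have v0 := indep_neq0 (indep_sym uv).
have := uv N (fun a b => c (N - a.+1)%N (N - b.+1)%N) _ (N - i.+1)%N (N - j.+1)%N.
have -> : (N - (N - i.+1).+1 = i)%N by lia.
have -> : (N - (N - j.+1).+1 = j)%N by lia.
apply; last 2 [by lia].
rewrite (reindex_inj rev_ord_inj); under eq_bigr => a _ do rewrite (reindex_inj rev_ord_inj).
transitivity (u ^+ N.-1 * v ^+ N.-1 *
    \sum_(i < N) \sum_(j < N) (c i j)%:~R * (u^-1 ^+ i * v^-1 ^+ j)); last by rewrite e mulr0.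
rewrite mulr_sumr; apply: eq_bigr => a _; rewrite mulr_sumr; apply: eq_bigr => b _ /=.
have aN := ltn_ord a; have bN := ltn_ord b.
have flip (x : F) (m : nat) : x != 0 -> (m < N)%N -> x ^+ (N - m.+1) = x ^+ N.-1 * x^-1 ^+ m.
  move=> x0 mN; rewrite (_ : N.-1 = N - m.+1 + m)%N; last by lia.
  by rewrite exprD -mulrA -exprMn mulfV // expr1n mulr1.
have -> : (N - (N - a.+1).+1 = a)%N by move: (nat_of_ord a) aN => ?; lia.
have -> : (N - (N - b.+1).+1 = b)%N by move: (nat_of_ord b) bN => ?; lia.
by rewrite !flip // [RHS]mulrCA; congr (_ * _); rewrite mulrACA.
by lia.
Qed.

Lemma indep_neq1 u v : indep u v -> 1 - u != 0.
Proof.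
move=> uv; apply/eqP => /eqP; rewrite subr_eq0 => /eqP e.
have := @indep_exp u v 0 0 1 0 uv.
by rewrite !expr0 !mulr1 expr1 => /(_ e)[].
Qed.

Definition Bsum u v mu := \sum_(r < size mu) \sum_(c < nth 0%N mu r) v ^+ r * u ^+ c.

(** The diagonal coefficient of [Dprime_jt]: the factor u^(mu_i - i) there meets (uv)^i from the row
    scaled by uv. *)
Definition lam u v mu : F :=
  v ^+ size mu + (1 - v) * \sum_(r < size mu) v ^+ r * u ^+ nth 0%N mu r.

Lemma lamE u v mu : lam u v mu = 1 - (1 - u) * (1 - v) * Bsum u v mu.
Proof.
rewrite /lam.
have geo n : (1 - v) * \sum_(r < n) v ^+ r = 1 - v ^+ n.
  elim: n => [|n IHn]; first by rewrite big_ord0 expr0 mulr0 subrr.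
  by rewrite big_ord_recr mulrDr IHn /= exprS; ring.
have geou n : (1 - u) * \sum_(c < n) u ^+ c = 1 - u ^+ n.
  elim: n => [|n IHn]; first by rewrite big_ord0 expr0 mulr0 subrr.
  by rewrite big_ord_recr mulrDr IHn /= exprS; ring.
have -> : v ^+ size mu = 1 - (1 - v) * \sum_(r < size mu) v ^+ r by rewrite geo subKr.
have -> : (1 - u) * (1 - v) * Bsum u v mu = (1 - v) * \sum_(r < size mu)
    (v ^+ r - v ^+ r * u ^+ nth 0%N mu r).
  rewrite [(1 - u) * _]mulrC -mulrA; congr (_ * _); rewrite mulr_sumr.
  by apply: eq_bigr => r _; rewrite -mulr_sumr mulrCA geou; ring.
by rewrite sumrB; ring.
Qed.

Definition cell_sum u v (f : nat -> nat -> bool) N : F :=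
  \sum_(c < N) \sum_(r < N) (f c r)%:R * (u ^+ c * v ^+ r).

Lemma cell_sum_inj u v f g N : indep u v -> cell_sum u v f N = cell_sum u v g N ->
  forall c r, (c < N)%N -> (r < N)%N -> f c r = g c r.
Proof.
move=> uv e c r cN rN.
have := uv N (fun c r => (f c r)%:Z - (g c r)%:Z) _ c r cN rN.
have z : \sum_(i < N) \sum_(j < N) ((f i j)%:Z - (g i j)%:Z)%:~R * (u ^+ i * v ^+ j) = 0.
  under eq_bigr => i _ do (under eq_bigr => j _ do rewrite rmorphB mulrBl).
  under eq_bigr => i _ do rewrite sumrB.
  by rewrite sumrB; apply/eqP; rewrite subr_eq0; apply/eqP.
by move=> /(_ z); case: (f c r); case: (g c r).
Qed.

Lemma Bsum_cells u v mu N : is_part mu -> (sumn mu <= N)%N ->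
  Bsum u v mu = cell_sum u v (fun c r => c < nth 0 mu r)%N N.
Proof.
move=> pm le; rewrite /cell_sum exchange_big /=.
have le_size := leq_trans (size_le_sumn pm) le.
rewrite /Bsum (big_ord_widen _
  (fun r => \sum_(c < nth 0%N mu r) v ^+ r * u ^+ c) le_size) big_mkcond.
apply: eq_bigr => r _; case: ltnP => [_|ler]; last first.
  by rewrite big1 // => c _; rewrite nth_default // mul0r.
have le_r := leq_trans (nth_le_sumn mu r) le.
rewrite (big_ord_widen _ (fun c => v ^+ r * u ^+ c) le_r) big_mkcond.
by apply: eq_bigr => c _; case: ltnP => _; rewrite ?mul0r // mul1r mulrC.
Qed.

Lemma Bsum_swap_cells u v ka N : is_part ka -> (sumn ka <= N)%N ->
  Bsum v u ka = cell_sum u v (fun c r => r < nth 0 ka c)%N N.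
Proof.
move=> pk le; rewrite (Bsum_cells _ _ pk le) /cell_sum exchange_big.
by do 2 apply: eq_bigr => ? _; congr (_ * _); rewrite mulrC.
Qed.

Lemma lam_eq_Bsum u v u' v' mu nu : indep u v -> (1 - u') * (1 - v') = (1 - u) * (1 - v) ->
  lam u v mu = lam u' v' nu -> Bsum u v mu = Bsum u' v' nu.
Proof.
move=> uv e; rewrite !lamE e => /addrI/oppr_inj/mulfI; apply.
by apply: mulf_neq0; [exact: indep_neq1 uv | exact: (indep_neq1 (indep_sym uv))].
Qed.

Lemma Bsum_inj u v mu nu : indep u v -> is_part mu -> is_part nu ->
  Bsum u v mu = Bsum u v nu -> mu = nu.
Proof.
move=> uv pm pn; set N := (maxn (sumn mu) (sumn nu)).+1.
have lm : (sumn mu <= N)%N by rewrite /N; lia.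
have ln : (sumn nu <= N)%N by rewrite /N; lia.
rewrite (Bsum_cells _ _ pm lm) (Bsum_cells _ _ pn ln) => e.
apply: part_eq => // r; have H := cell_sum_inj uv e.
have [rN|Nr] := ltnP r N; last first.
  rewrite !nth_default //; [have := size_le_sumn pn | have := size_le_sumn pm]; lia.
apply/eqP; rewrite eqn_leq; apply/andP; split; rewrite leqNgt; apply/negP => lt.
  have := H (nth 0%N nu r) r _ rN; rewrite lt ltnn => H'.
  by have /H' : (nth 0 nu r < N)%N by have := nth_le_sumn nu r; rewrite /N; lia.
have := H (nth 0%N mu r) r _ rN; rewrite lt ltnn => H'.
by have /H' : (nth 0 mu r < N)%N by have := nth_le_sumn mu r; rewrite /N; lia.
Qed.

Lemma lam_inj u v mu nu : indep u v -> is_part mu -> is_part nu ->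
  lam u v mu = lam u v nu -> mu = nu.
Proof. by move=> uv pm pn e; apply: (Bsum_inj uv pm pn); apply: lam_eq_Bsum e. Qed.

Lemma lam_conj u v mu : is_part mu -> lam u v mu = lam v u (conj_part mu).
Proof.
move=> pm; rewrite !lamE [(1 - v) * (1 - u)]mulrC; congr (1 - _ * _).
have lm := leqnn (sumn mu).
rewrite (Bsum_cells _ _ pm lm) (Bsum_swap_cells (N := sumn mu) _ _ (conj_part_is_part pm)).
  by do 2 apply: eq_bigr => ? _; rewrite cell_conj.
by rewrite sumn_conj.
Qed.

Lemma lam_swap_cells u v nu ka : indep u v -> is_part nu -> is_part ka ->
  lam u v nu = lam v u ka ->
  forall r c, (r < nth 0 ka c)%N = (c < nth 0 nu r)%N.
Proof.
move=> uv pn pk e r c; have {}e := lam_eq_Bsum uv (mulrC _ _) e.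
set N := (maxn (maxn (sumn nu) (sumn ka)) (maxn r c)).+1.
have lk : (sumn ka <= N)%N by rewrite /N; lia.
have ln : (sumn nu <= N)%N by rewrite /N; lia.
rewrite (Bsum_cells _ _ pn ln) (Bsum_swap_cells _ _ pk lk) in e.
by rewrite (cell_sum_inj uv e) // /N; lia.
Qed.
End Independence.

(** * Products of shifted operators and their kernels *)

Section KillOperators.
Variables (F : fieldType) (V : lmodType F) (D : {linear V -> V}).
Implicit Types (cs : seq F) (f g : V).

(** The product of the operators D - c, the last entry of [cs] acting first. *)
Definition kill cs f := foldr (fun c g => D g - c *: g) f cs.

Lemma kill_lin cs a f g : kill cs (a *: f + g) = a *: kill cs f + kill cs g.
Proof.
elim: cs => //= c cs ->; rewrite linearP scalerDr opprD scalerBr !scalerA mulrC.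
by rewrite addrACA.
Qed.

Lemma kill0 cs : kill cs 0 = 0.
Proof. by elim: cs => //= c cs ->; rewrite linear0 scaler0 subrr. Qed.

Lemma kill_cat cs1 cs2 f : kill (cs1 ++ cs2) f = kill cs1 (kill cs2 f).
Proof. by rewrite /kill foldr_cat. Qed.

Lemma kill_step cs c f : kill cs (D f - c *: f) = D (kill cs f) - c *: kill cs f.
Proof.
elim: cs => //= d cs ->; move: (kill cs f) => k.
rewrite ![D (_ - _)]linearB ![D (_ *: _)]linearZ /=.
rewrite ![_ *: (_ - _)]scalerBr !scalerA mulrC !opprB.
by rewrite addrACA [RHS]addrACA; congr (_ + _); rewrite addrC.
Qed.

Lemma kill_catC cs1 cs2 f : kill (cs1 ++ cs2) f = kill (cs2 ++ cs1) f.
Proof.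
rewrite !kill_cat; elim: cs1 => //= c cs1 IH.
by rewrite IH kill_step.
Qed.

Lemma kill_eigen cs c f : D f = c *: f -> kill cs f = (\prod_(d <- cs) (c - d)) *: f.
Proof.
move=> Df; elim: cs => [|d cs IH] /=; first by rewrite big_nil scale1r.
rewrite big_cons IH linearZ /= Df !scalerA -scalerBl; congr (_ *: _); ring.
Qed.

Lemma kill_eigen0 cs c f : D f = c *: f -> c \notin cs -> kill cs f = 0 -> f = 0.
Proof.
move=> Df ncs; rewrite (kill_eigen _ Df) => /eqP; rewrite scaler_eq0.
case/orP=> [|/eqP//]; rewrite prodf_seq_eq0 => /hasP[d dcs /=]; rewrite subr_eq0 => /eqP e.
by rewrite -e (negPf ncs) in dcs.
Qed.

(** Annihilating polynomials without a common root: by induction (D - c) f = 0 for a root c of the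
    first, and then the second acts on f by a nonzero scalar. *)
Lemma kill_disjoint cs1 cs2 f : (forall c, c \in cs1 -> c \notin cs2) ->
  kill cs1 f = 0 -> kill cs2 f = 0 -> f = 0.
Proof.
elim: cs1 f => //= c cs1 IH f dis k1 k2.
apply: (@kill_eigen0 cs2 c) => //; last by apply: dis; rewrite inE eqxx.
apply/eqP; rewrite -subr_eq0; apply/eqP; apply: IH.
- by move=> d d1; apply: dis; rewrite inE d1 orbT.
- by rewrite kill_step.
- by rewrite kill_step k2 linear0 scaler0 subrr.
Qed.

Lemma eigen_independent (I : eqType) (r : seq I) (la : I -> F) (f : I -> V) :
  uniq r -> {in r &, injective la} -> (forall i, i \in r -> D (f i) = la i *: f i) ->
  \sum_(i <- r) f i = 0 -> forall i, i \in r -> f i = 0.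
Proof.
elim: r => //= i r IH in f *; case/andP=> ir ur inj Df s0.
have inj' : {in r &, injective la}.
  by move=> x y xr yr; apply: inj; rewrite inE ?xr ?yr orbT.
have Dr j : j \in r -> D (f j) = la j *: f j by move=> jr; apply: Df; rewrite inE jr orbT.
have Di : D (f i) = la i *: f i by apply: Df; rewrite inE eqxx.
have fr0 j : j \in r -> f j = 0.
  move=> jr; have : (la j - la i) *: f j = 0.
    apply: (IH (fun j => (la j - la i) *: f j)) => // [l lr|].
      by rewrite linearZ /= Dr // !scalerA mulrC.
    have := congr1 (fun x => D x - la i *: x) s0; rewrite /= linear0 scaler0 subrr.
    rewrite big_cons linearD scalerDr opprD addrACA Di subrr add0r => E.
    rewrite -[RHS]E linear_sum scaler_sumr -sumrB; apply: eq_big_seq => l lr.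
    by rewrite scalerBl Dr.
  move/eqP; rewrite scaler_eq0 subr_eq0 => /orP[/eqP e|/eqP//].
  by case/negP: ir; rewrite -(inj j i) // inE ?jr ?eqxx ?orbT.
move=> j; rewrite inE => /orP[/eqP->|]; last exact: fr0.
by move: s0; rewrite big_cons big_seq big1 ?addr0.
Qed.
End KillOperators.

(** * Eigenvectors and bases from triangularity on Schur functions *)

Section SchurTriangular.
Variables (F : fieldType) (S : sym_model F).
Implicit Types (u v : F) (mu nu ka : seq nat) (f g : S).
Local Notation h := (sh S).
Local Notation span := (lin_span (sschur S)).

HB.instance Definition _ u v := GRing.Linear.copy (@Dprime F S u v)
  (@Vop F S (fun i => 1 - v ^+ i) (fun i => u ^+ i - 1) 0).

Local Notation DP u v := (@Dprime F S u v).

Definition ge_part mu nu := [/\ is_part nu, sumn nu = sumn mu & dominates nu mu].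

Lemma Dprime_schur u v mu : u != 0 ->
  span (gt_part mu) (DP u v (sschur S mu) - lam u v mu *: sschur S mu).
Proof.
move=> u0; rewrite -[sschur S mu]/(jt S (size mu) (vec mu)) Dprime_jt //.
set k := size mu; set J := jt S k _.
have -> : v ^+ k *: J + (1 - v) *: (\sum_(i < k) u ^ (vec mu i - i%:Z) *:
      jt_row S (vec mu) (u * v) i) - lam u v mu *: J =
    (1 - v) *: \sum_(i < k) u ^ (vec mu i - i%:Z) *:
      (jt_row S (vec mu) (u * v) i - (u * v) ^+ i *: J).
  rewrite /lam [X in _ - X]scalerDl opprD addrACA subrr add0r -scalerA -scalerBr; congr (_ *: _).
  rewrite scaler_suml -sumrB; apply: eq_bigr => i _; rewrite scalerBr scalerA.
  congr (_ - _ *: _); rewrite exprMn mulrA [u ^+ i]exprnP -expfzDr // subrK.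
  by rewrite mulrC.
apply: lin_spanZ; apply: lin_span_big => -[r rk] _; apply: lin_spanZ.
apply: lin_span_sub (@above_strict_gt mu) _.
exact: (jt_row_triangular (shift_model_exists S k)).
Qed.

Lemma Dprime_ge u v mu f : u != 0 -> is_part mu -> span (ge_part mu) f ->
  span (gt_part mu) (DP u v f - lam u v mu *: f).
Proof.
move=> u0 pm [l [Pl ->]]; rewrite linear_sum scaler_sumr -sumrB big_seq.
apply: lin_span_big => x xl; have [pn sn dn] := Pl x xl.
rewrite linearZ /= !scalerA [lam _ _ _ * _]mulrC -scalerA -scalerBr; apply: lin_spanZ.
have [->|gt] := dominates_eq_or_gt pm pn sn dn; first exact: Dprime_schur.
have -> : DP u v (sschur S x.2) - lam u v mu *: sschur S x.2 =
    (DP u v (sschur S x.2) - lam u v x.2 *: sschur S x.2)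
    + (lam u v x.2 - lam u v mu) *: sschur S x.2.
  by rewrite scalerBl addrA subrK.
apply: lin_spanD; last by apply: lin_spanZ; apply: lin_span_gen.
by apply: lin_span_sub (Dprime_schur v x.2 u0) => nu; apply: gt_part_trans.
Qed.

(** D - lambda_nu sends s_nu to terms strictly above nu, so induction on [pweight] exhausts them
    with finitely many factors. The factors commute, so the lists found for different terms can be
    concatenated. *)
Lemma kill_gt u v mu f : u != 0 -> span (gt_part mu) f ->
  exists L, (forall nu, nu \in L -> gt_part mu nu) /\
    kill (DP u v) [seq lam u v nu | nu <- L] f = 0.
Proof.
move=> u0.
have sums (l : seq (F * seq nat)) : (forall x, x \in l -> exists L,
    (forall nu, nu \in L -> gt_part mu nu) /\
    kill (DP u v) [seq lam u v nu | nu <- L] (sschur S x.2) = 0) ->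
  exists L, (forall nu, nu \in L -> gt_part mu nu) /\
    kill (DP u v) [seq lam u v nu | nu <- L] (\sum_(x <- l) x.1 *: sschur S x.2) = 0.
  elim: l => [|x l IH] H; first by exists [::]; rewrite big_nil.
  have [|L1 [P1 k1]] := IH; first by move=> y yl; apply: H; rewrite inE yl orbT.
  have [|L2 [P2 k2]] := H x; first by rewrite inE eqxx.
  exists (L1 ++ L2); split=> [nu|]; first by rewrite mem_cat => /orP[/P1|/P2].
  rewrite big_cons map_cat kill_lin kill_cat k2 kill0 scaler0 add0r.
  by rewrite kill_catC kill_cat k1 kill0.
have one n nu : (pweight nu < n)%N -> gt_part mu nu -> exists L,
    (forall ka, ka \in L -> gt_part mu ka) /\
    kill (DP u v) [seq lam u v ka | ka <- L] (sschur S nu) = 0.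
  elim: n nu => // n IHn nu lt_n gt_nu.
  have [l [Pl e]] := Dprime_schur v nu u0.
  have [x xl|L [PL kL]] := sums l.
    have gx := Pl x xl; apply: IHn; last exact: gt_part_trans gt_nu gx.
    by case: gx => _ _ _ w; apply: leq_trans w _.
  exists (rcons L nu); split=> [ka|].
    by rewrite mem_rcons inE => /orP[/eqP->|/PL].
  by rewrite map_rcons -cats1 kill_cat /= e.
move=> [l [Pl ->]]; apply: sums => x xl.
exact: (one (pweight x.2).+1 x.2 (ltnSn _) (Pl x xl)).
Qed.

Lemma kill_map (D D' P : {linear S -> S}) cs f : (forall g, P (D g) = D' (P g)) ->
  P (kill D cs f) = kill D' cs (P f).
Proof. by move=> PD; elim: cs => //= c cs IH; rewrite linearB linearZ /= PD IH. Qed.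

(** Both plethysms carry D to a triangular operator, and [lam_conj] makes the two diagonal
    coefficients at mu agree, so the same element D f - lambda f is killed by both products. *)
Lemma macdonald_eigen (D P1 P2 : {linear S -> S}) u v mu f :
  indep u v -> injective P1 -> injective P2 ->
  (forall g, P1 (D g) = DP u v (P1 g)) ->
  (forall g, P2 (D g) = DP v u (P2 g)) -> is_part mu ->
  span (ge_part mu) (P1 f) -> span (ge_part (conj_part mu)) (P2 f) ->
  D f = lam u v mu *: f.
Proof.
move=> uv i1 i2 PD1 PD2 pm s1 s2.
have u0 := indep_neq0 uv; have v0 := indep_neq0 (indep_sym uv).
have [L1 [g1 k1]] := kill_gt v u0 (Dprime_ge v u0 pm s1).
have [L2 [g2 k2]] := kill_gt u v0 (Dprime_ge u v0 (conj_part_is_part pm) s2).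
apply/eqP; rewrite -subr_eq0; apply/eqP.
apply: (@kill_disjoint _ _ D [seq lam u v nu | nu <- L1] [seq lam v u nu | nu <- L2]).
- move=> c /mapP[nu n1 ->]; apply/negP => /mapP[ka k2' e].
  have [pn sn dn _] := g1 nu n1; have gka := g2 ka k2'; have [pk _ _ _] := gka.
  exact: (gt_part_conj pm pn sn dn gka (lam_swap_cells uv pn pk e)).
- by apply: i1; rewrite (kill_map _ _ PD1) linearB linearZ /= PD1 k1 linear0.
- apply: i2; rewrite (kill_map _ _ PD2) linearB linearZ /= PD2 (lam_conj _ _ pm) k2.
  by rewrite linear0.
Qed.

(** If the coefficient of s_mu vanished, H_mu would be killed by factors D - lambda_nu with nu
    strictly above mu, none of which has its eigenvalue, so H_mu would be 0. A nonzero coefficient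
    lets the expansion be solved for s_mu. *)
Lemma macdonald_span (D P1 : {linear S -> S}) u v (H : seq nat -> S) :
  indep u v -> injective P1 -> (forall g, P1 (D g) = DP u v (P1 g)) ->
  (forall mu, is_part mu -> span (ge_part mu) (P1 (H mu))) ->
  (forall mu, is_part mu -> D (H mu) = lam u v mu *: H mu) ->
  (forall mu, is_part mu -> H mu != 0) ->
  forall mu, is_part mu -> lin_span (P1 \o H) is_part (sschur S mu).
Proof.
move=> uv i1 PD1 sH eH nH mu; have u0 := indep_neq0 uv.
have [n] := ubnP (pweight mu); elim: n mu => // n IHn mu lt_n pm.
have [l [Pl e]] := sH mu pm.
pose c := \sum_(x <- l | x.2 == mu) x.1.
pose G := \sum_(x <- l | x.2 != mu) x.1 *: sschur S x.2.
have eG : P1 (H mu) = c *: sschur S mu + G.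
  rewrite e (bigID (fun x => x.2 == mu)) /=; congr (_ + _).
  by rewrite scaler_suml; apply: eq_bigr => x /eqP->.
have sG : span (gt_part mu) G.
  rewrite /G big_seq_cond; apply: lin_span_big => x /andP[xl ne]; apply: lin_spanZ.
  have [pn sn dn] := Pl x xl; apply: lin_span_gen.
  by have [e'|//] := dominates_eq_or_gt pm pn sn dn; rewrite e' eqxx in ne.
have c0 : c != 0.
  apply/eqP => c0; have [L [gL kL]] := kill_gt v u0 sG.
  have H0 : H mu = 0.
    apply: (@kill_eigen0 _ _ D [seq lam u v nu | nu <- L] (lam u v mu)); first exact: eH.
      apply/mapP => -[nu nL en]; have [pn _ _ w] := gL nu nL.
      by rewrite (lam_inj uv pm pn en) ltnn in w.
    by apply: i1; rewrite (kill_map _ _ PD1) eG c0 scale0r add0r kL linear0.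
  by have := nH mu pm; rewrite H0 eqxx.
have -> : sschur S mu = c^-1 *: ((P1 \o H) mu - G).
  by rewrite /= eG addrK scalerA mulVf // scale1r.
apply: lin_spanZ; apply: lin_spanB; first exact: lin_span_gen.
have [l' [Pl' ->]] := sG; rewrite big_seq; apply: lin_span_big => x xl; apply: lin_spanZ.
by have [pn _ _ w] := Pl' x xl; apply: IHn => //; apply: leq_trans w _.
Qed.

(** The product is the identity term of a Jacobi-Trudi determinant; every other permutation gives a
    product of smaller [wgt]. *)
Lemma prod_shz_span k (al : nat -> int) :
  span is_part (\prod_(i < k) shz S (al i)).
Proof.
suff main n : forall al, wgt k al < n%:Z -> span is_part (\prod_(i < k) shz S (al i)).
  by apply: (main (absz (wgt k al)).+1); lia.
elim: n => [|n IHn] {}al lt_n.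
all: have [/existsP[i neg] | /existsPn pos] := boolP [exists i : 'I_k, al i < 0];
  first by rewrite (bigD1 i) //= shz_lt0 // mul0r; apply: lin_span0.
  suff: 0 <= wgt k al by lia.
  apply: Num.Theory.sumr_ge0 => i _; apply: Num.Theory.mulr_ge0 => //.
  by have := pos i; lia.
have sj : span is_part (jt S k al).
  by apply: lin_span_sub (schur_span_jt S k al) => nu [].
have e := erefl (jt S k al); rewrite {2}/jt /determinant (bigD1 1%g) //= odd_perm1 in e.
rewrite expr0 mul1r (eq_bigr (fun i : 'I_k => shz S (al i))) in e; last first.
  by move=> i _; rewrite mxE perm1 /jt_entry subrK.
have -> : \prod_(i < k) shz S (al i) = jt S k al -
    \sum_(s : 'S_k | s != 1%g) (-1) ^+ s *
      \prod_i (\matrix_(i, j) jt_entry S al i j) i (s i) by rewrite e addrK.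
apply: lin_spanB => //; apply: lin_span_big => s s1.
rewrite -signr_odd mulr_sign -scaler_sign; apply: lin_spanZ.
pose al' l : int := if insub l is Some o then al l - l%:Z + (s o : nat)%:Z else 0.
have al'E (i : 'I_k) : al' i = al i - i%:Z + (s i : nat)%:Z by rewrite /al' valK.
rewrite (eq_bigr (fun i : 'I_k => shz S (al' i))) => [|i _]; last by rewrite mxE al'E.
apply: IHn.
(* Sum of squares: 2 (sum i^2 - sum i s(i)) = sum (i - s(i))^2 > 0. *)
have sq : 0 < \sum_(i < k) (i%:Z - (s i : nat)%:Z) ^+ 2.
  have /existsP[i si] : [exists i, s i != i].
    apply: contraR s1 => /existsPn H; apply/eqP/permP => i; rewrite perm1.
    by apply/eqP; have := H i; rewrite negbK.
  rewrite (bigD1 i) //=; apply: Num.Theory.ltr_wpDr.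
    by apply: Num.Theory.sumr_ge0 => l _; exact: Num.Theory.sqr_ge0.
  rewrite Num.Theory.exprn_even_gt0 //= subr_eq0; apply: contra si => /eqP[e'].
  by apply/eqP/val_inj.
have e2 : \sum_(i < k) (s i : nat)%:Z ^+ 2 = \sum_(i < k) (i : nat)%:Z ^+ 2.
  by rewrite [RHS](reindex_inj (@perm_inj _ s)).
have eal : wgt k al' = wgt k al - \sum_(i < k) (i : nat)%:Z ^+ 2
    + \sum_(i < k) (i : nat)%:Z * (s i : nat)%:Z.
  rewrite /wgt -sumrB -big_split; apply: eq_bigr => i _; rewrite al'E /=; ring.
have esq : \sum_(i < k) (i%:Z - (s i : nat)%:Z) ^+ 2 =
    \sum_(i < k) (i : nat)%:Z ^+ 2 + \sum_(i < k) (s i : nat)%:Z ^+ 2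
    - 2 * \sum_(i < k) (i : nat)%:Z * (s i : nat)%:Z.
  rewrite mulr_sumr -big_split -sumrB; apply: eq_bigr => i _ /=; ring.
rewrite esq e2 in sq; rewrite eal; move: sq lt_n.
move: (\sum_(i < k) _) (\sum_(i < k) _) (wgt k al) => x y z; lia.
Qed.

Definition hprod (s : seq nat) : S := \prod_(i <- s) h i.

Lemma hprod_span f : lin_span hprod (fun=> True) f.
Proof.
have mulh n g : lin_span hprod (fun=> True) g -> lin_span hprod (fun=> True) (h n * g).
  move=> [l [_ ->]]; rewrite mulr_sumr; apply: lin_span_big => x _.
  rewrite mulrC -scalerAl mulrC; apply: lin_spanZ.
  rewrite (_ : h n * _ = hprod (n :: x.2)); first exact: lin_span_gen.
  by rewrite /hprod big_cons.
have mulp n : forall g, lin_span hprod (fun=> True) g ->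
    lin_span hprod (fun=> True) (sp S n.+1 * g).
  have [N] := ubnP n; elim: N n => // N IHN n lt_n g sg.
  have := (newton_sh S).2 n; rewrite big_ord_recr /= subnn (newton_sh S).1 mul1r => e.
  have -> : sp S n.+1 = n.+1%:R * h n.+1 - \sum_(i < n) h (n - i) * sp S i.+1.
    by rewrite e addrAC subrr add0r.
  rewrite mulrBl; apply: lin_spanB.
    by rewrite -mulrA mulr_natl -scaler_nat; apply: lin_spanZ; apply: mulh.
  rewrite mulr_suml; apply: lin_span_big => i _; rewrite -mulrA; apply: mulh.
  by apply: IHN => //; apply: leq_trans (ltn_ord i) _.
move: f; apply: sm_ind => [c f g | | | r f] ; first exact: lin_span_lin.
- exact: lin_span0.
- rewrite (_ : 1 = hprod [::]); last by rewrite /hprod big_nil.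
  exact: lin_span_gen.
- exact: mulp.
Qed.

Lemma schur_span_all f : span is_part f.
Proof.
have [l [_ ->]] := hprod_span f; apply: lin_span_big => x _; apply: lin_spanZ.
rewrite /hprod (big_nth 0%N) big_mkord.
exact: (prod_shz_span (size x.2) (vec x.2)).
Qed.

(** The plethysm X -> xX detects the degree and stands in for a grading of the ring. *)
Lemma ssig_pow_schur x mu : x != 0 ->
  ssig S (fun i => x ^+ i) (sschur S mu) = x ^+ sumn mu *: sschur S mu.
Proof.
move=> x0; have nx : newton (fun i => x ^+ i *: sp S i) (fun n => x ^+ n *: h n).
  have algX m : x%:A ^+ m = (x ^+ m)%:A :> S.
    by rewrite -[x%:A]/(in_alg S x) -rmorphXn.
  apply: eq_newton (newton_scale x%:A (newton_sh S)) => [i | i];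
    by rewrite algX mulr_algl.
have sz (z : int) : ssig S (fun i => x ^+ i) (shz S z) = x ^ z *: shz S z.
  by case: z => n /=; [exact: (ssig_newton nx) | rewrite rmorph0 scaler0].
rewrite /sschur /jt -det_map_mx /determinant scaler_sumr; apply: eq_bigr => s _.
under eq_bigr => i _ do rewrite !mxE sz.
rewrite scaler_prod -scalerAr; congr (_ *: (_ * _)); last first.
  by apply: eq_bigr => i _; rewrite mxE.
rewrite -(big_morph _ (fun m n => expfzDr m n x0) (expr0z x)) exprnP; congr (_ ^ _).
rewrite big_split /= sumrB.
rewrite (_ : \sum_(i < size mu) (s i : nat)%:Z = \sum_(i < size mu) i%:Z); last first.
  by rewrite [RHS](reindex_inj (@perm_inj _ s)).
rewrite subrK sumnE /psum_of (big_morph _ PoszD (erefl 0%:Z)) //.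
Qed.
End SchurTriangular.

(** * The Pieri rule *)

Section CellCombinatorics.
Implicit Types (mu nu : seq nat) (N : nat).

Definition colweight mu := (\sum_(r < size mu) \sum_(c < nth 0 mu r) c)%N.

Lemma pweight_cells mu N : is_part mu -> (sumn mu <= N)%N ->
  pweight mu = (\sum_(r < N) \sum_(c < N) (c < nth 0 mu r) * r)%N.
Proof.
move=> pm le; rewrite (pweight_widen (leq_trans (size_le_sumn pm) le)).
apply: eq_bigr => r _; rewrite (sum_cells (fun=> nat_of_ord r)).
  by rewrite sum_nat_const card_ord mulnC.
exact: leq_trans (nth_le_sumn _ _) le.
Qed.

Lemma colweight_cells mu N : is_part mu -> (sumn mu <= N)%N ->
  colweight mu = (\sum_(r < N) \sum_(c < N) (c < nth 0 mu r) * c)%N.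
Proof.
move=> pm le; rewrite /colweight.
rewrite (@sum_nth_widen (fun _ x => \sum_(c < x) c)%N mu N); last 2 first.
- by move=> _; rewrite big_ord0.
- exact: leq_trans (size_le_sumn pm) le.
apply: eq_bigr => r _; rewrite (sum_cells id) //.
exact: leq_trans (nth_le_sumn _ _) le.
Qed.

Lemma sum_sq_eq1 (I : finType) (n : I -> int) :
  \sum_i n i ^+ 2 = 1 -> \sum_i n i = 1 -> exists i0, forall i, n i = (i == i0)%:Z.
Proof.
move=> sq s; have /existsP[i0 ni0] : [exists i, n i != 0].
  apply: contraPT s => /existsPn n0; rewrite big1 // => i _.
  by apply/eqP; have := n0 i; rewrite negbK.
have rest : \sum_(i | i != i0) n i ^+ 2 = 0.
  have ge0 : 0 <= \sum_(i | i != i0) n i ^+ 2.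
    by apply: Num.Theory.sumr_ge0 => i _; exact: Num.Theory.sqr_ge0.
  have ge1 : 1 <= n i0 ^+ 2 by rewrite expr2; move: (n i0) ni0 => x; nia.
  move: sq ge0 ge1; rewrite (bigD1 i0) //=.
  by move: (\sum_(i | _) _) (n i0 ^+ 2) => x y; lia.
have z i : i != i0 -> n i = 0.
  move=> ii0; have := Num.Theory.psumr_eq0P (fun i _ => Num.Theory.sqr_ge0 (n i)) rest ii0.
  by move/eqP; rewrite sqrf_eq0 => /eqP.
exists i0 => i; have [->|/z//] := eqVneq i i0.
by move: s; rewrite (bigD1 i0) //= big1 ?addr0.
Qed.
End CellCombinatorics.

Section LaurentUnit.
Variables (F : fieldType) (u v : F).
Hypothesis uv : indep u v.

Lemma pick_sum N (f : nat -> nat -> F) x y : (x < N)%N -> (y < N)%N ->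
  \sum_(i < N) \sum_(j < N) (((i == x :> nat) && (j == y :> nat))%:Z)%:~R * f i j = f x y.
Proof.
move=> xN yN; rewrite (bigD1 (Ordinal xN)) //= [X in _ + X]big1 => [|i ix].
  rewrite addr0 (bigD1 (Ordinal yN)) //= !eqxx mul1r big1 ?addr0 // => j jy.
  by rewrite -val_eqE /= in jy; rewrite (negPf jy) mul0r.
by rewrite -val_eqE /= in ix; rewrite big1 // => j _; rewrite (negPf ix) mul0r.
Qed.

(* The constant term of f(u,v) f(1/u,1/v) is the sum of the squared coefficients. *)
Lemma laurent_unit_sq N (n : 'I_N * 'I_N -> int) :
  (\sum_e (n e)%:~R * (u ^+ e.1 * v ^+ e.2)) *
  (\sum_e (n e)%:~R * (u^-1 ^+ e.1 * v^-1 ^+ e.2)) = 1 -> \sum_e n e ^+ 2 = 1.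
Proof.
have u0 := indep_neq0 uv; have v0 := indep_neq0 (indep_sym uv).
move=> prod1; pose K := (N + N).+1.
pose C i j : int := \sum_e \sum_e' n e * n e' *
  ((i == e.1 + N - e'.1)%N && (j == e.2 + N - e'.2)%N)%:Z.
have lt1 (x y : 'I_N) : (x + N - y < K)%N.
  by rewrite /K; have := ltn_ord x; move: (nat_of_ord x) (nat_of_ord y) => a b; lia.
have total : \sum_(i < K) \sum_(j < K) (C i j)%:~R * (u ^+ i * v ^+ j) = u ^+ N * v ^+ N.
  transitivity (\sum_e \sum_e' (n e * n e')%:~R *
      (u ^+ (e.1 + N - e'.1) * v ^+ (e.2 + N - e'.2))).
    under eq_bigr => i _ do (under eq_bigr => j _ do
      (rewrite rmorph_sum mulr_suml; under eq_bigr => e _ do rewrite rmorph_sum mulr_suml)).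
    under eq_bigr => i _ do rewrite exchange_big.
    rewrite exchange_big; apply: eq_bigr => e _ /=.
    under eq_bigr => i _ do rewrite exchange_big.
    rewrite exchange_big; apply: eq_bigr => e' _ /=.
    rewrite -(@pick_sum K (fun i j => u ^+ i * v ^+ j) _ _ (lt1 e.1 e'.1) (lt1 e.2 e'.2)).
    rewrite mulr_sumr; apply: eq_bigr => i _; rewrite mulr_sumr; apply: eq_bigr => j _.
    by rewrite rmorphM mulrA.
  rewrite -[RHS]mulr1 -[X in _ = _ * X]prod1 mulr_suml mulr_sumr; apply: eq_bigr => e _.
  rewrite !mulr_sumr; apply: eq_bigr => e' _; rewrite intrM.
  have shift (x : F) (a b : 'I_N) : x != 0 -> x ^+ (a + N - b) = x ^+ N * x ^+ a * x^-1 ^+ b.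
    move=> x0; have bN := ltn_ord b; apply: (@mulIf _ (x ^+ b)); first by rewrite expf_neq0.
    rewrite -[_ * x^-1 ^+ b * _]mulrA -exprMn mulVf // expr1n mulr1 -!exprD.
    congr (_ ^+ _).
    by move: (nat_of_ord a) (nat_of_ord b) bN => ? ?; lia.
  rewrite !shift //; ring.
have := @uv K (fun i j => C i j - ((i == N) && (j == N))%:Z) _ N N.
have z : \sum_(i < K) \sum_(j < K) (C i j - ((i == N :> nat) && (j == N :> nat))%:Z)%:~R
     * (u ^+ i * v ^+ j) = 0.
  under eq_bigr => i _ do (under eq_bigr => j _ do rewrite rmorphB mulrBl).
  under eq_bigr => i _ do rewrite sumrB.
  rewrite sumrB total (@pick_sum K (fun i j => u ^+ i * v ^+ j)) ?subrr // /K; lia.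
move=> /(_ z); rewrite !eqxx => H.
have /eqP : C N N - 1 = 0 by apply: H; rewrite /K; lia.
rewrite subr_eq0 => /eqP <-; rewrite /C; apply: eq_bigr => e _.
rewrite (bigD1 e) //= big1 ?addr0 => [|e' ne].
  by rewrite !addKn !eqxx mulr1 expr2.
rewrite (_ : _ && _ = false) ?mulr0 //; apply: contraNF ne => /andP[/eqP e1 /eqP e2].
rewrite [e]surjective_pairing [e']surjective_pairing xpair_eqE -!val_eqE /=.
have := ltn_ord e'.1; have := ltn_ord e'.2; move: e1 e2.
move: (nat_of_ord e.1) (nat_of_ord e'.1) (nat_of_ord e.2) (nat_of_ord e'.2) => a b c d.
by move=> *; apply/andP; split; apply/eqP; lia.
Qed.

(** By [laurent_unit_sq] the integer coefficients of B_nu - B_mu have square sum 1, so just one is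
    nonzero, and their sum |nu| - |mu| makes it +1. Pairing the same coefficients with row and
    column indices gives the change of the two weights. *)
Lemma Bsum_diff_unit mu nu : is_part mu -> is_part nu -> sumn nu = (sumn mu).+1 ->
  (Bsum u v nu - Bsum u v mu) * (Bsum u^-1 v^-1 nu - Bsum u^-1 v^-1 mu) = 1 ->
  exists a b : nat, [/\ Bsum u v nu - Bsum u v mu = u ^+ a * v ^+ b,
    Bsum u^-1 v^-1 nu - Bsum u^-1 v^-1 mu = u^-1 ^+ a * v^-1 ^+ b,
    pweight nu = (pweight mu + b)%N & colweight nu = (colweight mu + a)%N].
Proof.
move=> pm pn es; set N := sumn nu.
have lm : (sumn mu <= N)%N by rewrite /N es.
have ln : (sumn nu <= N)%N by [].
pose n (e : 'I_N * 'I_N) : int :=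
  (e.1 < nth 0 nu e.2)%N%:Z - (e.1 < nth 0 mu e.2)%N%:Z.
have BE (x y : F) : Bsum x y nu - Bsum x y mu = \sum_e (n e)%:~R * (x ^+ e.1 * y ^+ e.2).
  rewrite (Bsum_cells _ _ pm lm) (Bsum_cells _ _ pn ln) /cell_sum !pair_big /= -sumrB.
  by apply: eq_bigr => e _; rewrite /n rmorphB mulrBl.
rewrite !BE => /laurent_unit_sq sq.
have natE (G : nat -> nat -> nat) : (\sum_(r < N) \sum_(c < N) (c < nth 0 nu r) * G c r)%N%:Z
    - (\sum_(r < N) \sum_(c < N) (c < nth 0 mu r) * G c r)%N%:Z =
    \sum_e n e * (G e.1 e.2)%:Z.
  rewrite exchange_big [X in _ - X%:Z]exchange_big !pair_big /=.
  rewrite !(big_morph _ PoszD (erefl 0%:Z)) -sumrB; apply: eq_bigr => e _.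
  by rewrite /n !PoszM mulrBl.
have s1 : \sum_e n e = 1.
  have c1 ka : is_part ka -> (sumn ka <= N)%N ->
      (\sum_(r < N) \sum_(c < N) (c < nth 0 ka r) * 1 = sumn ka)%N.
    by move=> pk lk; rewrite (sumn_cells pk lk); do 2 apply: eq_bigr => ? _; rewrite muln1.
  have := natE (fun _ _ => 1%N); rewrite !c1 // es (eq_bigr n) => [e|i _].
    by rewrite -e; lia.
  by rewrite mulr1.
have [e0 ne] := sum_sq_eq1 sq s1.
have pickF (G : 'I_N * 'I_N -> F) : \sum_e (n e)%:~R * G e = G e0.
  rewrite (bigD1 e0) //= ne eqxx mul1r big1 ?addr0 // => e /negPf ee.
  by rewrite ne ee mul0r.
have pickZ (G : 'I_N * 'I_N -> int) : \sum_e n e * G e = G e0.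
  rewrite (bigD1 e0) //= ne eqxx mul1r big1 ?addr0 // => e /negPf ee.
  by rewrite ne ee mul0r.
exists e0.1, e0.2; split; rewrite ?pickF //.
- have := natE (fun _ r => r); rewrite pickZ (pweight_cells pm lm) (pweight_cells pn ln).
  by move: (\sum_(r < N) _)%N (\sum_(r < N) _)%N (nat_of_ord _) => x y w; lia.
- have := natE (fun c _ => c); rewrite pickZ (colweight_cells pm lm) (colweight_cells pn ln).
  by move: (\sum_(r < N) _)%N (\sum_(r < N) _)%N (nat_of_ord _) => x y w; lia.
Qed.
End LaurentUnit.

(** Repeated labels are merged because independence of eigenvectors needs distinct eigenvalues. *)
Lemma lin_span_uniq (F : fieldType) (V : lmodType F) (e : seq nat -> V) P f :
  lin_span e P f -> exists r (c : seq nat -> F),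
    [/\ uniq r, forall nu, nu \in r -> P nu & f = \sum_(nu <- r) c nu *: e nu].
Proof.
move=> [l [Pl ->]]; elim: l Pl => [|[a nu] l IH] Pl.
  by exists [::], (fun=> 0); split=> //; rewrite !big_nil.
have [|r [c [ur Pr er]]] := IH.
  by move=> x xl; apply: Pl; rewrite inE xl orbT.
rewrite big_cons /= er.
have cE (s : seq (seq nat)) : nu \notin s ->
    \sum_(ka <- s) (c ka + (if ka == nu then a else 0)) *: e ka = \sum_(ka <- s) c ka *: e ka.
  move=> ns; apply: eq_big_seq => ka ks; case: eqP => [ek|_]; last by rewrite addr0.
  by rewrite ek (negPf ns) in ks.
have [nr|nr] := boolP (nu \in r).
  exists r, (fun ka => c ka + (if ka == nu then a else 0)); split=> //.
  rewrite (big_rem nu nr) [RHS](big_rem nu nr) /= eqxx cE ?mem_rem_uniq ?inE ?eqxx //.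
  by rewrite addrA -scalerDl addrC [a + _]addrC addrC.
exists (nu :: r), (fun ka => if ka == nu then a else c ka); split.
- by rewrite /= nr.
- by move=> ka; rewrite inE => /orP[/eqP->|/Pr//]; apply: (Pl (a, nu)); rewrite inE eqxx.
rewrite big_cons eqxx; congr (_ + _); apply: eq_big_seq => ka kr; case: eqP => // ek.
by rewrite -ek kr in nr.
Qed.

Lemma lin_span_ind (F : fieldType) (V : lmodType F) (e : seq nat -> V) P
    (R : V -> Prop) f :
  (forall c f g, R f -> R g -> R (c *: f + g)) -> R 0 ->
  (forall nu, P nu -> R (e nu)) -> lin_span e P f -> R f.
Proof.
move=> Rlin R0 Re [l [Pl ->]]; elim: l Pl => [|x l IH] Pl; first by rewrite big_nil.
rewrite big_cons; apply: Rlin; first by apply: Re; apply: Pl; rewrite inE eqxx.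
by apply: IH => y yl; apply: Pl; rewrite inE yl orbT.
Qed.

(** * Conjugation of vertex operators by plethysms *)

Section VertexConjugation.
Variables (F : fieldType) (S : sym_model F).
Implicit Types (a b c : nat -> F) (f : S).

Lemma ssigK c f : (forall i, c i.+1 != 0) -> ssig S (fun i => (c i)^-1) (ssig S c f) = f.
Proof.
move=> c0; move: f; apply: sm_ind => [x f g IHf IHg | | | r f IHf].
- by rewrite rmorphD ssigZ rmorphD ssigZ IHf IHg.
- by rewrite !rmorph0.
- by rewrite !rmorph1.
- by rewrite !rmorphM !ssig_p ssigZ ssig_p scalerA mulfV // scale1r IHf.
Qed.

Lemma ssig_inj c : (forall i, c i.+1 != 0) -> injective (ssig S c).
Proof. by move=> c0; apply: can_inj (fun f => ssigK f c0). Qed.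

Lemma ssig_shz_scale b c z :
  ssig S c (ssig S b (shz S z)) = ssig S (fun i => c i * b i) (shz S z).
Proof.
case: z => n /=; last by rewrite !rmorph0.
apply/esym; move: n; apply: ssig_newton.
apply: eq_newton (newton_morph (ssig S c) (newton_ssig S b)) => // i /=.
by rewrite ssigZ ssig_p scalerA mulrC.
Qed.

Lemma Vop_conj a b c a' b' k f :
  (forall i, a i.+1 = c i.+1 * a' i.+1) -> (forall i, b' i.+1 = c i.+1 * b i.+1) ->
  ssig S c (Vop a b k f) = Vop a' b' k (ssig S c f).
Proof.
move=> ea eb; move: f k; apply: sm_ind => [x f g IHf IHg | | | r f IHf] k.
- by rewrite linearP rmorphD ssigZ IHf IHg rmorphD ssigZ linearP.
- by rewrite linear0 !rmorph0 linear0.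
- rewrite Vop1 rmorph1 Vop1 ssig_shz_scale; case: k => n /=; last by rewrite !rmorph0.
  move: n; apply: ssig_newton; apply: eq_newton (newton_ssig S b') => // i.
  by rewrite eb.
- rewrite Vop_psum rmorphD rmorphM ssig_p ssigZ !IHf rmorphM ssig_p -!scalerAl linearZ /=.
  by rewrite Vop_psum scalerDr scalerA ea.
Qed.

(** Rescaling z multiplies the coefficient of z^k by x^k and fixes that of z^0. The argument needs
    the whole family in k, since passing a power sum raises the index. *)
Lemma Vop_scale a b x f : x != 0 ->
  Vop a b 0 f = Vop (fun i => a i * x^-1 ^+ i) (fun i => x ^+ i * b i) 0 f.
Proof.
move=> x0; rewrite -(@Vop_uniq F S (fun i => a i * x^-1 ^+ i) (fun i => x ^+ i * b i)
  (fun k f => x ^ k *: Vop a b k f)) ?expr0z ?scale1r //.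
- by move=> k y g g'; rewrite linearP scalerDr !scalerA mulrC.
- move=> k; rewrite Vop1 -ssig_shz_scale.
  case: k => n /=; last by rewrite !rmorph0 scaler0.
  have nw := newton_scale (in_alg S x) (newton_ssig S b).
  have algX m : x%:A ^+ m = (x ^+ m)%:A :> S.
    by rewrite -[x%:A]/(in_alg S x) -rmorphXn.
  have nw2 : newton (fun i => (x ^+ i * b i) *: sp S i) (fun m => x ^+ m *: ssig S b (sh S m)).
    apply: eq_newton nw => [i | i] /=; rewrite algX mulr_algl ?scalerA //.
  have nw3 := newton_morph (ssig S (fun i => x ^+ i)) (newton_ssig S b).
  have nw4 : newton (fun i => (x ^+ i * b i) *: sp S i)
      (ssig S (fun i => x ^+ i) \o (ssig S b \o sh S)).
    by apply: eq_newton nw3 => // i /=; rewrite ssigZ ssig_p scalerA mulrC.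
  exact: (newton_uniq (@sm_tf _ S) nw2 nw4 n).
- move=> k r g; rewrite Vop_psum scalerDr !scalerA; congr (_ + _ *: _).
    by rewrite [RHS]mulrC -scalerAl [in RHS]mulrC.
  by rewrite expfzDr // -exprnP mulrC -!mulrA; congr (_ * _);
    rewrite mulrCA -exprMn mulVf // expr1n mulr1.
Qed.
End VertexConjugation.

(** * Nabla *)

Section Nabla.
Variables (F : fieldType) (S : sym_model F) (t q : F).
Hypothesis qt : indep q t.
Variable H : seq nat -> S.
Hypothesis H_q : forall mu, is_part mu ->
  lin_span (sschur S) (ge_part mu) (ssig S (fun i => 1 - q ^+ i) (H mu)).
Hypothesis H_t : forall mu, is_part mu ->
  lin_span (sschur S) (ge_part (conj_part mu)) (ssig S (fun i => 1 - t ^+ i) (H mu)).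
Hypothesis H_neq0 : forall mu, is_part mu -> H mu != 0.
Variable nab : {linear S -> S}.
Hypothesis nabE : forall mu, is_part mu ->
  nab (H mu) = (t ^+ pweight mu * q ^+ colweight mu) *: H mu.
Implicit Types (mu nu : seq nat) (f : S).
Local Notation p1 := (sp S 1).
Local Notation D k := (@Dv F S t q k).
Local Notation Ds k := (@Dstar F S t q k).
Local Notation M := (Mk t q 1).
Local Notation M' := (Mdual t q 1).

Let q0 : q != 0 := indep_neq0 qt.
Let t0 : t != 0 := indep_neq0 (indep_sym qt).

Lemma oneB_expS_neq0 (x y : F) i : indep x y -> 1 - x ^+ i.+1 != 0.
Proof.
move=> xy; apply/eqP => /eqP; rewrite subr_eq0 => /eqP e.
have := @indep_exp _ x y 0 0 i.+1 0 xy.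
by rewrite !expr0 !mulr1 => /(_ e)[].
Qed.

Let c_q i := oneB_expS_neq0 i qt.
Let c_t i := oneB_expS_neq0 i (indep_sym qt).

Lemma inj_q : injective (ssig S (fun i => 1 - q ^+ i)).
Proof. exact: ssig_inj c_q. Qed.

Lemma D0_eigen mu : is_part mu -> D 0 (H mu) = lam q t mu *: H mu.
Proof.
move=> pm; apply: (@macdonald_eigen _ _ (D 0) (ssig S (fun i => 1 - q ^+ i))
  (ssig S (fun i => 1 - t ^+ i)) q t) => //.
- exact: ssig_inj c_q.
- exact: ssig_inj c_t.
- move=> g; apply: Vop_conj => i; rewrite /Mk; first by rewrite mulrC.
  by rewrite mulrN1 opprB.
- move=> g; apply: Vop_conj => i; rewrite /Mk //.
  by rewrite mulrN1 opprB.
- exact: H_q.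
- exact: H_t.
Qed.

(** After X -> X(1-q), and with z rescaled by q, the parameters of D*_0 are those of [Dprime] at the
    inverses of q and t; likewise with q and t exchanged. *)
Lemma Ds0_eigen mu : is_part mu -> Ds 0 (H mu) = lam q^-1 t^-1 mu *: H mu.
Proof.
have key (x y : F) g : x != 0 -> (forall i, 1 - x ^+ i.+1 != 0) ->
    ssig S (fun i => 1 - x ^+ i) (Vop (fun i => - ((1 - y^-1 ^+ i) * (1 - x^-1 ^+ i)))
      (fun=> 1) 0 g) = Dprime x^-1 y^-1 (ssig S (fun i => 1 - x ^+ i) g).
  move=> x0 cx; rewrite /Dprime [RHS](Vop_scale _ _ _ x0); apply: Vop_conj => i.
    have xi : x ^+ i.+1 != 0 by rewrite expf_neq0.
    by rewrite !exprVn; move: (x ^+ i.+1) (y ^- i.+1) xi => X Y X0; field.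
  by rewrite mulr1 mulrBr mulr1 -exprMn mulfV // expr1n.
move=> pm; apply: (@macdonald_eigen _ _ (Ds 0) (ssig S (fun i => 1 - q ^+ i))
  (ssig S (fun i => 1 - t ^+ i)) q^-1 t^-1) => //.
- exact: indep_inv.
- exact: ssig_inj c_q.
- exact: ssig_inj c_t.
- by move=> g; apply: key.
- move=> g; rewrite -key //; congr (ssig _ _ _).
  rewrite /Dstar /Mdual; apply/esym; apply: Vop_uniq => [k | k | k r f].
  + by move=> x f f'; rewrite linearP.
  + by rewrite Vop1.
  + by rewrite Vop_psum /Mdual [(1 - q^-1 ^+ r.+1) * _]mulrC.
- exact: H_q.
- exact: H_t.
Qed.

Lemma H_span f : lin_span H is_part f.
Proof.
have s := @macdonald_span _ _ (D 0) (ssig S (fun i => 1 - q ^+ i)) q t H qt.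
have sP := s inj_q _ H_q D0_eigen H_neq0.
have {s}sP mu : is_part mu -> lin_span (ssig S (fun i => 1 - q ^+ i) \o H) is_part (sschur S mu).
  apply: sP => g; apply: Vop_conj => i; rewrite /Mk; first by rewrite mulrC.
  by rewrite mulrN1 opprB.
have sall g : lin_span (ssig S (fun i => 1 - q ^+ i) \o H) is_part g.
  by apply: (@lin_span_map _ _ _ idfun _ _ _ _ g sP); exact: schur_span_all.
rewrite -[f](@ssigK F S (fun i => 1 - q ^+ i) f c_q).
apply: (lin_span_map (T := ssig S (fun i => (1 - q ^+ i)^-1)) (P := is_part)) (sall _).
by move=> nu pn /=; rewrite ssigK //; apply: lin_span_gen.
Qed.

Lemma H_grade mu : is_part mu ->
  ssig S (fun i => q ^+ i) (H mu) = q ^+ sumn mu *: H mu.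
Proof.
move=> pm; apply: inj_q; rewrite ssigZ.
have comm f : ssig S (fun i => 1 - q ^+ i) (ssig S (fun i => q ^+ i) f) =
    ssig S (fun i => q ^+ i) (ssig S (fun i => 1 - q ^+ i) f).
  move: f; apply: sm_ind => [x f g IHf IHg | | | r f IHf].
  - by rewrite !(rmorphD, ssigZ) IHf IHg.
  - by rewrite !rmorph0.
  - by rewrite !rmorph1.
  - rewrite !rmorphM /= IHf !ssig_p !ssigZ !ssig_p !scalerA.
    by congr (_ *: _ * _); exact: mulrC.
rewrite comm; have [l [Pl ->]] := H_q pm.
rewrite rmorph_sum scaler_sumr; apply: eq_big_seq => x xl.
have [_ sx _] := Pl x xl.
by rewrite ssigZ ssig_pow_schur // sx !scalerA mulrC.
Qed.

Lemma M_neq0 : M != 0.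
Proof. by apply: mulf_neq0; [exact: (c_t 0) | exact: (c_q 0)]. Qed.

Lemma M'_neq0 : M' != 0.
Proof.
apply: mulf_neq0.
  exact: (oneB_expS_neq0 0 (indep_inv (indep_sym qt))).
exact: (oneB_expS_neq0 0 (indep_inv qt)).
Qed.

Lemma lam_diff mu nu : lam q t nu - lam q t mu = - M * (Bsum q t nu - Bsum q t mu).
Proof. by rewrite !lamE /Mk !expr1; ring. Qed.

Lemma lam'_diff mu nu : lam q^-1 t^-1 nu - lam q^-1 t^-1 mu =
  - M' * (Bsum q^-1 t^-1 nu - Bsum q^-1 t^-1 mu).
Proof. by rewrite !lamE /Mdual !expr1; ring. Qed.

(** The components y_nu of e_1 H_mu, possibly zero, replace Pieri coefficients. Commuting e_1 with
    D_0 and D*_0 yields D_1 H_mu and D*_1 H_mu on the same components with weights -x_nu and 1/x_nu,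
    where x_nu = B_nu - B_mu. *)
Lemma pieri mu : is_part mu -> exists r (y : seq nat -> S) (x : seq nat -> F),
  [/\ p1 * H mu = \sum_(nu <- r) y nu,
      D 1 (H mu) = - \sum_(nu <- r) x nu *: y nu,
      Ds 1 (H mu) = \sum_(nu <- r) (x nu)^-1 *: y nu
    & forall nu, nu \in r -> nab (y nu) =
        (t ^+ pweight mu * q ^+ colweight mu * x nu) *: y nu /\
        (y nu != 0 -> x nu != 0)].
Proof.
move=> pm; have [r [c [ur Pr e]]] := lin_span_uniq (H_span (p1 * H mu)).
pose y nu := c nu *: H nu.
pose x nu := Bsum q t nu - Bsum q t mu.
pose x' nu := Bsum q^-1 t^-1 nu - Bsum q^-1 t^-1 mu.
have Dy nu : nu \in r -> D 0 (y nu) = lam q t nu *: y nu.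
  by move=> nr; rewrite linearZ /= D0_eigen ?Pr // !scalerA mulrC.
have Dsy nu : nu \in r -> Ds 0 (y nu) = lam q^-1 t^-1 nu *: y nu.
  by move=> nr; rewrite linearZ /= Ds0_eigen ?Pr // !scalerA mulrC.
have Gy nu : nu \in r -> ssig S (fun i => q ^+ i) (y nu) = q ^+ sumn nu *: y nu.
  by move=> nr; rewrite ssigZ H_grade ?Pr // !scalerA mulrC.
have ny nu : nu \in r ->
    nab (y nu) = (t ^+ pweight nu * q ^+ colweight nu) *: y nu.
  by move=> nr; rewrite linearZ /= nabE ?Pr // !scalerA mulrC.
have {}e : p1 * H mu = \sum_(nu <- r) y nu by [].
clearbody y.
have inj : {in r &, injective (lam q t)}.
  by move=> a b ar br; apply: lam_inj qt (Pr a ar) (Pr b br).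
have indepy (w : seq nat -> F) : \sum_(nu <- r) w nu *: y nu = 0 ->
    forall nu, nu \in r -> w nu *: y nu = 0.
  apply: (eigen_independent (D := D 0) ur inj) => nu nr.
  by rewrite linearZ /= Dy // !scalerA mulrC.
(* The passage rule for p_1 reads [D_0, p_1] = M D_1; the dual rule below has the opposite sign. *)
have D1 : M *: D 1 (H mu) = \sum_(nu <- r) (lam q t nu - lam q t mu) *: y nu.
  have := Dv_psum t q 0 0 (H mu); rewrite add0r e linear_sum D0_eigen //.
  rewrite (eq_big_seq (fun nu => lam q t nu *: y nu)); last by move=> nu /Dy.
  rewrite [p1 * _]mulrC -scalerAl [H mu * _]mulrC e scaler_sumr => E.
  under eq_bigr => nu _ do rewrite scalerBl.
  by rewrite sumrB E addrAC subrr add0r.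
have Ds1 : M' *: Ds 1 (H mu) =
    - \sum_(nu <- r) (lam q^-1 t^-1 nu - lam q^-1 t^-1 mu) *: y nu.
  have := Dstar_psum t q 0 0 (H mu); rewrite add0r e linear_sum Ds0_eigen //.
  rewrite (eq_big_seq (fun nu => lam q^-1 t^-1 nu *: y nu)); last by move=> nu /Dsy.
  rewrite [p1 * _]mulrC -scalerAl [H mu * _]mulrC e scaler_sumr => E.
  under eq_bigr => nu _ do rewrite scalerBl.
  by rewrite sumrB E addrAC subrr add0r opprK.
(* X -> qX multiplies e_1 H_mu by q^(|mu|+1), and the components are independent. *)
have grade nu : nu \in r -> y nu != 0 -> sumn nu = (sumn mu).+1.
  move=> nr y0; have := indepy (fun nu => q ^+ sumn nu - q ^+ (sumn mu).+1) _ nu nr.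
  have z : \sum_(nu <- r) (q ^+ sumn nu - q ^+ (sumn mu).+1) *: y nu = 0.
    under eq_bigr => ka _ do rewrite scalerBl.
    rewrite sumrB -scaler_sumr -e; apply/eqP; rewrite subr_eq0; apply/eqP.
    have := congr1 (ssig S (fun i => q ^+ i)) e.
    rewrite rmorphM ssig_p H_grade // expr1 rmorph_sum => E.
    rewrite exprS -scalerA -[q ^+ _ *: (p1 * _)](_ : p1 * (q ^+ sumn mu *: H mu) = _).
      rewrite scalerAl E; apply: eq_big_seq => ka kr; by rewrite Gy.
    by rewrite mulrC -scalerAl mulrC.
  move=> /(_ z)/eqP; rewrite scaler_eq0 (negPf y0) orbF subr_eq0 => /eqP E.
  have := @indep_exp _ q t (sumn nu) 0 (sumn mu).+1 0 qt.
  by rewrite !expr0 !mulr1 => /(_ E)[].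
(* Comparing components in [D*_0, D_1] = M' p_1 at H_mu shows that the product of the two eigenvalue
   differences is M M'; these differences are -M x_nu and -M' x'_nu. *)
have unit nu : nu \in r -> y nu != 0 -> x nu * x' nu = 1.
  move=> nr y0; have := indepy (fun nu => (lam q^-1 t^-1 nu - lam q^-1 t^-1 mu) *
      (lam q t nu - lam q t mu) - M * M') _ nu nr.
  have z : \sum_(nu <- r) ((lam q^-1 t^-1 nu - lam q^-1 t^-1 mu) *
      (lam q t nu - lam q t mu) - M * M') *: y nu = 0.
    under eq_bigr => ka _ do rewrite scalerBl -scalerA.
    rewrite sumrB -scaler_sumr -e; apply/eqP; rewrite subr_eq0; apply/eqP.
    have := Dstar0_Dv1_comm t0 q0 (H mu); rewrite Ds0_eigen // [D 1 (_ *: _)]linearZ /= => C.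
    have -> : (M * M') *: (p1 * H mu) =
        Ds 0 (M *: D 1 (H mu)) - lam q^-1 t^-1 mu *: (M *: D 1 (H mu)).
      by rewrite -scalerA -C scalerBr [Ds 0 (M *: _)]linearZ /= !scalerA
        [M * lam _ _ _]mulrC.
    rewrite D1 [Ds 0 (\sum_(_ <- _) _)]linear_sum scaler_sumr -sumrB; apply: eq_big_seq => ka kr.
    by rewrite /= [Ds 0 (_ *: _)]linearZ /= Dsy // !scalerA -scalerBl; congr (_ *: _); ring.
  move=> /(_ z)/eqP; rewrite scaler_eq0 (negPf y0) orbF subr_eq0 => /eqP.
  rewrite lam_diff lam'_diff -/(x nu) -/(x' nu) => E.
  apply: (@mulfI _ (M * M')); first by rewrite mulf_neq0 ?M_neq0 ?M'_neq0.
  by rewrite mulr1 -[RHS]E; ring.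
have xinv nu : nu \in r -> x' nu *: y nu = (x nu)^-1 *: y nu.
  move=> nr; have [->|y0] := eqVneq (y nu) 0; first by rewrite !scaler0.
  have U := unit nu nr y0; have x0 : x nu != 0.
    by apply/eqP => x0; move: U; rewrite x0 mul0r => /eqP; rewrite eq_sym oner_eq0.
  by congr (_ *: _); apply: (mulfI x0); rewrite U mulfV.
exists r, y, x; split.
- exact: e.
- apply: (scalerI M_neq0); rewrite D1 scalerN scaler_sumr -sumrN; apply: eq_bigr => nu _.
  by rewrite lam_diff scalerA -scaleNr mulNr.
- apply: (scalerI M'_neq0); rewrite Ds1 scaler_sumr -sumrN; apply: eq_big_seq => nu nr.
  by rewrite lam'_diff -xinv // scalerA -scaleNr mulNr opprK.
move=> nu nr; have [y0|y0] := eqVneq (y nu) 0.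
  by split=> //; rewrite y0 linear0 scaler0.
have U := unit nu nr y0.
have [a [b [xE _ pw cw]]] := Bsum_diff_unit qt pm (Pr nu nr) (grade nu nr y0) U.
split=> [|_]; last first.
  by apply/eqP => x0; move: U; rewrite x0 mul0r => /eqP; rewrite eq_sym oner_eq0.
rewrite ny //; congr (_ *: _).
by rewrite /x xE pw cw !exprD; ring.
Qed.

Lemma nab_p1 f : nab (p1 * f) = - D 1 (nab f).
Proof.
move: (H_span f).
apply: (lin_span_ind (R := fun f => nab (p1 * f) = - D 1 (nab f)))
  => {f} [c f g IHf IHg | | mu pm].
- rewrite mulrDr [p1 * (c *: f)]mulrC -scalerAl [f * p1]mulrC.
  rewrite [nab (_ + p1 * g)]linearP IHf IHg [nab (_ + g)]linearP [D 1 (_ + _)]linearP /=.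
  by rewrite opprD scalerN.
- by rewrite mulr0 linear0 [D 1 0]linear0 oppr0.
have [r [y [x [e1 e2 _ e4]]]] := pieri pm.
rewrite nabE // [D 1 (_ *: _)]linearZ /= e2 scalerN opprK e1 linear_sum scaler_sumr.
by apply: eq_big_seq => nu nr; rewrite (e4 nu nr).1 scalerA.
Qed.

Lemma nab_Ds1 f : nab (Ds 1 f) = p1 * nab f.
Proof.
move: (H_span f).
apply: (lin_span_ind (R := fun f => nab (Ds 1 f) = p1 * nab f))
  => {f} [c f g IHf IHg | | mu pm].
- rewrite [Ds 1 _]linearP [nab (_ + Ds 1 g)]linearP [nab (_ + g)]linearP /= IHf IHg.
  by rewrite mulrDr [p1 * (c *: _)]mulrC -scalerAl [nab f * p1]mulrC.
- by rewrite [Ds 1 0]linear0 linear0 mulr0.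
have [r [y [x [e1 _ e3 e4]]]] := pieri pm.
rewrite nabE // [RHS]mulrC -scalerAl [H mu * _]mulrC e1 e3 linear_sum scaler_sumr.
apply: eq_big_seq => nu nr; have [en xn] := e4 nu nr; rewrite linearZ /= en scalerA.
have [->|y0] := eqVneq (y nu) 0; first by rewrite !scaler0.
by rewrite mulrC mulfK ?xn.
Qed.

(** The polynomial H of the empty partition is a nonzero constant, and its weight is an empty
    product. *)
Lemma nab1 : nab 1 = 1.
Proof.
have p0 : is_part [::] by [].
have [l [Pl e]] := H_q p0.
have eH : ssig S (fun i => 1 - q ^+ i) (H [::]) = (\sum_(x <- l) x.1) *: 1.
  rewrite e scaler_suml; apply: eq_big_seq => x xl; have [pn sn _] := Pl x xl.
  have -> : x.2 = [::].
    by apply/eqP; rewrite -size_eq0 -leqn0 (leq_trans (size_le_sumn pn)) // sn.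
  by rewrite /sschur /jt det_mx00.
have {}eH : H [::] = (\sum_(x <- l) x.1) *: 1.
  by apply: inj_q; rewrite eH ssigZ rmorph1.
have c0 : \sum_(x <- l) x.1 != 0.
  by apply/eqP => c0; have := H_neq0 p0; rewrite eH c0 scale0r eqxx.
apply: (scalerI c0); rewrite -linearZ /= -eH nabE //.
by rewrite /pweight /colweight !big_ord0 !expr0 mulr1 scale1r.
Qed.

(** [Qrec m] is Q_(m+1,m+2), starting from Q_(1,2) = D_2 and splitting off (1,1) at every step. *)
Fixpoint Qrec (m : nat) (f : S) : S :=
  if m is m'.+1 then M^-1 *: (Qrec m' (D 1 f) - D 1 (Qrec m' f)) else D 2 f.

Lemma QrecN m f : Qrec m (- f) = - Qrec m f.
Proof.
elim: m f => [|m IHm] f /=; first exact: linearN.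
by rewrite [D 1 (- f)]linearN !IHm [D 1 (- _)]linearN opprK -scalerN opprB addrC.
Qed.

(* Conjugation by nabla turns D*_1 into multiplication by e_1 and the latter into
   -D_1, so it carries the recursion for D*_n to the one for Q_(n-1,n). *)
Lemma nab_Dstar m f : nab (Ds m.+2%:Z f) = - (t * q) ^+ m.+1 *: Qrec m (nab f).
Proof.
have eM : M = t * q * M' by have := Mk_Mdual t0 q0 1; rewrite expr1.
have DsS (k : nat) g : nab (Ds k.+1%:Z g) = M'^-1 *: (nab (p1 * Ds k g) - nab (Ds k (p1 * g))).
  have := Dstar_psum t q k 0 g; rewrite -PoszD addn1 => E.
  by rewrite -linearB E opprB addrC subrK -linearZ /= scalerA mulVf ?M'_neq0 ?scale1r.
elim: m f => [|m IHm] f.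
  (* For D*_2 the conjugated commutator is that of p_1 with D_1, a multiple of D_2 by the passage
     rule; M = tq M' supplies the scalar. *)
  rewrite DsS nab_p1 !nab_Ds1 nab_p1 /= mulrN opprK.
  have := Dv_psum t q 1 0 (nab f); rewrite -PoszD addn1 => E.
  rewrite E opprD addrAC addNr add0r scalerN scalerA eM expr1 scaleNr.
  by congr (- (_ *: _)); rewrite mulrC mulfK ?M'_neq0.
rewrite DsS nab_p1 !IHm nab_p1 QrecN [D 1 (_ *: _)]linearZ /=.
move: (D 1 (Qrec m (nab f))) (Qrec m (D 1 (nab f))) => A B.
rewrite !(scaleNr, scalerN, opprK) -scalerBr !scalerA -[B - A]opprB scalerN opprK.
have -> : (t * q) ^+ m.+2 = t * q * (t * q) ^+ m.+1 by exact: exprS.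
congr (_ *: _); rewrite eM; have := M'_neq0; move: M' ((t * q) ^+ m.+1) => w z w0.
by field; rewrite t0 q0 w0.
Qed.

Lemma nab_hom m : nab (sh S m.+2) = - (t * q) ^+ m.+1 *: Qrec m 1.
Proof.
have := nab_Dstar m 1; rewrite nab1 => <-; congr (nab _).
by rewrite /Dstar Vop1 /= ssig1.
Qed.
End Nabla.

(** * The ring [Sym] as a model of the abstract setting *)

Lemma size_h_upto n : size (h_upto n) = n.+1.
Proof. by elim: n => //= n IHn; rewrite size_rcons IHn. Qed.

Lemma nth_h_upto n i : (i <= n)%N -> nth 0 (h_upto n) i = hom i.
Proof.
elim: n => [|n IHn]; first by rewrite leqn0 => /eqP->.
rewrite leq_eqVlt => /orP[/eqP-> //|]; rewrite ltnS => le_in.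
by rewrite /= nth_rcons size_h_upto ltnS le_in IHn.
Qed.

Lemma size_e_upto n : size (e_upto n) = n.+1.
Proof. by elim: n => //= n IHn; rewrite size_rcons IHn. Qed.

Lemma nth_e_upto n i : (i <= n)%N -> nth 0 (e_upto n) i = elem i.
Proof.
elim: n => [|n IHn]; first by rewrite leqn0 => /eqP->.
rewrite leq_eqVlt => /orP[/eqP-> //|]; rewrite ltnS => le_in.
by rewrite /= nth_rcons size_e_upto ltnS le_in IHn.
Qed.

Lemma nat_mul_invS n (x : Sym) : n.+1%:R * ((n.+1%:R : Fqt)^-1 *: x) = x.
Proof. by rewrite mulr_natl -scaler_nat scalerA mulfV ?scale1r ?Fqt_nat_neq0. Qed.

Lemma newton_hom : newton psum hom.
Proof.
split=> // n; rewrite {1}/hom /= nth_rcons size_h_upto ltnn eqxx nat_mul_invS.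
by apply: eq_bigr => i _; rewrite nth_h_upto ?leq_subr.
Qed.

(** This is (-1)^n e_n = h_n[-X]: the signs turn the recursion for e into the one for h. *)
Lemma newton_sign (R : comNzRingType) (p e : nat -> R) : e 0%N = 1 ->
  (forall n, n.+1%:R * e n.+1 =
     \sum_(i < n.+1) ((-1) ^+ i * e (n - i)%N * p i.+1)) ->
  newton (fun k => - p k) (fun n => (-1) ^+ n * e n).
Proof.
move=> e0 eS; split=> [|n]; first by rewrite e0 mulr1.
rewrite mulrCA eS mulr_sumr; apply: eq_bigr => i _.
have -> : (-1) ^+ n.+1 = - ((-1) ^+ (n - i) * (-1) ^+ i) :> R.
  by rewrite -exprD subnK -1?ltnS // exprS mulN1r.
rewrite !mulNr mulrN; congr (- _); rewrite -!mulrA; congr (_ * _).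
exact: signrMK.
Qed.

Lemma newton_elem :
  newton (fun k => - psum k) (fun n => (-1) ^+ n * elem n).
Proof.
apply: newton_sign => // n.
rewrite {1}/elem /= nth_rcons size_e_upto ltnn eqxx nat_mul_invS.
by apply: eq_bigr => i _; rewrite nth_e_upto // leq_subr.
Qed.

Section Operators.
Implicit Types (a b : nat -> Fqt) (k : int) (f g : Sym) (A B : {poly Sym}).

Definition sig b : Sym -> Sym :=
  pleth cst (fun i => cst (b i) * psum i).

HB.instance Definition _ b := GRing.RMorphism.copy (sig b)
  (pleth cst (fun i => cst (b i) * psum i) : Sym -> Sym).

Definition tau a : Sym -> {poly Sym} :=
  pleth (polyC \o cst) (fun i => (psum i)%:P + (cst (a i))%:P * 'X^i).

HB.instance Definition _ a := GRing.RMorphism.copy (tau a)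
  (pleth (polyC \o cst) (fun i => (psum i)%:P + (cst (a i))%:P * 'X^i)
   : Sym -> {poly Sym}).

Lemma sig_psum b i : sig b (psum i.+1) = b i.+1 *: psum i.+1.
Proof. by rewrite -cst_scale; exact: pleth_psum. Qed.

Lemma sigZ b c f : sig b (c *: f) = c *: sig b f.
Proof. by rewrite -[RHS]cst_scale; exact: pleth_scale. Qed.

Lemma tau_psum a i :
  tau a (psum i.+1) = (psum i.+1)%:P + (cst (a i.+1))%:P * 'X^(i.+1).
Proof. exact: pleth_psum. Qed.

Lemma tauZ a c f : tau a (c *: f) = (cst c)%:P * tau a f.
Proof. exact: pleth_scale. Qed.

Lemma newton_sig b : newton (fun i => b i *: psum i) (sig b \o hom).
Proof.
apply: eq_newton (newton_morph (sig b) newton_hom) => // i /=.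
exact: sig_psum.
Qed.
End Operators.

Lemma sig_homz_newton b x : newton (fun i => b i *: psum i) x ->
  forall n, sig b (hom n) = x n.
Proof. by move=> nx n; apply: (newton_uniq Sym_torsion_free (newton_sig b) nx). Qed.

Lemma sgn_elemzE k : sgn_elemz k = sig (fun=> -1) (homz k).
Proof.
case: k => n /=; last by rewrite rmorph0.
apply/esym; move: n; apply: sig_homz_newton; apply: eq_newton newton_elem => // i.
by rewrite scaleN1r.
Qed.

Lemma in_alg_cst c : in_alg Sym c = cst c.
Proof. by rewrite -[cst c]mulr1 cst_scale. Qed.

Lemma tauZ_alg a c f : tau a (c *: f) = (in_alg Sym c)%:P * tau a f.
Proof. by rewrite in_alg_cst tauZ. Qed.

Lemma tau_psum_alg a i :
  tau a (psum i.+1) = (psum i.+1)%:P + (in_alg Sym (a i.+1))%:P * 'X^(i.+1).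
Proof. by rewrite in_alg_cst tau_psum. Qed.

Definition SymM : sym_model Fqt :=
  @SymModel Fqt Sym psum hom (fun b => sig b) (fun a => tau a) Sym_torsion_free
    Sym_ind newton_hom sigZ sig_psum tauZ_alg tau_psum_alg.

Lemma homzE z : homz z = shz SymM z.
Proof. by case: z. Qed.

Lemma schurE la : schur la = sschur SymM la.
Proof.
by congr (\det _); apply/matrixP => i j; rewrite !mxE /jt_entry -homzE.
Qed.

Lemma DopE k f : Dop k f = @Dv Fqt SymM tv qv k f.
Proof.
rewrite /Dv /Vop /Lz /Dop; apply: eq_bigr => j _.
by rewrite sgn_elemzE homzE.
Qed.

(** * Independence of q and t, arms and legs, and the lattice splitting *)

Lemma coef_polyXY (R : comNzRingType) (z : int) a b i j :
  (z%:~R * (('X : {poly R})%:P ^+ a * 'X^b))`_j`_i =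
  z%:~R * ((i == a) && (j == b))%:R.
Proof.
have intP (T : comNzRingType) : z%:~R = (z%:~R)%:P :> {poly T} by rewrite rmorph_int.
rewrite intP -rmorphXn mulrA -polyCM coefCM coefXn; case: (j == b); last first.
  by rewrite mulr0 coef0 andbF mulr0.
by rewrite mulr1 intP coefCM coefXn andbT.
Qed.

Lemma poly2_indep N (c : nat -> nat -> int) :
  \sum_(i < N) \sum_(j < N) (c i j)%:~R * ((('X : {poly rat})%:P) ^+ i * 'X^j) = 0 ->
  forall i j, (i < N)%N -> (j < N)%N -> c i j = 0.
Proof.
move=> e i j iN jN; have := congr1 (fun p : {poly {poly rat}} => p`_j`_i) e.
rewrite !coef0 !coef_sum (bigD1 (Ordinal iN)) //= [X in _ + X]big1 => [|a ai].
  rewrite addr0 !coef_sum (bigD1 (Ordinal jN)) //= [X in _ + X]big1 => [|b bj].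
    by rewrite addr0 coef_polyXY !eqxx mulr1 => /eqP; rewrite intr_eq0 => /eqP.
  rewrite coef_polyXY; rewrite -val_eqE /= eq_sym in bj.
  by rewrite (negPf bj) andbF mulr0.
rewrite !coef_sum big1 // => b _; rewrite coef_polyXY.
by rewrite -val_eqE /= eq_sym in ai; rewrite (negPf ai) mulr0.
Qed.

Lemma qt_indep : indep qv tv.
Proof.
move=> N c e; apply: poly2_indep.
apply/eqP; rewrite -(@tofrac_eq0 {poly {poly rat}}); apply/eqP; rewrite -[RHS]e.
rewrite rmorph_sum; apply: eq_bigr => i _.
rewrite rmorph_sum; apply: eq_bigr => j _.
by rewrite rmorphM rmorph_int rmorphM !rmorphXn.
Qed.

(** Prepending a row adds the size of the remaining rows to both sides: to the legs by counting
    cells below the new row, to the weight because every row index rises by one. *)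
Lemma sum_leg_pweight mu : is_part mu -> sum_leg mu = pweight mu.
Proof.
elim: mu => [|x mu IH] pm; first by rewrite /sum_leg /pweight !big_ord0.
have pmu : is_part mu.
  by case/andP: pm => /= /path_sorted s /andP[_ a]; apply/andP.
have -> : sum_leg (x :: mu) = (sumn mu + sum_leg mu)%N.
  rewrite /sum_leg big_ord_recl /= drop0; congr (_ + _)%N.
  have le_x i : (nth 0 mu i <= x)%N by apply: (@is_part_nth (x :: mu) 0 i.+1 pm).
  transitivity (\sum_(j < x) \sum_(r < size mu) (j < nth 0 mu r))%N.
    apply: eq_bigr => j _; rewrite -sum1_count (big_nth 0%N) big_mkord big_mkcond.
    by apply: eq_bigr => r _; case: ltnP.
  rewrite exchange_big sumnE /psum_of; apply: eq_bigr => r _.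
  under eq_bigr => c _ do rewrite -[nat_of_bool _]muln1.
  by rewrite (sum_cells (fun=> 1%N)) // sum1_card card_ord.
rewrite IH // /pweight /= big_ord_recl mul0n add0n sumnE /psum_of -big_split.
by apply: eq_bigr => r _; rewrite /= mulSn.
Qed.

Lemma sum_arm_colweight mu : sum_arm mu = colweight mu.
Proof.
apply: eq_bigr => r _; rewrite (reindex_inj rev_ord_inj); apply: eq_bigr => c _ /=.
by have := ltn_ord c; move: (nat_of_ord c) => j; lia.
Qed.

(** Strictly below the segment [lat_dist] is at least 1, and the point (1,1) attains it; [find]
    returns the first minimiser, here the head of the list. *)
Lemma split_a_diag m : (1 < m)%N -> split_a m m.+1 = 1%N.
Proof.
case: m => [|[|m]] // _.
have lat1 a : (0 < a)%N -> (1 <= lat_dist m.+2 m.+3 a)%N.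
  move=> a0; rewrite /lat_dist /best_b subn_gt0.
  have := leq_divM (a * m.+3).-1 m.+2; have : (0 < a * m.+3)%N by rewrite muln_gt0 a0.
  move: (a * m.+3)%N => y; move: (y.-1 %/ m.+2 * m.+2)%N => x; lia.
have H1 : all (fun a => lat_dist m.+2 m.+3 1 <= lat_dist m.+2 m.+3 a)%N (iota 1 m.+1).
  apply/allP => a; rewrite mem_iota => /andP[a1 _].
  suff -> : lat_dist m.+2 m.+3 1 = 1%N by apply: lat1.
  by rewrite /lat_dist /best_b mul1n /= divnn mul1n; lia.
rewrite /split_a -[m.+2.-1]/(m.+1).
set p := (fun a => all _ _); have p1 : p 1%N by exact: H1.
by rewrite /= p1.
Qed.

Lemma split_b_diag m : (1 < m)%N -> split_b m m.+1 = 1%N.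
Proof.
by move=> m1; rewrite /split_b split_a_diag // /best_b mul1n /= divnn; case: m m1.
Qed.

Lemma Mqt_Mk : Mqt = Mk tv qv 1.
Proof. by rewrite /Mk !expr1. Qed.

Lemma Qfuel_diag fuel m f : (m < fuel)%N ->
  Qfuel fuel m.+1 m.+2 f = Qrec tv qv m (f : SymM).
Proof.
elim: m fuel f => [|m IHm] [|fuel] f lt_m; try by exfalso; rewrite ltn0 in lt_m.
  rewrite -[LHS]/(Dop 2%N%:Z f) -[RHS]/(@Dv Fqt SymM tv qv 2 f).
  exact: DopE.
have Q11 g : Qfuel fuel 1 1 g = @Dv Fqt SymM tv qv 1 g.
  case: fuel lt_m {IHm} => [|fuel] lt_m; first by exfalso.
  rewrite -[LHS]/(Dop 1%N%:Z g); exact: DopE.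
rewrite -[LHS]/(Mqt^-1 *: (Qfuel fuel (m.+2 - split_a m.+2 m.+3) (m.+3 - split_b m.+2 m.+3)
    (Qfuel fuel (split_a m.+2 m.+3) (split_b m.+2 m.+3) f) -
  Qfuel fuel (split_a m.+2 m.+3) (split_b m.+2 m.+3)
    (Qfuel fuel (m.+2 - split_a m.+2 m.+3) (m.+3 - split_b m.+2 m.+3) f))).
rewrite split_a_diag; last by [].
rewrite split_b_diag; last by [].
rewrite !subSS !subn0 !Q11 (IHm fuel _ lt_m) (IHm fuel _ lt_m) Mqt_Mk.
exact: erefl.
Qed.

(** * The evaluation z = 1/q and the resulting formula for E_(n,1) *)

Definition Eimg (k : nat) : {poly Sym} :=
  (cst ((1 - qv ^+ k)^-1) * psum k)%:P * (1 - 'X^k).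

(** The point z = 1/q is the root of the second factor of (z;q)_k, so only k = 1 survives in the
    defining sum. *)
Definition Eeval : Sym -> Sym :=
  horner_eval (cst qv^-1) \o pleth (polyC \o cst) Eimg.

HB.instance Definition _ := GRing.RMorphism.copy Eeval
  (horner_eval (cst qv^-1) \o pleth (polyC \o cst) Eimg).

Lemma oneB_inv_ratio (F : fieldType) (x : F) k : x != 0 -> 1 - x ^+ k != 0 ->
  (1 - x ^+ k)^-1 * (1 - x^-1 ^+ k) = - x^-1 ^+ k.
Proof.
move=> x0; rewrite exprVn; have := expf_neq0 k x0; move: (x ^+ k) => y y0 y1.
by field; rewrite y0 y1.
Qed.

Lemma scale_mul_cst a c (x : Sym) : (a *: x) * cst c = (a * c) *: x.
Proof. by rewrite mulrC cst_scale scalerA mulrC. Qed.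

Lemma horner_oneB_Xn (R T : comNzRingType) (f : {rmorphism R -> T}) x k :
  (1 - 'X^k).[f x] = f (1 - x ^+ k).
Proof. by rewrite !hornerE rmorphB rmorph1 rmorphXn. Qed.

Lemma horner_prod_lin (R T : comNzRingType) (f : {rmorphism R -> T}) x y k :
  (\prod_(i < k) (1 - (f (y ^+ i))%:P * 'X)).[f x] = f (\prod_(i < k) (1 - y ^+ i * x)).
Proof.
rewrite horner_prod rmorph_prod; apply: eq_bigr => i _.
by rewrite !hornerE rmorphB rmorph1 rmorphM.
Qed.

Lemma horner_sum_first (R : comNzRingType) (c : nat -> R) (P : nat -> {poly R}) x n :
  (forall k, (1 < k)%N -> (P k).[x] = 0) ->
  (\sum_(1 <= k < n.+2) (c k)%:P * P k).[x] = c 1%N * (P 1%N).[x].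
Proof.
move=> P0; rewrite big_ltn // hornerD hornerM hornerC horner_sum big_nat big1 ?addr0 //.
by move=> k /andP[k1 _]; rewrite hornerM P0 // mulr0.
Qed.

(** At z = 1/q the alphabet X(1-z)/(1-q) is -X/q, which is why e_n turns into a multiple of h_n. *)
Lemma Eeval_psum k : Eeval (psum k.+1) = (- (qv^-1 ^+ k.+1)) *: psum k.+1.
Proof.
rewrite -[Eeval _]/((pleth (polyC \o cst) Eimg (psum k.+1)).[cst qv^-1]) pleth_psum.
rewrite /Eimg hornerM hornerC horner_oneB_Xn mulrAC -(rmorphM cst) cst_scale.
rewrite (oneB_inv_ratio (indep_neq0 qt_indep) (oneB_expS_neq0 k qt_indep)).
exact: erefl.
Qed.

Lemma EevalN x : Eeval (- x) = - Eeval x. Proof. exact: rmorphN. Qed.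

Lemma Eeval_sign n x : Eeval ((-1) ^+ n * x) = (-1) ^+ n * Eeval x.
Proof. by rewrite rmorphM rmorphXn rmorphN1. Qed.

Lemma Eeval_elem n : (-1) ^+ n * Eeval (elem n) = qv^-1 ^+ n *: hom n.
Proof.
have n1 := newton_morph Eeval newton_elem.
have n2 := newton_scale (cst qv^-1) newton_hom.
have n3 : newton (Eeval \o (fun k => - psum k)) (fun n => cst qv^-1 ^+ n * hom n).
  apply: eq_newton n2 => [k | k]; last exact: erefl.
  rewrite -[RHS]/(Eeval (- psum k.+1)) EevalN Eeval_psum scaleNr opprK.
  by rewrite -(rmorphXn cst) cst_scale.
have := newton_uniq Sym_torsion_free n1 n3 n.
rewrite -[(Eeval \o _) n]/(Eeval ((-1) ^+ n * elem n)) Eeval_sign => ->.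
by rewrite -(rmorphXn cst) cst_scale.
Qed.

Lemma qq_poch1 : qq_poch 1 = 1 - qv.
Proof. by rewrite /qq_poch big_ord1 expr1. Qed.

Lemma E_family_1 n E : is_E_family n.+1 E -> Eeval (elem n.+1) = (- qv^-1) *: E 1%N.
Proof.
move=> /(congr1 (fun p : {poly Sym} => p.[cst qv^-1])).
rewrite -[LHS]/(Eeval (elem n.+1)) => ->.
have q0 := indep_neq0 qt_indep.
rewrite (@horner_sum_first Sym (fun k => (qq_poch k)^-1 *: E k)) => [|[|[|k]] // _].
  rewrite /zq_poch (horner_prod_lin cst qv^-1 qv) big_ord1 expr0 mul1r.
  have x1 : 1 - qv ^+ 1 != 0 := oneB_expS_neq0 0 qt_indep.
  have := oneB_inv_ratio q0 x1; rewrite !expr1 => sc.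
  rewrite scale_mul_cst qq_poch1 sc.
  exact: erefl.
rewrite /zq_poch (horner_prod_lin cst qv^-1 qv) big_ord_recl big_ord_recl /=.
by rewrite expr1 mulfV // subrr mul0r mulr0 rmorph0.
Qed.

(** Here z is the sign. The factors are -q from inverting (1 - 1/q)/(1 - q), q^-(n+2) from the
    evaluation of e_(n+2), and -(tq)^(n+1) from nabla. *)
Lemma final_scalar (F : fieldType) (q t z : F) n : q != 0 ->
  (- q^-1)^-1 * (z * q^-1 ^+ n.+2) * - (t * q) ^+ n.+1 = t ^+ n.+1 * z.
Proof.
move=> q0; rewrite invrN invrK exprMn exprVn [q ^+ n.+2]exprS.
have := expf_neq0 n.+1 q0; move: (q ^+ n.+1) (t ^+ n.+1) => x y x0.
by field; rewrite ?q0 ?x0 ?mulf_neq0.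
Qed.

Lemma solve_sign_scale (F : fieldType) (A : comAlgType F) (x e h : A) (a b : F) m :
  b != 0 -> (-1) ^+ m * x = a *: h -> x = b *: e -> e = (b^-1 * ((-1) ^+ m * a)) *: h.
Proof.
move=> b0 ex xe; rewrite -!scalerA -ex xe (_ : (-1) ^+ m *: _ = b *: e).
  by rewrite scalerA mulVf // scale1r.
by rewrite -(signr_odd F m) -(signr_odd A m); case: (odd m);
  rewrite ?expr1 ?expr0 ?scaleN1r ?scale1r ?mulN1r ?mul1r ?opprK.
Qed.

Lemma Qrec_sign (F : fieldType) (S : sym_model F) (t q : F) m k :
  Qrec t q m ((-1) ^+ k : S) = (-1) ^+ k *: Qrec t q m 1.
Proof.
rewrite -signr_odd -[in RHS]signr_odd; case: (odd k); last by rewrite !expr0 scale1r.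
by rewrite !expr1 QrecN scaleN1r.
Qed.

Theorem theorem4 (n : nat) (n_ge2 : (2 <= n)%N)
  (H : seq nat -> Sym)
  (H_mac : forall mu, is_part mu -> is_modMacdonald mu (H mu))
  (nab : {linear Sym -> Sym}) (nab_def : is_nabla H nab)
  (E : nat -> Sym) (E_def : is_E_family n E) :
  nab (E 1%N) = tv ^+ n.-1 *: Qop n.-1 n ((-1) ^+ n).
Proof.
have H_q mu : is_part mu -> lin_span (sschur SymM) (ge_part mu)
    (ssig SymM (fun i => 1 - qv ^+ i) (H mu)).
  move=> pm; have [[l [Pl e]] _ _] := H_mac mu pm.
  exists l; split; first by move=> x /Pl[].
  rewrite -[LHS]/(pleth_X1mq (H mu)) e.
  by apply: eq_bigr => x _; rewrite schurE.
have H_t mu : is_part mu -> lin_span (sschur SymM) (ge_part (conj_part mu))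
    (ssig SymM (fun i => 1 - tv ^+ i) (H mu)).
  move=> pm; have [_ [l [Pl e]] _] := H_mac mu pm.
  exists l; split.
    by move=> x /Pl[px sx dx]; split=> //; rewrite sumn_conj.
  rewrite -[LHS]/(pleth_X1mt (H mu)) e.
  by apply: eq_bigr => x _; rewrite schurE.
(* The normalisation against the one-row Schur function excludes zero. *)
have H_neq0 mu : is_part mu -> H mu != 0.
  move=> pm; have [_ _] := H_mac mu pm; apply: contra_eqN => /eqP->.
  by rewrite /hall msupp0 big_seq_fset0 eq_sym oner_eq0.
have nabE mu : is_part mu ->
    nab (H mu) = (tv ^+ pweight mu * qv ^+ colweight mu) *: H mu.
  move=> pm; rewrite (nab_def mu pm) (sum_leg_pweight pm) sum_arm_colweight.
  exact: erefl.
case: n n_ge2 E_def => [|[|n]] n_ge2 E_def; try by exfalso.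
have hE : nab (hom n.+2) = - (tv * qv) ^+ n.+1 *: (Qrec tv qv n (1 : SymM) : Sym) :=
  @nab_hom Fqt SymM tv qv qt_indep H H_q H_t H_neq0 nab nabE n.
have q0 := indep_neq0 qt_indep.
have b0 : - qv^-1 != 0 by rewrite oppr_eq0 invr_eq0.
rewrite (solve_sign_scale b0 (Eeval_elem n.+2) (E_family_1 E_def)).
have nabZ c f : nab (c *: f) = c *: nab f by exact: linearZ.
rewrite nabZ hE /Qop (Qfuel_diag _ (ltnSn n)).
rewrite (Qrec_sign SymM tv qv n n.+2) !scalerA (final_scalar tv _ n q0).
exact: erefl.
Qed.
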